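(* There exists a unimodal map $f\in\mathcal{A}_*$ with critical point $c$ which has a wild attractor $\omega(c)$ such that $f:\omega(c)\to\omega(c)$ is topologically conjugate to an adding machine, and hence equicontinuous.
   Context: A continuous map $f:[0,1]\to[0,1]$ is unimodal if there is a unique $c\in(0,1)$ (the turning point, also called critical point) such that $f$ is strictly increasing on $[0,c]$ and strictly decreasing on $[c,1]$. $\mathcal{A}$ denotes the collection of unimodal maps $f$ that are $C^3$ outside $c$, satisfy $f'(x)\ne 0$ for $x\neq c$, and have $c$ non-flat: there exist $C^3$ local diffeomorphisms $\phi,\psi$ defined near $0$ with $\phi(0)=c$, $\psi(0)=f(c)$, and a real number $\ell>1$ such that $|\psi^{-1}\circ f\circ\phi(x)|=|x|^{\ell}$ for $|x|$ small. $\mathcal{A}_*$ is the collection of $f\in\mathcal{A}$ all of whose periodic points are hyperbolic repelling. A (minimal) metric attractor of $f$ is a compact (forward) invariant set $X\subset[0,1]$ such that $\{x\in[0,1]:\omega(x)\subset X\}$ has positive Lebesgue measure, but no invariant compact proper subset of $X$ has this property. A Cantor attractor is a metric attractor that is a Cantor set. A closed interval $I$ is restrictive if $c$ is in its interior and there is an integer $s\ge2$ (the period) such that $I,f(I),\dots,f^{s-1}(I)$ have pairwise disjoint interiors, $f^s(I)\subset I$ and $f^s(\partial I)\subset\partial I$. $f$ is infinitely renormalizable if there are restrictive intervals of arbitrarily large period. A wild attractor is a Cantor attractor of a map $f\in\mathcal{A}$ that is not infinitely renormalizable. Adding machine: for a sequence $\alpha=(p_1,p_2,\ldots)$ of integers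 $p_i\ge2$, let $\Delta_\alpha=\prod_i\{0,1,\ldots,p_i-1\}$ with the product topology. The adding machine $f_\alpha:\Delta_\alpha\to\Delta_\alpha$ is ''add one with carry'': $f_\alpha(x_1,x_2,\ldots)=(0,\ldots,0,x_l+1,x_{l+1},\ldots)$ (with $l-1$ leading zeros) if $x_i=p_i-1$ for $i<l$ and $x_l<p_l-1$; and $f_\alpha(x_1,x_2,\ldots)=(0,0,\ldots)$ if $x_i=p_i-1$ for all $i$. *)

(* Defs.v *)
From HB Require Import structures.
From mathcomp Require Import all_boot all_order all_algebra.
From mathcomp Require Import all_classical all_reals all_analysis.

Set Implicit Arguments.
Unset Strict Implicit.
Unset Printing Implicit Defensive.

Import Order.TTheory GRing.Theory Num.Theory.
Import numFieldNormedType.Exports.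

Local Open Scope classical_set_scope.
Local Open Scope ring_scope.

(* A map [0,1] -> [0,1] is a function f : R -> R which maps [0,1] to itself;
   every notion below depends only on the restriction of f to [0,1]. *)

Section interval_maps.
Context {R : realType}.
Implicit Types (A I X Y U V : set R) (f g : R -> R) (a b c x p : R).

Definition I01 : set R := `[0, 1]%classic.

(* Derivatives relative to A: at an end point of an interval they are one-sided,
   at an interior point of A they are the usual ones. *)
Definition diff_quot f x : R -> R := fun y => (f y - f x) / (y - x).

Definition derivable_in A f x := cvg (diff_quot f x @ within A x^').

Definition derive_in A f : R -> R :=
  fun x => lim (diff_quot f x @ within A x^').

Definition Cn_on A (n : nat) f :=
  (forall k x, (k < n)%N -> A x -> derivable_in A (iter k (derive_in A) f) x) /\
  {within A, continuous (iter n (derive_in A) f)}.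

(* g is a Cn diffeomorphism from a neighbourhood of a to a neighbourhood of b
   with g a = b, and h is its inverse; the values of g and h away from these
   neighbourhoods are irrelevant. *)
Definition local_diffeo (n : nat) a b g h :=
  exists U V, [/\ open U /\ open V, U a /\ g a = b, set_bij U V g,
    {in U, cancel g h} & Cn_on U n g /\ Cn_on V n h].

Definition turning_point f c :=
  [/\ 0 < c < 1,
      {in `[0, c] &, {homo f : x y / x < y >-> x < y}} &
      {in `[c, 1] &, {homo f : x y / x < y >-> y < x}}].

Definition unimodal f c :=
  [/\ f @` I01 `<=` I01, {within I01, continuous f} &
      unique (turning_point f) c].

Definition non_flat f c :=
  exists phi phi' psi psi' l, [/\ local_diffeo 3 0 c phi phi',
    local_diffeo 3 0 (f c) psi psi', 1 < l &
    \forall x \near (0 : R), `|psi' (f (phi x))| = `|x| `^ l].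

Definition class_A f c :=
  [/\ unimodal f c, Cn_on (I01 `\ c) 3 f,
      forall x, (I01 `\ c) x -> derive_in (I01 `\ c) f x != 0 &
      non_flat f c].

Definition has_period f p (n : nat) :=
  [/\ (0 < n)%N, iter n f p = p &
      forall m, (0 < m < n)%N -> iter m f p != p].

Definition hyperbolic_repelling f p (n : nat) :=
  derivable_in I01 (iter n f) p /\ 1 < `|derive_in I01 (iter n f) p|.

Definition class_A_star f c :=
  class_A f c /\
  forall p n, I01 p -> has_period f p n -> hyperbolic_repelling f p n.

Definition omega f x : set R := cluster (iter n f x @[n --> \oo]).

Definition basin f X : set R := [set x | I01 x /\ omega f x `<=` X].

(* The basin of a compact set is a Borel set. *)
Definition attracting f X :=
  [/\ X `<=` I01, compact X, f @` X `<=` X &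
      (0 < lebesgue_measure (basin f X))%E].

Definition metric_attractor f X :=
  attracting f X /\ forall Y, Y `<` X -> ~ attracting f Y.

Definition cantor_set X :=
  [/\ X !=set0, compact X, perfect_set X & totally_disconnected X].

Definition cantor_attractor f X := metric_attractor f X /\ cantor_set X.

Definition restrictive f c a b (s : nat) :=
  let I := `[a, b]%classic in
  [/\ I `<=` I01 /\ I° c, (2 <= s)%N,
      forall i j, (i < j < s)%N ->
        (iter i f @` I)° `&` (iter j f @` I)° = set0,
      iter s f @` I `<=` I &
      iter s f @` [set a; b] `<=` [set a; b]].

Definition infinitely_renormalizable f c :=
  forall N : nat, exists s a b, (N <= s)%N /\ restrictive f c a b s.

Definition wild_attractor f c X :=
  [/\ class_A f c, ~ infinitely_renormalizable f c & cantor_attractor f X].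

(* f : X -> X is topologically conjugate to g : T -> T: h is a homeomorphism
   from T onto X, with inverse k, and h \o g = f \o h. *)
Definition conjugate_on f X (T : topologicalType) (g : T -> T) :=
  exists (h : T -> R) (k : R -> T),
    [/\ set_bij [set: T] X h, cancel h k, continuous h,
        {within X, continuous k} & forall t, h (g t) = f (h t)].

Definition equicontinuous_on f X :=
  equicontinuous [set: nat] (fun n (x : X) => iter n f (set_val x)).

End interval_maps.

Arguments I01 : clear implicits.

Definition Delta (alpha : nat -> nat) : topologicalType :=
  prod_topology (fun i => discrete_topology 'I_(alpha i)).

(* The carry reaches position i iff all earlier digits are maximal; ordS is the
   cyclic successor, which sends the maximal digit to 0. *)
Definition adding_machine (alpha : nat -> nat) (x : Delta alpha) : Delta alpha :=
  fun i => if [forall j : 'I_i, (x j : 'I_(alpha j)).+1 == alpha j]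
           then ordS (x i) else x i.

(* Main.v *)
Require Import Defs.
From mathcomp Require Import all_boot all_order all_algebra.
From mathcomp Require Import all_classical all_reals all_analysis.
From mathcomp Require Import ring lra zify.

(** The map is the affine copy on [0, 1] of [f x = a - (1 + a) x^l] on [-1, 1], with
    [l = 2^m] very large.  The parameter [a] is chosen so that the cutting times
    [S_(k+1) = S_k + S_(Q(k+1))] of [f] come from the kneading map [Q k = k - d], where
    [d] is [2], [5] or [3] according to [k] modulo [3].  Then [S_(3i+2) = 3^(i+1)]: the
    times of close return of the critical point are highly divisible by [3], and the
    critical orbit is a [3]-adic odometer.  If [s] divides [S_j] then a restrictive
    interval of period [s] contains a preimage of the critical point of order
    [S_(Q(j+1))], so [s] divides [S_(Q(j+1))] too; descending, [s = 1] and [f] is not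
    renormalizable.

    All first return branches are compositions of affine maps and iterated square roots
    (backwards), so they contract cross-ratios.  This gives a priori bounds for the
    precritical points [Z_k], the points closest to [0] which are mapped to [0] at time
    [S_(k-1)]: in the scale [- l ln Z_k] consecutive points are at distance [O(ln m)],
    far below [l].  Hence a point of [(Z_(k+1), Z_k)] is
    mapped almost uniformly over the harmonic scale, its level [k] drifts upwards in mean,
    and with positive probability it tends to infinity; such orbits converge to the
    closure of the critical orbit.  Contraction of cross-ratios also excludes intervals
    on which no iterate has a turning point, whence periodic points repel, and points
    with similar itineraries are close. *)

Set Implicit Arguments.
Unset Strict Implicit.
Unset Printing Implicit Defensive.

Import Order.TTheory GRing.Theory Num.Theory.
Import numFieldNormedType.Exports.

Local Open Scope classical_set_scope.
Local Open Scope ring_scope.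

(** * Combinatorics *)

Section Combinatorics.
Local Open Scope nat_scope.

(** The exponent is a power of 2 so that the inverse of [x^l] is an iterated square root, for which
    contraction of cross-ratios is an elementary inequality. The obstacle is that the a priori
    bounds are circular: upper bounds on the distances between consecutive [Z_k] need lower bounds
    on the distance from [L_k] to the neighbouring precritical points, and conversely. The circle is
    broken in two rounds. One application of cross-ratio contraction loses a factor [l], and
    induction on the level then yields logarithmic distances at most [8 m], of order [ln l]. For
    large levels a chain of three branches avoids the factor [l] and improves this to order [ln m].
    The improvement matters because the drift is the divergence of a harmonic series cut off at
    [2^J], where [l = 2^(2 J)]: its sum, about [J / D], must exceed the four levels that a jump may
    lose, and the distortion [D] is of the order of the fourth power of the bound. With [8 m] alone,
    [D] would be larger than [J = m / 2]. The margin is met with [m = 2^128]. *)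

Definition kneadQ (k : nat) : nat := k - nth 0 [:: 2; 5; 3] (k %% 3).

(** The case split behind the inequalities on [kneadQ], which become linear arithmetic. Truncated
    subtraction accounts for the initial values. *)
Variant mod3_spec (k : nat) : Prop :=
  | Mod30 i of k = 3 * i & kneadQ k = 3 * i - 2
  | Mod31 i of k = 3 * i + 1 & kneadQ k = 3 * i - 4
  | Mod32 i of k = 3 * i + 2 & kneadQ k = 3 * i - 1.

Lemma mod3P k : mod3_spec k.
Proof.
have := divn_eq k 3; have := ltn_mod k 3; move E : (k %% 3) => r.
case: r E => [|[|[|//]]] E _ kE;
  [apply: (@Mod30 _ (k %/ 3))|apply: (@Mod31 _ (k %/ 3))|apply: (@Mod32 _ (k %/ 3))];
  rewrite /kneadQ ?E /=; lia.
Qed.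

Lemma kneadQ_lt k : 0 < k -> kneadQ k < k.
Proof. by case: (mod3P k) => i; lia. Qed.

Lemma kneadQ_leS k : kneadQ k.+1 <= k.
Proof. exact: (@kneadQ_lt k.+1). Qed.

Lemma kneadQ_ge k : k <= kneadQ k + 5.
Proof. by case: (mod3P k) => i; lia. Qed.

Lemma kneadQ_le2 k : 1 < k -> kneadQ k + 2 <= k.
Proof. by case: (mod3P k) => i; lia. Qed.

Lemma kneadQQ_lt k : 4 < k -> kneadQ (kneadQ k) + 2 <= kneadQ k.+1.
Proof.
case: (mod3P k.+1) => i ? ?; case: (mod3P k) => j ? ?;
  case: (mod3P (kneadQ k)) => h; lia.
Qed.

(** A strict form of Hofbauer's admissibility condition for kneading maps. It places [L_k] strictly
    below [L_(Q (Q k))]. *)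
Lemma kneadQQQ_lt k : 4 < k -> kneadQ (kneadQ (kneadQ k)).+1 + 1 <= kneadQ k.+1.
Proof.
move=> k4; have := kneadQQ_lt k4; have := kneadQ_leS (kneadQ (kneadQ k)); lia.
Qed.

Lemma kneadQ_small :
  ((kneadQ 0 = 0) * (kneadQ 1 = 0) * (kneadQ 2 = 0) * (kneadQ 3 = 1) * (kneadQ 4 = 0) * (kneadQ 5 = 2))%type.
Proof. by []. Qed.

Lemma kneadQ_gt0 k : 4 < k -> 0 < kneadQ k.
Proof. by case: (mod3P k) => i; lia. Qed.

Section Rec.
Variables (T : Type) (x0 : T) (step : T -> T -> T).

(** Course-of-values recursion through the list of earlier values, as [Q (k+1)] is not a structural
    predecessor. Cutting times, signs and branches are all instances. *)
Fixpoint rec_table (k : nat) : seq T :=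
  if k is k'.+1 then
    let s := rec_table k' in
    rcons s (step (nth x0 s k') (nth x0 s (kneadQ k)))
  else [:: x0].

Definition kneadrec k := nth x0 (rec_table k) k.

Lemma size_rec_table k : size (rec_table k) = k.+1.
Proof. by elim: k => //= k IH; rewrite size_rcons IH. Qed.

Lemma nth_rec_table n k : k <= n -> nth x0 (rec_table n) k = kneadrec k.
Proof.
elim: n => [|n IH] kn; first by move: kn; rewrite leqn0 => /eqP ->.
move: kn; rewrite leq_eqVlt => /predU1P[->//|kn].
by rewrite /= nth_rcons size_rec_table kn IH.
Qed.

Lemma kneadrecS k : kneadrec k.+1 = step (kneadrec k) (kneadrec (kneadQ k.+1)).
Proof.
by rewrite /kneadrec /= nth_rcons size_rec_table ltnn eqxx !nth_rec_table// kneadQ_leS.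
Qed.

End Rec.

Definition cuttime : nat -> nat := kneadrec 1 addn.

Lemma cuttimeS k : cuttime k.+1 = cuttime k + cuttime (kneadQ k.+1).
Proof. exact: kneadrecS. Qed.

Lemma cuttime_gt0 k : 0 < cuttime k.
Proof. by elim: k => // k IH; rewrite cuttimeS addn_gt0 IH. Qed.

Lemma cuttime_ltS k : cuttime k < cuttime k.+1.
Proof. by rewrite cuttimeS -[X in X < _]addn0 ltn_add2l cuttime_gt0. Qed.

Lemma cuttime_mono k n : k <= n -> cuttime k <= cuttime n.
Proof.
elim: n => [|n IH]; first by rewrite leqn0 => /eqP->.
by rewrite leq_eqVlt => /predU1P[->//|/IH kn]; rewrite (leq_trans kn)// ltnW// cuttime_ltS.
Qed.

Lemma cuttime_gtk k : k < cuttime k.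
Proof. by elim: k => // k IH; rewrite (leq_ltn_trans IH)// cuttime_ltS. Qed.

Lemma cuttime3 i :
  [/\ cuttime (3 * i + 1) = 2 * 3 ^ i, cuttime (3 * i + 2) = 3 ^ i.+1 &
      cuttime (3 * i + 3) = 5 * 3 ^ i].
Proof.
elim: i => [|i [E1 E2 E3]]; first by [].
have F1 : cuttime (3 * i.+1 + 1) = 2 * 3 ^ i.+1.
  have -> : 3 * i.+1 + 1 = (3 * i + 3).+1 by lia.
  rewrite cuttimeS E3; case: i E1 E2 E3 => [//|i] E1 E2 E3.
  have -> : kneadQ (3 * i.+1 + 3).+1 = 3 * i + 2 by case: (mod3P (3 * i.+1 + 3).+1) => h; lia.
  suff -> : cuttime (3 * i + 2) = 3 ^ i.+1 by rewrite !expnS; lia.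
  have := cuttimeS (3 * i.+1 + 1).
  have -> : kneadQ (3 * i.+1 + 1).+1 = 3 * i + 2 by case: (mod3P (3 * i.+1 + 1).+1) => h; lia.
  have -> : (3 * i.+1 + 1).+1 = 3 * i.+1 + 2 by lia.
  by rewrite E1 E2 !expnS; lia.
have F2 : cuttime (3 * i.+1 + 2) = 3 ^ i.+2.
  have -> : 3 * i.+1 + 2 = (3 * i.+1 + 1).+1 by lia.
  rewrite cuttimeS F1.
  have -> : kneadQ (3 * i.+1 + 1).+1 = 3 * i + 2 by case: (mod3P (3 * i.+1 + 1).+1) => h; lia.
  by rewrite E2 !expnS; lia.
split=> //; have -> : 3 * i.+1 + 3 = (3 * i.+1 + 2).+1 by lia.
rewrite cuttimeS F2.
have -> : kneadQ (3 * i.+1 + 2).+1 = 3 * i.+1 + 1 by case: (mod3P (3 * i.+1 + 2).+1) => h; lia.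
by rewrite F1 !expnS; lia.
Qed.

Lemma kneadQ_eq0 k : k <= 2 -> kneadQ k = 0.
Proof. by case: (mod3P k) => i; lia. Qed.

Lemma kneadQ_gt0' k : ~~ (k <= 2) -> k != 4 -> 0 < kneadQ k.
Proof. by case: (mod3P k) => i; lia. Qed.

Lemma kneadQ_C2_4 k : k == 4 -> kneadQ 2 < kneadQ k.+1.
Proof. by move=> /eqP ->. Qed.

Lemma kneadQQ_ltk k : 2 < k -> kneadQ (kneadQ k) < k.
Proof. by case: (mod3P k) => i; case: (mod3P (kneadQ k)) => j; lia. Qed.

(** The index inequality that gives [Z_(Q (k+1)) <= L_(Q (Q k)) = X_k] through the lower bound in
    [adm]. For [k = 4], where [X_4 = L_1], its place is taken by [kneadQ_C2_4]. *)
Lemma kneadQ_C2 k : 2 < k -> k != 4 -> kneadQ k.+1 != 0 ->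
  kneadQ (kneadQ (kneadQ k)).+1 < kneadQ k.+1.
Proof.
case: (mod3P k) => i; case: (mod3P (kneadQ k)) => j; case: (mod3P k.+1) => h;
  case: (mod3P (kneadQ (kneadQ k)).+1) => n; lia.
Qed.

Lemma kneadQSS_le k : kneadQ k.+2 <= k.
Proof. by have := @kneadQ_le2 k.+2 isT; lia. Qed.

Lemma kneadQQS_lt k : 4 < k.+1 -> kneadQ (kneadQ k.+1) < k.
Proof. by move=> k4; have := kneadQQ_lt k4; have := kneadQSS_le k; lia. Qed.

Lemma kneadQQQS_lt k : 4 < k.+1 ->
  (kneadQ (kneadQ (kneadQ k.+1)).+1).+1 <= kneadQ k.+2.
Proof. by move=> k4; have := kneadQQQ_lt k4; lia. Qed.

Lemma kneadQQQ_ge k : (kneadQ k.+1).+1 <= kneadQ (kneadQ (kneadQ k)).+1 + 16.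
Proof.
have := kneadQ_leS k; have := kneadQ_ge k; have := kneadQ_ge (kneadQ k).
have := kneadQ_ge (kneadQ (kneadQ k)).+1; lia.
Qed.

Lemma kneadQQQ_ge' k : k <= kneadQ (kneadQ (kneadQ k)).+1 + 14.
Proof.
have := kneadQ_ge k; have := kneadQ_ge (kneadQ k).
have := kneadQ_ge (kneadQ (kneadQ k)).+1; lia.
Qed.

Lemma kneadQQ_ge k : k <= kneadQ (kneadQ k) + 10.
Proof. by have := kneadQ_ge k; have := kneadQ_ge (kneadQ k); lia. Qed.

Lemma kneadQ_pred k : 3 < k -> exists2 j, kneadQ k.+1 = j.+1 & (j <= k) /\ (k <= j + 5).
Proof.
move=> k3; have := @kneadQ_gt0 k.+1 k3; have := kneadQ_ge k.+1; have := kneadQ_leS k.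
by case: (kneadQ k.+1) => // j ? ? _; exists j => //; lia.
Qed.

(** Bookkeeping for the lower bound of [off k]: with [j + 1 = Q (k+1)] and [q = Q (j+1)], all levels
    that enter lie between [k - 25] and [k]. *)
Lemma kneadQ_pack k : 3 < k -> exists2 j, kneadQ k.+1 = j.+1 &
  let q := kneadQ j.+1 in
  [/\ j <= k, k <= j + 9, q <= k, k <= q + 9 & k <= q.+1 + 25] /\
  [/\ q.+1 <= k, (kneadQ q.+1).+1 <= kneadQ k.+2,
      forall i, q <= i + 14 -> i <= kneadQ q.+1 -> k <= i + 25 /\ i <= k,
      forall i, j <= i + 14 -> i <= kneadQ j.+1 -> k <= i + 25 /\ i <= k &
      forall i, k.+1 <= i + 14 -> i <= kneadQ k.+2 -> k <= i + 25 /\ i <= k].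
Proof.
move=> k3; have [j kj [jk kj5]] := kneadQ_pred k3; exists j => //=.
have k4 : 4 < k.+1 by [].
have h1 := kneadQQ_ge k.+1; have h2 := kneadQQ_lt k4; have h3 := kneadQSS_le k.
have h4 := kneadQQQ_lt k4; rewrite kj in h1 h2 h4.
have h5 := kneadQ_leS (kneadQ j.+1); have h6 := kneadQ_leS j.
split; split; try lia.
Qed.

(* The turning point is on the negative side at time [t]; written in terms of
   [t = 3^v u], which is what makes the sign sequence Toeplitz. *)
Definition kneadneg (t : nat) : bool :=
  let v := logn 3 t in let u := (t %/ 3 ^ v) %% 9 in
  if v == 0 then (u == 2) || (u == 8) else odd v (+) (u == 5).

Lemma kneadneg_exp n u : ~~ (3 %| u) -> kneadneg (3 ^ n * u) =
  if n == 0 then (u %% 9 == 2) || (u %% 9 == 8) else odd n (+) (u %% 9 == 5).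
Proof.
move=> u3; have u0 : 0 < u by case: u u3.
rewrite /kneadneg lognM ?expn_gt0// pfactorK//.
have -> : logn 3 u = 0 by apply: logn_coprime; rewrite prime_coprime.
by rewrite addn0 mulKn ?expn_gt0.
Qed.

Lemma exp3_decomp t : 0 < t -> exists n u, t = 3 ^ n * u /\ ~~ (3 %| u).
Proof.
move=> t0; exists (logn 3 t), (t %/ 3 ^ logn 3 t); split.
  by rewrite mulnC divnK// pfactor_dvdnn.
have [u ou E] := pfactor_coprime (isT : prime 3) t0.
by rewrite {1}E mulnK ?expn_gt0// -prime_coprime.
Qed.

(** The Toeplitz property. The valuation [v < n] and the unit part modulo 9 are read off from [t]
    modulo [3^(v+2)], which divides [3^(n+1)]. *)
Lemma kneadneg_mod n t t' : ~~ (3 ^ n %| t) -> t = t' %[mod 3 ^ n.+1] ->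
  kneadneg t = kneadneg t'.
Proof.
move=> nt tt'; have t0 : 0 < t by case: t nt {tt'}; rewrite ?dvdn0.
have [v [u [tE u3]]] := exp3_decomp t0.
have vn : v < n.
  by rewrite ltnNge; apply/negP => nv; move: nt; rewrite tE dvdn_mulr// dvdn_exp2l.
have E9 : 3 ^ n.+1 = 3 ^ v * 9 * 3 ^ (n.+1 - v.+2).
  by rewrite -[9]/(3 ^ 2) -!expnD; congr (3 ^ _); lia.
have t'v : 3 ^ v %| t'.
  rewrite /dvdn -(@modn_dvdm (3 ^ n.+1)) -?tt' ?modn_dvdm ?E9 -?mulnA ?dvdn_mulr//.
  by rewrite tE modnMr.
have [u' t'E] := dvdnP t'v; rewrite mulnC in t'E.
have uu' : u = u' %[mod 9].
  have : t = t' %[mod 3 ^ v * 9].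
    by rewrite -(@modn_dvdm (3 ^ n.+1) t) ?tt' ?modn_dvdm// E9 dvdn_mulr.
  rewrite tE t'E -!muln_modr => /eqP.
  by rewrite eqn_pmul2l ?expn_gt0// => /eqP.
have u'3 : ~~ (3 %| u').
  by apply: contra u3; rewrite /dvdn -(@modn_dvdm 9 u')// -uu' modn_dvdm.
by rewrite tE t'E !kneadneg_exp// uu'.
Qed.

(** By induction [t = 3^n s]. The samples at [3^n j], with [j] and [s + j] prime to 3, depend only
    on [s] modulo 9, and each residue prime to 3 is refuted by one of [j = 1, 2, 4, 5, 7, 8]. This
    makes the coding by the odometer injective. *)
Lemma kneadneg_recog n t : 0 < t ->
  (forall j, 0 < j < 3 ^ n * 3 -> kneadneg (t + j) = kneadneg j) -> 3 ^ n %| t.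
Proof.
elim: n => [|n IH] t0 tj; first by rewrite expn0 dvd1n.
have /dvdnP[s tE] : 3 ^ n %| t.
  by apply: IH => // j /andP[j0 jn]; apply: tj; rewrite j0 (leq_trans jn)// !expnS; lia.
rewrite mulnC in tE.
suff s3 : 3 %| s by rewrite tE expnSr dvdn_pmul2l ?expn_gt0.
have H j : 0 < j < 9 -> ~~ (3 %| j) -> ~~ (3 %| s + j) ->
    (if n == 0 then ((s + j) %% 9 == 2) || ((s + j) %% 9 == 8) else odd n (+) ((s + j) %% 9 == 5)) =
    (if n == 0 then (j %% 9 == 2) || (j %% 9 == 8) else odd n (+) (j %% 9 == 5)).
  move=> /andP[j0 j9] j3 sj3; rewrite -!kneadneg_exp// mulnDr -tE; apply: tj.
  by rewrite muln_gt0 expn_gt0 j0/= expnSr -mulnA ltn_pmul2l ?expn_gt0.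
apply/negPn/negP => s3.
have := divn_eq s 9; set q := s %/ 9; have := ltn_mod s 9.
move: (s %% 9) => r r9 sE.
have H' j : 0 < j < 9 -> ~~ (3 %| j) -> ~~ (3 %| r + j) ->
    (if n == 0 then ((r + j) %% 9 == 2) || ((r + j) %% 9 == 8) else odd n (+) ((r + j) %% 9 == 5)) =
    (if n == 0 then (j %% 9 == 2) || (j %% 9 == 8) else odd n (+) (j %% 9 == 5)).
  move=> j9 j3 rj; rewrite -(H j)//; last by move: rj; rewrite sE; lia.
  by rewrite sE -addnA modnMDl.
have r3 : ~~ (3 %| r) by move: s3; rewrite sE; lia.
clear - H' r3 r9.
have h1 := H' 1 isT isT; have h2 := H' 2 isT isT; have h4 := H' 4 isT isT.
have h5 := H' 5 isT isT; have h7 := H' 7 isT isT; have h8 := H' 8 isT isT.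
clear H'.
move: h1 h2 h4 h5 h7 h8.
case: (n == 0); case: (odd n); move: r3; do 9?[case: r r9 => [|r] r9 //];
 move=> h1 h2 h4 h5 h7 h8;
 first [by have := h1 isT | by have := h2 isT | by have := h4 isT | by have := h5 isT | by have := h7 isT | by have := h8 isT].
Qed.

Lemma kneadneg_shift p d v u : v.+2 <= p -> ~~ (3 %| u) ->
  kneadneg (3 ^ p * d + 3 ^ v * u) = kneadneg (3 ^ v * u).
Proof.
move=> vp u3; apply/esym/(@kneadneg_mod v.+1).
  by rewrite expnSr dvdn_pmul2l ?expn_gt0.
by rewrite -(subnKC vp) expnD -mulnA [3 ^ v.+2 * _]mulnC modnMDl.
Qed.

Lemma cuttime_cases k : k = 0 \/ exists i,
  [\/ cuttime k = 3 ^ i.+1 /\ cuttime (kneadQ k.+1) = 2 * 3 ^ i,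
      cuttime k = 5 * 3 ^ i /\ cuttime (kneadQ k.+1) = 3 ^ i |
      cuttime k = 2 * 3 ^ i /\ cuttime (kneadQ k.+1) = 3 ^ i].
Proof.
case: (mod3P k) => i kE _.
- case: i kE => [->|i kE]; [by left|right; exists i; apply: Or32].
  have -> : k = 3 * i + 3 by lia.
  have [_ _ ->] := cuttime3 i; split=> //.
  case: i {kE} => [//|i]; have [_ <- _] := cuttime3 i; congr cuttime.
  by case: (mod3P (3 * i.+1 + 3).+1) => h; lia.
- right; exists i; apply: Or33; rewrite kE.
  have [-> _ _] := cuttime3 i; split=> //.
  case: i {kE} => [//|i]; have [_ <- _] := cuttime3 i; congr cuttime.
  by case: (mod3P (3 * i.+1 + 1).+1) => h; lia.
- right; exists i; apply: Or31; rewrite kE.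
  have [<- -> _] := cuttime3 i; split=> //; congr cuttime.
  by case: (mod3P (3 * i + 2).+1) => h; lia.
Qed.

(** Together with [kneadneg_cutS] this says that the Toeplitz sequence has kneading map [Q]: after
    time [S_k] it copies its beginning until time [S_(Q (k+1))], where it differs. *)
Lemma kneadneg_cut k i : 0 < i < cuttime (kneadQ k.+1) ->
  kneadneg (cuttime k + i) = kneadneg i.
Proof.
move=> /andP[i0]; have [v [u [-> u3]]] := exp3_decomp i0.
have u0 : 0 < u by case: u u3.
have [->|[p [[-> ->]|[-> ->]|[-> ->]]]] := cuttime_cases k.
- by rewrite kneadQ_small ltnS leqn0 muln_eq0 expn_eq0/= => /eqP uE; rewrite uE in u0.
(* Signs at times of valuation below [p] are unaffected by the shift; the only other time below
   [2 * 3^p] is [3^p], checked directly. *)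
- move=> lt; have [vp|] := leqP v.+2 p.+1; first by rewrite -[3 ^ p.+1]muln1 kneadneg_shift.
  rewrite !ltnS leq_eqVlt => /predU1P[pE|pv]; last first.
    have : 3 ^ p.+1 <= 3 ^ v by rewrite leq_exp2l.
    by rewrite expnS; nia.
  have {}lt : u < 2 by rewrite pE mulnC ltn_pmul2r ?expn_gt0 in lt.
  have -> : u = 1 by lia.
  by rewrite pE expnS -[3 * _]mulnC -mulnDr !kneadneg_exp.
- move=> lt; have [vp|] := leqP v.+2 p; first by rewrite mulnC kneadneg_shift.
  case: p lt => [|p lt]; first by rewrite expn0 ltnS leqn0 muln_eq0 expn_eq0/= => /eqP uE; rewrite uE in u0.
  rewrite !ltnS leq_eqVlt => /predU1P[pE|pv]; last first.
    have : 3 ^ p.+1 <= 3 ^ v by rewrite leq_exp2l.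
    by nia.
  have {}lt : u < 3 by rewrite pE expnSr ltn_pmul2l ?expn_gt0 in lt.
  have -> : 5 * 3 ^ p.+1 + 3 ^ v * u = 3 ^ v * (15 + u) by rewrite pE expnS mulnDr; congr (_ + _); lia.
  rewrite !kneadneg_exp // ?dvdn_addr//.
  by case: u u0 lt {u3} => [|[|[|]]].
- move=> lt; have [vp|] := leqP v.+2 p; first by rewrite mulnC kneadneg_shift.
  case: p lt => [|p lt]; first by rewrite expn0 ltnS leqn0 muln_eq0 expn_eq0/= => /eqP uE; rewrite uE in u0.
  rewrite !ltnS leq_eqVlt => /predU1P[pE|pv]; last first.
    have : 3 ^ p.+1 <= 3 ^ v by rewrite leq_exp2l.
    by nia.
  have {}lt : u < 3 by rewrite pE expnSr ltn_pmul2l ?expn_gt0 in lt.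
  have -> : 2 * 3 ^ p.+1 + 3 ^ v * u = 3 ^ v * (6 + u) by rewrite pE expnS mulnDr; congr (_ + _); lia.
  rewrite !kneadneg_exp // ?dvdn_addr//.
  by case: u u0 lt {u3} => [|[|[|]]].
Qed.

Lemma kneadneg_cutS k :
  kneadneg (cuttime k.+1) = ~~ kneadneg (cuttime (kneadQ k.+1)).
Proof.
rewrite cuttimeS; have [->//|[p [[-> ->]|[-> ->]|[-> ->]]]] := cuttime_cases k.
- have -> : 3 ^ p.+1 + 2 * 3 ^ p = 3 ^ p * 5 by rewrite expnS; lia.
  by rewrite [2 * _]mulnC !kneadneg_exp//=; case: p => //= p; case: (odd p).
- have -> : 5 * 3 ^ p + 3 ^ p = 3 ^ p.+1 * 2 by rewrite expnS; lia.
  by rewrite -[in RHS](muln1 (3 ^ p)) !kneadneg_exp//=; case: p => //= p; case: (odd p).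
- have -> : 2 * 3 ^ p + 3 ^ p = 3 ^ p.+1 * 1 by rewrite expnS; lia.
  by rewrite -[in RHS](muln1 (3 ^ p)) !kneadneg_exp//=; case: p => //= p; case: (odd p).
Qed.

End Combinatorics.

(** * Cross-ratios *)

Section CrossRatio.
Context {R : realType}.
Implicit Types (a b c d p q s t x y : R) (phi psi : R -> R).

(** The cross-ratio [|T| |J| / (|L| |R|)] of one-dimensional dynamics. It is unchanged by reversal,
    so that increasing and decreasing branches are treated alike. *)
Definition cross a b c d := ((d - a) * (c - b)) / ((b - a) * (d - c)).

Lemma cross_rev a b c d : cross d c b a = cross a b c d.
Proof. by rewrite /cross; congr (_ / _); ring. Qed.

Lemma cross_affine r s a b c d : r != 0 ->
  cross (r * a + s) (r * b + s) (r * c + s) (r * d + s) = cross a b c d.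
Proof.
move=> r0; rewrite /cross.
have -> : (r * d + s - (r * a + s)) * (r * c + s - (r * b + s)) =
  (r * r) * ((d - a) * (c - b)) by ring.
have -> : (r * b + s - (r * a + s)) * (r * d + s - (r * c + s)) =
  (r * r) * ((b - a) * (d - c)) by ring.
by rewrite -mulf_div divff ?mul1r// mulf_neq0.
Qed.

(** Squaring multiplies the cross-ratio by [(d + a) (c + b) / ((b + a) (d + c))], which exceeds 1
    because numerator and denominator differ by [(d - b) (c - a)]. This plays the part of negative
    Schwarzian derivative. *)
Lemma cross_sqr a b c d : 0 <= a -> a < b -> b < c -> c < d ->
  cross a b c d < cross (a ^+ 2) (b ^+ 2) (c ^+ 2) (d ^+ 2).
Proof.
move=> a0 ab bc cd; rewrite /cross.
rewrite !subr_sqr.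
rewrite [X in _ < X](_ : _ = (d - a) * (c - b) / ((b - a) * (d - c)) *
  (((d + a) * (c + b)) / ((b + a) * (d + c)))); last first.
  by rewrite mulf_div; congr (_ / _); ring.
rewrite -[X in X < _]mulr1 ltr_pM2l; last first.
  by rewrite divr_gt0// mulr_gt0// subr_gt0// (lt_trans ab)// (lt_trans bc).
rewrite ltr_pdivlMr ?mul1r; last by rewrite mulr_gt0//; lra.
by rewrite -subr_gt0 (_ : _ - _ = (d - b) * (c - a)); [rewrite mulr_gt0//; lra|ring].
Qed.

Definition smono phi p q :=
  (forall x y, p <= x -> x < y -> y <= q -> phi x < phi y) \/
  (forall x y, p <= x -> x < y -> y <= q -> phi y < phi x).

Definition crcontr phi p q := forall a b c d,
  p <= a -> a < b -> b < c -> c < d -> d <= q ->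
  cross (phi a) (phi b) (phi c) (phi d) <= cross a b c d.

Lemma crcontr_comp phi psi p q s t : smono psi s t -> crcontr psi s t ->
  (forall x, s <= x <= t -> p <= psi x <= q) ->
  crcontr phi p q -> crcontr (phi \o psi) s t.
Proof.
move=> mpsi cpsi spq cphi a b c d sa ab bc cd dt /=.
apply: le_trans (cpsi a b c d sa ab bc cd dt).
have /andP[pa qa] : p <= psi a <= q by apply: spq; lra.
have /andP[pd qd] : p <= psi d <= q by apply: spq; lra.
case: mpsi => m.
  by apply: cphi => //; apply: m => //; lra.
by rewrite -cross_rev -[X in _ <= X]cross_rev; apply: cphi => //; apply: m => //; lra.
Qed.

Lemma smono_comp phi psi p q s t : smono psi s t ->
  (forall x, s <= x <= t -> p <= psi x <= q) ->
  smono phi p q -> smono (phi \o psi) s t.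
Proof.
move=> mpsi spq mphi.
have P x : s <= x -> x <= t -> p <= psi x by move=> sx xt; have /andP[] : p <= psi x <= q by apply: spq; rewrite sx xt.
have Q x : s <= x -> x <= t -> psi x <= q by move=> sx xt; have /andP[] : p <= psi x <= q by apply: spq; rewrite sx xt.
case: mpsi mphi => m [] n; [left|right|right|left] => x y sx xy yt;
  by apply: n; [apply: P; lra|apply: m|apply: Q; lra].
Qed.

Lemma smonoW phi p q s t : p <= s -> t <= q -> smono phi p q -> smono phi s t.
Proof. by move=> ps tq [] m; [left|right] => x y *; apply: m => //; lra. Qed.

Lemma crcontrW phi p q s t : p <= s -> t <= q -> crcontr phi p q -> crcontr phi s t.
Proof. by move=> ps tq m a b c d *; apply: m => //; lra. Qed.

Lemma crcontr_affine r s p q : r != 0 -> crcontr (fun x => r * x + s) p q.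
Proof. by move=> r0 a b c d *; rewrite cross_affine. Qed.

End CrossRatio.

Section Root.
Context {R : realType} (m : nat).
Implicit Types (x y : R).

(** The [2^m]-th root; written with square roots, it inherits contraction of cross-ratios from
    [cross_sqr]. *)
Definition rt : R -> R := iter m Num.sqrt.

Lemma rt_ge0 x : 0 <= x -> 0 <= rt x.
Proof. by rewrite /rt; case: m => // n _; rewrite iterS sqrtr_ge0. Qed.

Lemma rt_ltr x y : 0 <= x -> x < y -> rt x < rt y.
Proof.
rewrite /rt; elim: m => //= n IH x0 xy.
by rewrite ltr_sqrt ?IH// (le_lt_trans _ (IH x0 xy))//; case: n {IH} => //= n; rewrite sqrtr_ge0.
Qed.

Lemma rt_ler x y : 0 <= x -> x <= y -> rt x <= rt y.
Proof. by move=> x0; rewrite le_eqVlt => /predU1P[->//|xy]; rewrite ltW// rt_ltr. Qed.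

Lemma rt_exp x : 0 <= x -> rt x ^+ (2 ^ m) = x.
Proof.
rewrite /rt; elim: m x => [|n IH] x x0; first by rewrite expn0 expr1.
by rewrite iterSr expnSr exprM IH ?sqrtr_ge0// sqr_sqrtr.
Qed.

Lemma rt_inj_exp x y : 0 <= x -> 0 <= y -> x ^+ (2 ^ m) = y ^+ (2 ^ m) -> x = y.
Proof. by move=> x0 y0 /eqP; rewrite eqrXn2 ?expn_gt0// => /eqP. Qed.

Lemma exp_rt x : 0 <= x -> rt (x ^+ (2 ^ m)) = x.
Proof.
by move=> x0; apply: rt_inj_exp => //; rewrite ?rt_ge0 ?rt_exp ?exprn_ge0.
Qed.

Lemma rt_gt0 x : 0 < x -> 0 < rt x.
Proof.
move=> x0; rewrite lt_neqAle rt_ge0 1?ltW// andbT; apply/eqP => r0.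
have := rt_exp (ltW x0); rewrite -r0 expr0n expn_eq0/= => x00.
by move: x0; rewrite -x00 ltxx.
Qed.

Lemma rt0 : rt 0 = 0.
Proof. by rewrite /rt; elim: m => //= n ->; rewrite sqrtr0. Qed.

Lemma rt1 : rt 1 = 1.
Proof. by rewrite /rt; elim: m => //= n ->; rewrite sqrtr1. Qed.

Lemma rt_continuous : continuous rt.
Proof.
rewrite /rt; elim: m => [|n IH] x; first exact: cvg_id.
by apply: (@continuous_comp _ _ _ (iter n Num.sqrt)); [exact: IH|exact: sqrt_continuous].
Qed.

Lemma rt_crcontr q : crcontr rt 0 q.
Proof.
move=> a b c d a0 ab bc cd _; rewrite /rt; elim: m => //= n.
apply: le_trans.
set r := iter n Num.sqrt.
have r0 x : 0 <= x -> 0 <= r x by rewrite /r; case: n {r} => //= n; rewrite sqrtr_ge0.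
have rl x y : 0 <= x -> x < y -> r x < r y.
  rewrite {}/r in r0 *; elim: n {r0} => //= n IH x0 xy.
  by rewrite ltr_sqrt ?IH// (le_lt_trans _ (IH x0 xy))//; case: n {IH} => //= n; rewrite sqrtr_ge0.
have [b0 c0 d0] : [/\ 0 <= b, 0 <= c & 0 <= d] by split; lra.
have sl x y : 0 <= x -> x < y -> Num.sqrt (r x) < Num.sqrt (r y).
  by move=> x0 xy; rewrite ltr_sqrt ?rl// (le_lt_trans (r0 _ x0))// rl.
rewrite -{2}(sqr_sqrtr (r0 _ a0)) -{2}(sqr_sqrtr (r0 _ b0)) -{2}(sqr_sqrtr (r0 _ c0)).
rewrite -{2}(sqr_sqrtr (r0 _ d0)) ltW// cross_sqr ?sqrtr_ge0//.
all: exact: sl.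
Qed.

End Root.

(** * The renormalized branches *)

Module Branch.

Section Branches.
Context {R : realType} (m : nat) (a : R).
Implicit Types (w x y : R) (i j k K : nat).

Local Notation l := (2 ^ m)%N.
Local Notation Q := kneadQ.
Local Notation rt := (rt m).

(* [f^(S_k) x = +- gk k (x^l)] for all [x]; [th k] is the branch of the inverse of
   [gk k] along the turning point, [rt] being the [l]-th root. *)
Definition gk : nat -> R -> R :=
  kneadrec (fun y => a - (1 + a) * y) (fun t u y => - u (t y ^+ l)).

Definition th : nat -> R -> R :=
  kneadrec (fun w => (a - w) / (1 + a)) (fun t u w => t (rt (u (- w)))).

(* [Lk k] is the distance of [f^(S_k) 0] to [0], [Zk k.+1 = Yk k.+1 ^ (1/l)] is the
   preimage of [0] by [f^(S_k)] closest to [0], and [[- Mk k, Xk k]] is the interval on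
   which [th k] is controlled. *)
Definition Lk k := gk k 0.
Definition Yk k := if k is k'.+1 then th k' 0 else 1.
Definition Zk k := rt (Yk k).
Definition Mk k := if k is k'.+1 then Lk (Q k) else 1.
Definition Xk k := if (k <= 2)%N then rt 2 else if k == 4%N then Lk 1 else Lk (Q (Q k)).
Definition ubk i := if i == 3%N then Lk 0 else Zk (Q i.+1).

(* Prescribes the kneading map: the return at time [S_i] falls between the precritical
   points of indices [Q(i+1)+1] and [Q(i+1)].  The smaller bound at [i = 3] keeps
   [L_3 <= L_0]. *)
Definition adm K := forall i, (i < K)%N -> Zk (Q i.+1).+1 <= Lk i <= ubk i.

Arguments gk : simpl never.
Arguments th : simpl never.
Arguments kneadQ : simpl never.

Lemma gk0 y : gk 0 y = a - (1 + a) * y. Proof. by []. Qed.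
Lemma th0 w : th 0 w = (a - w) / (1 + a). Proof. by []. Qed.
Lemma gkS k y : gk k.+1 y = - gk (Q k.+1) (gk k y ^+ l).
Proof. by rewrite /gk kneadrecS. Qed.
Lemma thS k w : th k.+1 w = th k (rt (th (Q k.+1) (- w))).
Proof. by rewrite /th kneadrecS. Qed.
Lemma Lk0 : Lk 0 = a. Proof. by rewrite /Lk gk0 mulr0 subr0. Qed.
Lemma LkS k : Lk k.+1 = - gk (Q k.+1) (Lk k ^+ l). Proof. by rewrite /Lk gkS. Qed.
Lemma Zk0 : Zk 0 = 1. Proof. by rewrite /Zk /= rt1. Qed.
Lemma Lk1 : Lk 1 = (1 + a) * a ^+ l - a.
Proof. by rewrite LkS gk0 Lk0 opprB. Qed.

Opaque gk th Lk kneadQ.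

Hypotheses (a_gt0 : 0 < a) (a_le1 : a <= 1).

Ltac slra := let h1 := fresh in let h2 := fresh in
  have h1 := a_gt0; have h2 := a_le1; lra.
Let a1p : 1 + a != 0. Proof. by rewrite gt_eqF//; slra. Qed.

Lemma th0_lt x y : x < y -> th 0 y < th 0 x.
Proof. by move=> xy; rewrite !th0 ltr_pM2r ?invr_gt0; slra. Qed.

Lemma gk0K w : gk 0 (th 0 w) = w.
Proof. by rewrite gk0 th0 mulrC divfK//; ring. Qed.

Lemma th0K y : th 0 (gk 0 y) = y.
Proof. by rewrite gk0 th0 opprB addrCA subrr addr0 mulrC mulKf. Qed.

Lemma rt2_ge1 : 1 <= rt (2 : R).
Proof. by rewrite -[X in X <= _](rt1 m) rt_ler//; slra. Qed.

Lemma rt2_le2 : rt (2 : R) <= 2.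
Proof.
have r0 : 0 <= rt (2 : R) by rewrite rt_ge0//; slra.
rewrite -(@ler_pXn2r _ l) ?expn_gt0// ?nnegrE ?rt_exp//; try slra.
by rewrite -[X in X <= _]expr1 ler_eXn2l//; [rewrite expn_gt0|slra].
Qed.

(** The affine branch [th 0] is controlled everywhere, and the induction applies it to points below
    [- Mk 0 = -1]. *)
Definition branch_ok k := forall p q, k = 0%N \/ (- Mk k <= p /\ q <= Xk k) ->
  [/\ forall x y, p <= x -> x < y -> y <= q -> th k y < th k x,
      crcontr (th k) p q & forall w, p <= w <= q -> gk k (th k w) = w].

Definition level_ok k := [/\ 0 <= Lk k <= Xk k, 0 < Yk k,
  forall y, 0 <= y <= Yk k -> - Mk k <= gk k y <= Lk k /\ th k (gk k y) = y,
  th k (- Mk k) = Yk k & branch_ok k].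

Lemma gk_lt k : level_ok k -> forall x y, 0 <= x -> x < y -> y <= Yk k -> gk k y < gk k x.
Proof.
move=> [/andP[L0 LX] Y0 inv MY ok] x y x0 xy yY.
have [/andP[Mx xL] xE] : - Mk k <= gk k x <= Lk k /\ th k (gk k x) = x by apply: inv; slra.
have [/andP[My yL] yE] : - Mk k <= gk k y <= Lk k /\ th k (gk k y) = y by apply: inv; slra.
rewrite ltNge; apply/negP; rewrite le_eqVlt => /predU1P[E|lt].
  by move: xy; rewrite -xE E yE ltxx.
have [dec _ _] := ok (- Mk k) (Xk k) (or_intror (conj (lexx _) (lexx _))).
have := dec _ _ Mx lt (le_trans yL LX).
by rewrite xE yE => yx; move: (lt_trans xy yx); rewrite ltxx.
Qed.

Lemma th_Lk k : level_ok k -> th k (Lk k) = 0.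
Proof. by move=> [_ Y0 inv _ _]; have [|_ ->//] := inv 0; rewrite lexx ltW. Qed.

Lemma Yk_le k : level_ok k -> 0 <= Mk k -> Yk k.+1 <= Yk k.
Proof.
move=> [/andP[L0 LX] Y0 inv MY ok] M0; rewrite -MY /=.
have [dec _ _] := ok (- Mk k) (Xk k) (or_intror (conj (lexx _) (lexx _))).
move: M0; rewrite le_eqVlt => /predU1P[<-|M0]; first by rewrite oppr0.
by rewrite ltW// dec//; slra.
Qed.

Lemma Yk_gt0S k : level_ok k -> 0 <= Mk k -> 0 < Lk k -> 0 < Yk k.+1.
Proof.
move=> ok M0 L0; rewrite -(th_Lk ok) /=.
have [/andP[_ LX] Y0 inv MY br] := ok.
have [dec _ _] := br (- Mk k) (Xk k) (or_intror (conj (lexx _) (lexx _))).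
by apply: dec => //; slra.
Qed.

Lemma gk_YkS k : level_ok k -> 0 <= Mk k -> gk k (Yk k.+1) = 0.
Proof.
move=> [/andP[L0 LX] Y0 inv MY br] M0.
have [_ _ -> //] := br (- Mk k) (Xk k) (or_intror (conj (lexx _) (lexx _))).
by rewrite oppr_le0 M0/=; slra.
Qed.

Lemma gk_Yk k : level_ok k -> 0 <= Mk k -> gk k (Yk k) = - Mk k.
Proof.
move=> [/andP[L0 LX] Y0 inv MY br] M0.
rewrite -MY; have [_ _ -> //] := br (- Mk k) (Xk k) (or_intror (conj (lexx _) (lexx _))).
by rewrite lexx /=; slra.
Qed.

Lemma level_ok0 : level_ok 0.
Proof.
split=> //.
- by rewrite Lk0 /Xk /=; have r2 := rt2_ge1; slra.
- move=> y /= /andP[y0 y1]; split; last exact: th0K.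
  have ap := a_gt0; have a1 := a_le1; rewrite Lk0 gk0; apply/andP; split; nra.
- by rewrite th0 /= opprK addrC divff.
- move=> p q _; split.
  + by move=> x y _ xy _; apply: th0_lt.
  + move=> x y z t px xy yz zt tq.
    have E w : th 0 w = - (1 + a)^-1 * w + a / (1 + a) by rewrite th0; field.
    by rewrite !E cross_affine// oppr_eq0 invr_eq0.
  + by move=> w _; apply: gk0K.
Qed.

Lemma exp_rt_le x y : 0 <= x -> 0 <= y -> x <= rt y -> x ^+ l <= y.
Proof.
move=> x0 y0 xy; rewrite -[leRHS](rt_exp m)//.
by rewrite lerXn2r// nnegrE ?rt_ge0.
Qed.

Lemma le_exp_rt x y : 0 <= y -> rt y <= x -> y <= x ^+ l.
Proof.
move=> y0 yx; rewrite -[leLHS](rt_exp m)//.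
by rewrite lerXn2r// nnegrE ?rt_ge0// (le_trans _ yx)// rt_ge0.
Qed.

Section Step.
Variables (K : nat) (admK : adm K).
Variables (k : nat) (kK : (k.+1 <= K)%N) (IH : forall j, (j <= k)%N -> level_ok j).

Let kQ : (Q k.+1 <= k)%N. Proof. exact: kneadQ_leS. Qed.

Let L_ge0 j : (j <= k)%N -> 0 <= Lk j. Proof. by move=> /IH[/andP[]]. Qed.
Let M_ge0 j : (j <= k.+1)%N -> 0 <= Mk j.
Proof.
case: j => [|j] jk; first by rewrite /= ler01.
by apply: L_ge0; rewrite (leq_trans (kneadQ_leS j)).
Qed.
Let Y_gt0 j : (j <= k)%N -> 0 < Yk j. Proof. by move=> /IH[]. Qed.
Let Y_noninc i j : (i <= j)%N -> (j <= k)%N -> Yk j <= Yk i.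
Proof.
elim: j => [|j IHj]; first by rewrite leqn0 => /eqP->.
rewrite leq_eqVlt => /predU1P[->//|ij] jk.
apply: le_trans (IHj ij (ltnW jk)); apply: Yk_le; first by apply: IH; lia.
by apply: M_ge0; lia.
Qed.
Let Z_noninc i j : (i <= j)%N -> (j <= k)%N -> Zk j <= Zk i.
Proof. by move=> ij jk; apply: rt_ler; [exact/ltW/Y_gt0|exact: Y_noninc]. Qed.

Let L_gt0 j : (j < k)%N -> 0 < Lk j.
Proof.
move=> jk; have /andP[h _] := admK (ltn_trans jk kK).
by apply: lt_le_trans h; apply/rt_gt0/Y_gt0; have := kneadQ_leS j; lia.
Qed.

Let L_leZ : Lk k <= Zk (Q k.+1).
Proof.
have /andP[_] := admK kK; rewrite /ubk; case: eqP => [->|//].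
by rewrite kneadQ_small Zk0 Lk0; slra.
Qed.

Let Ll_le : Lk k ^+ l <= Yk (Q k.+1).
Proof. by apply: exp_rt_le => //; rewrite ?L_ge0//; apply/ltW/Y_gt0. Qed.

Let Q1_ge0 : 0 <= Mk (Q k.+1). Proof. by apply: M_ge0; lia. Qed.

Let LQ_gt0 : 0 < Lk (Q k.+1).
Proof.
have [Qk|Qk] := ltnP (Q k.+1) k; first exact: L_gt0.
have -> : Q k.+1 = 0%N.
  by case: (k) kQ Qk => // k' _; have := @kneadQ_le2 k'.+2 isT; lia.
by rewrite Lk0.
Qed.

(* [L_k <= X_k]; the case [k = 3] uses the extra bound [L_3 <= L_0]. *)
Lemma LkS_bound : 0 <= Lk k.+1 <= Xk k.+1.
Proof.
have okQ := IH kQ; have [LX Y0 inv MY br] := okQ.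
have LlE : 0 <= Lk k ^+ l <= Yk (Q k.+1) by rewrite Ll_le exprn_ge0// L_ge0.
have [/andP[Mg gL] _] := inv _ LlE.
have ge0 : 0 <= Lk k.+1.
  have Y1 : 0 < Yk (Q k.+1).+1 by apply: Yk_gt0S.
  have /andP[h _] := admK kK.
  rewrite LkS oppr_ge0 -(gk_YkS okQ Q1_ge0).
  have := le_exp_rt (ltW Y1) h; rewrite le_eqVlt => /predU1P[<-//|lt].
  by rewrite ltW// (gk_lt okQ)// ltW.
rewrite ge0/=.
have LM : Lk k.+1 <= Mk (Q k.+1) by rewrite LkS; slra.
rewrite /Xk; case: ifPn => [k2|k2].
  by apply: le_trans LM _; rewrite (kneadQ_eq0 k2) /= rt2_ge1.
case: ifPn => [/eqP kE|k4].
  have k3 : k = 3%N by case: kE.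
  rewrite LkS k3 !kneadQ_small Lk1 gk0.
  have := admK kK; rewrite k3 /ubk eqxx Lk0 => /andP[_ La].
  rewrite opprB lerD2r ler_pM2l; last by slra.
  by rewrite lerXn2r// nnegrE; [apply: L_ge0; rewrite k3|exact/ltW/a_gt0].
apply: le_trans LM _; have := kneadQ_gt0' k2 k4.
by rewrite /Mk; case: (Q k.+1).
Qed.

Let rt_le_Xk w : 0 <= w -> w <= 2 -> (k <= 2)%N -> rt w <= Xk k.
Proof. by move=> w0 w2 k2; rewrite /Xk k2 rt_ler. Qed.

(* The condition that makes [th k.+1] monotone up to [X_{k+1}]. *)
Lemma ZQ_le_Xk : (2 < k)%N -> Q k.+1 != 0%N -> Zk (Q k.+1) <= Xk k.
Proof.
move=> k2 Qk; rewrite /Xk leqNgt k2 /=.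
have ZL i : (i < k)%N -> (Q i.+1 < Q k.+1)%N -> Zk (Q k.+1) <= Lk i.
  move=> ik iQ; have /andP[+ _] := admK (ltn_trans ik kK).
  by apply: le_trans; apply: Z_noninc.
case: ifPn => k4; first by apply: ZL; [exact: ltn_trans k2|exact: kneadQ_C2_4].
by apply: ZL; [exact: kneadQQ_ltk|exact: kneadQ_C2].
Qed.

Let Qw_dom w : - Mk k.+1 <= w -> w <= Xk k.+1 ->
  Q k.+1 = 0%N \/ - w <= Xk (Q k.+1) /\ - Mk (Q k.+1) <= - w.
Proof.
rewrite /= => Mw wX; have [->|Q0] := eqVneq (Q k.+1) 0%N; first by left.
right; have [/andP[_ LX] _ _ _ _] := IH kQ; split; first by lra.
rewrite lerN2; apply: le_trans wX _; rewrite /Xk.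
case: ifPn => [/kneadQ_eq0 E|_]; first by rewrite E eqxx in Q0.
case: ifPn => [/eqP kE|k4]; first by rewrite kE kneadQ_small eqxx in Q0.
by rewrite /Mk; case: (Q k.+1) Q0.
Qed.

(** The reason for the choice of [Xk]. In general [w <= X_(k+1) = M_(Q (k+1))] keeps [- w] in the
    domain of [th (Q (k+1))], and the root lands below [Z_(Q (k+1)) <= X_k]. When [Q (k+1) = 0], the
    bound is checked directly: [(a + w) / (1 + a) <= 2] for [w <= 2] preserves the bound [rt 2], and
    [w = X_4 = L_1] is sent to [L_0 = X_3]. *)
Let thQ_range w : - Mk k.+1 <= w -> w <= Xk k.+1 ->
  0 <= th (Q k.+1) (- w) /\ rt (th (Q k.+1) (- w)) <= Xk k.
Proof.
move=> Mw wX; have := Qw_dom Mw wX; have okQ := IH kQ.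
have [Q0 _|Q0] := eqVneq (Q k.+1) 0%N.
  have th_ge0 : 0 <= th (Q k.+1) (- w).
    move: Mw; rewrite /= Q0 Lk0 th0 => Mw.
    by rewrite divr_ge0//; slra.
  split=> //; have [k2|k2] := leqP k.+1 2.
    apply: rt_le_Xk => //; last exact: ltnW.
    move: wX; rewrite /Xk k2 Q0 th0 => wX; have := rt2_le2 => r2.
    rewrite ler_pdivrMr; last by slra.
    by have ap := a_gt0; nra.
  have k3 : k = 3%N.
    apply/eqP/negPn/negP => k3; have := @kneadQ_gt0' k.+1.
    by rewrite -ltnNge k2 Q0 eqSS k3 => /(_ isT isT).
  move: wX; rewrite Q0 k3 /Xk /= kneadQ_small th0 Lk1 Lk0 => wX.
  rewrite -[leRHS](exp_rt m) ?(ltW a_gt0)// rt_ler//; last first.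
    by rewrite ler_pdivrMr; [rewrite mulrC; lra|slra].
  by move: th_ge0; rewrite Q0 th0.
case=> [E|[wX' Mw']]; first by rewrite E eqxx in Q0.
have [/andP[L0 LX] Y0 inv MY br] := okQ.
have [dec _ _] := br (- Mk (Q k.+1)) (Xk (Q k.+1)) (or_intror (conj (lexx _) (lexx _))).
have thL := th_Lk okQ.
have th_ge0 : 0 <= th (Q k.+1) (- w).
  have : - w <= Lk (Q k.+1) by rewrite lerNl.
  rewrite le_eqVlt => /predU1P[->|lt].
    by rewrite thL.
  by rewrite -thL ltW// dec.
split=> //.
have thY : th (Q k.+1) (- w) <= Yk (Q k.+1).
  rewrite -MY; move: Mw'; rewrite le_eqVlt => /predU1P[->//|lt].
  by rewrite ltW// dec.
have [k2|k2] := leqP k 2.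
  apply: rt_le_Xk => //; apply: le_trans thY _.
  apply: le_trans (Y_noninc (leq0n _) kQ) _ => /=; lra.
by apply: le_trans (ZQ_le_Xk k2 Q0); apply: rt_ler.
Qed.

(** The new branch is a sign change followed by [th (Q (k+1))], the root and [th k]. Monotonicity
    and contraction pass through because [Qw_dom] and [thQ_range] put every intermediate interval
    into a controlled domain. *)
Lemma level_okS : level_ok k.+1.
Proof.
have okQ := IH kQ; have okk := IH (leqnn k).
have [/andP[LQ0 LQX] YQ0 invQ MYQ brQ] := okQ.
have [/andP[Lk_0 LkX] Yk_0 invk MYk brk] := okk.
have Mk0 : 0 <= Mk k by apply: M_ge0.
have Yle : Yk k.+1 <= Yk k by apply: Yk_le.
have Y1 : 0 < Yk k.+1.
  apply: Yk_gt0S => //; have /andP[h _] := admK kK.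
  by apply: lt_le_trans h; apply/rt_gt0/Yk_gt0S.
have X_ge0 : 0 <= Xk k by lra.
split=> //; first exact: LkS_bound.
- move=> y /andP[y0 yY].
  have [|/andP[Mg gL] gK] := invk y; first by rewrite y0 (le_trans yY).
  have g0 : 0 <= gk k y.
    rewrite -(gk_YkS okk Mk0); move: yY; rewrite le_eqVlt => /predU1P[->//|lt].
    by rewrite ltW// (gk_lt okk)//.
  have gl0 : 0 <= gk k y ^+ l by rewrite exprn_ge0.
  have glL : gk k y ^+ l <= Lk k ^+ l by rewrite lerXn2r.
  have [|/andP[Mg' gL'] gK'] := invQ (gk k y ^+ l).
    by rewrite gl0 (le_trans glL).
  rewrite gkS thS opprK gK' exp_rt// gK; split=> //.
  rewrite /= lerN2 gL' LkS lerN2 /=.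
  move: glL; rewrite le_eqVlt => /predU1P[->//|lt].
  by rewrite ltW// (gk_lt okQ).
- by rewrite thS /= opprK (th_Lk okQ) rt0.
- move=> p q []// [Mp qX].
  have rng w : p <= w <= q -> - Mk k.+1 <= w /\ w <= Xk k.+1 by move=> /andP[? ?]; split; lra.
  have [decQ crQ invQ'] : [/\ forall x y, p <= x -> x < y -> y <= q -> th (Q k.+1) (- x) < th (Q k.+1) (- y),
      crcontr (fun w => th (Q k.+1) (- w)) p q &
      forall w, p <= w <= q -> gk (Q k.+1) (th (Q k.+1) (- w)) = - w].
    have [pq|qp] := leP p q; last first.
      split; [by move=> x y *; lra|by move=> x y z t *; lra|by move=> w /andP[? ?]; lra].
    have [] := brQ (- q) (- p).
      have [Mp' pX'] := rng p (introT andP (conj (lexx p) pq)).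
      have [Mq' qX'] := rng q (introT andP (conj pq (lexx q))).
      have [|[_ h1]] := Qw_dom Mq' qX'; first by left.
      by have [|[h2 _]] := Qw_dom Mp' pX'; [left|right].
    move=> dec cr inv'; split.
    + by move=> x y px xy yq; apply: dec; lra.
    + move=> x y z t px xy yz zt tq.
      have E : cross x y z t = cross (- x) (- y) (- z) (- t).
        by rewrite /cross; congr (_ / _); ring.
      rewrite E -cross_rev -[leRHS]cross_rev; apply: cr; lra.
    + by move=> w /andP[pw wq]; apply: inv'; apply/andP; split; lra.
  have [|deck crk invk'] := brk 0 (Xk k).
    by right; rewrite oppr_le0.
  have Qpos w : p <= w <= q -> 0 <= th (Q k.+1) (- w) /\ rt (th (Q k.+1) (- w)) <= Xk k.
    by move=> /rng[? ?]; apply: thQ_range.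
  have rtdom w : p <= w <= q -> 0 <= rt (th (Q k.+1) (- w)) <= Xk k.
    by move=> /Qpos[? ->]; rewrite rt_ge0.
  have rtlt x y : p <= x -> x < y -> y <= q -> rt (th (Q k.+1) (- x)) < rt (th (Q k.+1) (- y)).
    move=> px xy yq; apply: rt_ltr; last exact: decQ.
    by have [] := Qpos x; first by rewrite px (le_trans (ltW xy)).
  split.
  + move=> x y px xy yq; rewrite !thS; apply: deck; last first.
    * by move: (rtdom y); rewrite yq (le_trans px (ltW xy)) => /(_ isT)/andP[].
    * exact: rtlt.
    * by move: (rtdom x); rewrite px (le_trans (ltW xy) yq) => /(_ isT)/andP[].
  + have -> : th k.+1 = th k \o (fun w => rt (th (Q k.+1) (- w))) by apply/funext => w; rewrite thS.
    apply: (crcontr_comp _ _ rtdom crk); first by left.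
    have [pq|qp] := leP p q; last by move=> x y z t *; lra.
    apply: (@crcontr_comp _ rt (fun w => th (Q k.+1) (- w)) 0 (th (Q k.+1) (- q))) => //.
    * by left.
    * move=> w /andP[pw wq]; have [|-> _] /= := Qpos w; first by rewrite pw.
      by move: wq; rewrite le_eqVlt => /predU1P[->//|lt]; rewrite ltW// decQ.
    * exact: rt_crcontr.
  + move=> w wpq; have [thQ0 _] := Qpos w wpq.
    by rewrite gkS thS invk' ?rtdom// rt_exp// invQ'// opprK.
Qed.

End Step.

Lemma adm_level_ok K : adm K -> forall k, (k <= K)%N -> level_ok k.
Proof.
move=> admK; elim/ltn_ind => -[_ _|k IHk kK]; first exact: level_ok0.
by apply: (level_okS admK kK) => j jk; apply: IHk => //; rewrite (leq_trans jk)// ltnW.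
Qed.

Section AdmBasics.
Variables (K : nat) (admK : adm K).

Lemma Yk_gt0 k : (k <= K)%N -> 0 < Yk k.
Proof. by move=> /(adm_level_ok admK)[]. Qed.

Lemma Lk_ge0 k : (k <= K)%N -> 0 <= Lk k.
Proof. by move=> /(adm_level_ok admK)[/andP[]]. Qed.

Lemma Mk_ge0 k : (k <= K.+1)%N -> 0 <= Mk k.
Proof.
case: k => [|k] kK; first exact: ler01.
by apply: Lk_ge0; apply: leq_trans (kneadQ_leS k) kK.
Qed.

Lemma Yk_noninc i j : (i <= j)%N -> (j <= K.+1)%N -> Yk j <= Yk i.
Proof.
elim: j => [|j IHj]; first by rewrite leqn0 => /eqP->.
rewrite leq_eqVlt => /predU1P[->//|ij] jk.
apply: le_trans (IHj ij (ltnW jk)); apply: Yk_le; first exact: (adm_level_ok admK).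
by apply: Mk_ge0; apply: ltnW.
Qed.

Lemma Lk_gt0 k : (k < K)%N -> 0 < Lk k.
Proof.
move=> kK; have /andP[h _] := admK kK; apply: lt_le_trans h; apply/rt_gt0/Yk_gt0.
by apply: leq_ltn_trans (kneadQ_leS k) kK.
Qed.

Lemma Zk_noninc i j : (i <= j)%N -> (j <= K)%N -> Zk j <= Zk i.
Proof.
by move=> ij jK; apply: rt_ler; [exact/ltW/Yk_gt0|apply: Yk_noninc => //; exact: leqW].
Qed.

Lemma Zk_ge0 k : (k <= K)%N -> 0 <= Zk k.
Proof. by move=> kK; apply/rt_ge0/ltW/Yk_gt0. Qed.

End AdmBasics.

End Branches.

End Branch.
Import Branch.

(** * The parameter *)

Section LastZero.
Context {R : realType}.
Implicit Types (p q s t x : R) (h lo up phi : R -> R).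

(** The supremum of the points with [h <= 0]; taking the last zero fixes the sign of [h] beyond
    it. *)
Lemma last_zero h p q : p <= q ->
  (forall x, p <= x <= q -> {for x, continuous h}) -> h p <= 0 -> 0 <= h q ->
  exists t, [/\ p <= t <= q, h t = 0 & forall s, t < s -> s <= q -> 0 < h s].
Proof.
move=> pq ch hp hq.
pose S := [set x | p <= x <= q /\ h x <= 0].
have Sp : S p by rewrite /S /= lexx pq.
have Sb : ubound S q by move=> x [/andP[]].
have supS : has_sup S by split; [exists p|exists q].
pose t := sup S.
have pt : p <= t by apply: ub_le_sup => //; exists q.
have tq : t <= q by apply: ge_sup => //; exists p.
have gt s : t < s -> s <= q -> 0 < h s.
  move=> ts sq; rewrite ltNge; apply/negP => hs.
  have : s <= t by apply: ub_le_sup; [exists q|split=> //; lra].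
  by rewrite leNgt ts.
have ct : {for t, continuous h} by apply: ch; rewrite pt.
exists t; split=> //; first by rewrite pt.
apply/eqP; rewrite eq_le; apply/andP; split; rewrite leNgt; apply/negP => ht.
  have : \forall x \near t, 0 < h x by exact: (cvgr_gt _ ct 0 ht).
  move=> /nbhs_ballP[e /= e0 be].
  have [x [/andP[px xq] hx] tex] := sup_adherent e0 supS.
  have xt : x <= t by apply: ub_le_sup; [exists q|split=> //; lra].
  have := be x; rewrite /ball /= ltr_norml => H.
  by move: hx; rewrite leNgt H//; rewrite -/t in tex; apply/andP; split; lra.
move: tq; rewrite le_eqVlt => /predU1P[tq|tq].
  by move: ht; rewrite tq ltNge hq.
have : \forall x \near t, h x < 0 by exact: (cvgr_lt _ ct 0 ht).
move=> /nbhs_ballP[e /= e0 be].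
pose s := t + Num.min (e / 2) (q - t).
have m0 : 0 < Num.min (e / 2) (q - t) by rewrite lt_min; apply/andP; split; lra.
have me : Num.min (e / 2) (q - t) <= e / 2 by rewrite ge_min lexx.
have mq : Num.min (e / 2) (q - t) <= q - t by rewrite ge_min lexx orbT.
have /be : ball t e s by rewrite /ball /= ltr_norml /s; apply/andP; split; lra.
by rewrite /= ltNge ltW// gt// /s; lra.
Qed.

(** [p'] is the last point on the lower curve and [q'] the first point after [p'] on the upper one,
    found as a last zero after reflection. *)
Lemma band_crossing phi lo up p q : p <= q ->
  (forall x, p <= x <= q -> {for x, continuous phi}) ->
  (forall x, p <= x <= q -> {for x, continuous lo}) ->
  (forall x, p <= x <= q -> {for x, continuous up}) ->
  (forall x, p <= x <= q -> lo x <= up x) ->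
  phi p <= lo p -> up q <= phi q ->
  exists p' q', [/\ p <= p' <= q', q' <= q, phi p' = lo p', phi q' = up q' &
    forall x, p' <= x <= q' -> lo x <= phi x <= up x].
Proof.
move=> pq cphi clo cup loup php phq.
have [|||p' [/andP[pp' p'q] hp' gt]] := @last_zero (fun x => phi x - lo x) p q pq.
- by move=> x xpq; apply: continuousB; [exact: cphi|exact: clo].
- by lra.
- by have := loup q; rewrite pq lexx => /(_ isT); lra.
have [||||q' [/andP[qq' q'p] hq' gt']] :=
    @last_zero (fun x => up (- x) - phi (- x)) (- q) (- p').
- by lra.
- move=> x /andP[qx xp]; have nx : p <= - x <= q by apply/andP; split; lra.
  by apply: continuousB; apply: continuous_comp; rewrite /=; try exact: opp_continuous;
    [exact: cup|exact: cphi].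
- by rewrite opprK; lra.
- by rewrite opprK; have := loup p'; rewrite pp' p'q => /(_ isT); lra.
exists p', (- q'); split=> //; try (apply/andP; split); try lra.
move=> x /andP[px xq]; apply/andP; split.
  move: px; rewrite le_eqVlt => /predU1P[<-|px]; first lra.
  by have := gt x px; rewrite /=; lra.
move: xq; rewrite le_eqVlt => /predU1P[->|xq]; first lra.
by have := gt' (- x); rewrite opprK; lra.
Qed.

End LastZero.

Section Param.
Context {R : realType} (m : nat).
Implicit Types (a p q w x y : R) (i j k K : nat).

Local Notation l := (2 ^ m)%N.
Local Notation Q := kneadQ.
Local Notation rt := (rt m).
Local Notation th := (th m).
Local Notation gk := (gk m).
Local Notation Lk := (Lk m).
Local Notation Zk := (Zk m).
Local Notation Yk := (Yk m).
Local Notation ubk := (ubk m).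
Local Notation adm := (adm m).

(** The argument is allowed to vary with the parameter, which is what the recursion for [th]
    produces. *)
Lemma th_continuous k (u : R -> R) a : 0 < a -> {for a, continuous u} ->
  {for a, continuous (fun b => th b k (u b))}.
Proof.
move=> a0; elim/ltn_ind: k u => -[_|k IH] u cu.
  apply: continuousM; first by apply: continuousB => //; exact: cvg_id.
  apply: continuousV; first by rewrite gt_eqF//; lra.
  by apply: continuousD; [exact: cvg_cst|exact: cvg_id].
rewrite [X in {for _, continuous X}](_ : _ =
  fun b => th b k (rt (th b (Q k.+1) (- u b)))); last by apply/funext => b; rewrite thS.
apply: (IH) => //; apply: (continuous_comp _ (@rt_continuous R m _)).
apply: (IH); first by rewrite ltnS kneadQ_leS.
exact: continuousN.
Qed.

Lemma gk_continuous k (u : R -> R) a : {for a, continuous u} ->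
  {for a, continuous (fun b => gk b k (u b))}.
Proof.
elim/ltn_ind: k u => -[_|k IH] u cu.
  apply: continuousB; first exact: cvg_id.
  by apply: continuousM => //; apply: continuousD; [exact: cvg_cst|exact: cvg_id].
rewrite [X in {for _, continuous X}](_ : _ =
  fun b => - gk b (Q k.+1) (gk b k (u b) ^+ l)); last by apply/funext => b; rewrite gkS.
apply: continuousN; apply: (IH); first by rewrite ltnS kneadQ_leS.
apply: (continuous_comp (g := fun x : R => x ^+ l)); last exact: exprn_continuous.
exact: (IH).
Qed.

Lemma Lk_continuous k a : {for a, continuous (Lk ^~ k)}.
Proof. by apply: gk_continuous; exact: cvg_cst. Qed.

Lemma Zk_continuous k a : 0 < a -> {for a, continuous (Zk ^~ k)}.
Proof.
move=> a0; apply: (continuous_comp _ (@rt_continuous R m _)).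
by case: k => [|k]; [exact: cvg_cst|apply: th_continuous => //; exact: cvg_cst].
Qed.

Lemma ubk_continuous k a : 0 < a -> {for a, continuous (ubk ^~ k)}.
Proof.
move=> a0; rewrite /ubk; case: eqP => _; first exact: Lk_continuous.
exact: Zk_continuous.
Qed.

(** Over the parameter interval [L_K] sweeps across the band prescribed at level [K]; a subinterval
    on which it stays inside has its ends on the two boundary curves. The disjunctions leave open in
    which direction the band is crossed. *)
Lemma adm_step K p q : (0 < m)%N -> 1 / 2 <= p -> p <= q -> q <= 1 ->
  (forall a, p <= a <= q -> adm a K) ->
  ((Lk p K <= Zk p (Q K.+1).+1 /\ ubk q K <= Lk q K) \/
   (Lk q K <= Zk q (Q K.+1).+1 /\ ubk p K <= Lk p K)) ->
  exists p' q', [/\ p <= p' <= q', q' <= q,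
    forall a, p' <= a <= q' -> adm a K.+1 &
    (Lk p' K = Zk p' (Q K.+1).+1 /\ Lk q' K = ubk q' K) \/
    (Lk q' K = Zk q' (Q K.+1).+1 /\ Lk p' K = ubk p' K)].
Proof.
move=> m0 p2 pq q1 admK ends.
have pos a : p <= a <= q -> 0 < a by move=> /andP[pa _]; lra.
have le1 a : p <= a <= q -> a <= 1 by move=> /andP[_ aq]; lra.
have loup a : p <= a <= q -> Zk a (Q K.+1).+1 <= ubk a K.
  move=> apq; have aK := admK a apq; have a0 := pos a apq; have a1 := le1 a apq.
  rewrite /ubk; case: eqP => [K3|_].
    have := aK 0%N; rewrite K3 kneadQ_small => /(_ isT)/andP[+ _].
    apply: le_trans; rewrite kneadQ_small.
    by apply: (Zk_noninc a0 a1 aK) => //; rewrite K3.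
  apply: rt_ler; last first.
    by apply: (Yk_noninc a0 a1 aK) => //; rewrite ltnS kneadQ_leS.
  have okQ := adm_level_ok a0 a1 aK (kneadQ_leS K).
  have M0 := Mk_ge0 a0 a1 aK (leqW (kneadQ_leS K)).
  have LQ0 := Lk_ge0 a0 a1 aK (kneadQ_leS K).
  move: LQ0; rewrite le_eqVlt => /predU1P[LQ0|LQ0]; last by apply: ltW; apply: Yk_gt0S.
  by have := th_Lk okQ; rewrite -LQ0 => <-.
have cub a : p <= a <= q -> {for a, continuous (ubk ^~ K)}.
  by move=> apq; apply: ubk_continuous; exact: pos.
have clo a : p <= a <= q -> {for a, continuous (Zk ^~ (Q K.+1).+1)}.
  by move=> apq; apply: Zk_continuous; exact: pos.
have cL a : p <= a <= q -> {for a, continuous (Lk ^~ K)}.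
  by move=> _; apply: Lk_continuous.
have fin p' q' : p <= p' -> q' <= q ->
    (forall a, p' <= a <= q' -> Zk a (Q K.+1).+1 <= Lk a K <= ubk a K) ->
    forall a, p' <= a <= q' -> adm a K.+1.
  move=> pp' q'q h a /andP[pa aq] i; rewrite ltnS leq_eqVlt => /predU1P[->|iK].
    by apply: h; rewrite pa.
  by apply: (admK a) => //; apply/andP; split; lra.
case: ends => [[h1 h2]|[h1 h2]].
  have [p' [q' [/andP[pp' pq'] q'q e1 e2 h]]] := band_crossing pq cL clo cub loup h1 h2.
  exists p', q'; split; [by rewrite pp'|by []|exact: fin|by left].
have N (h : R -> R) : (forall a, p <= a <= q -> {for a, continuous h}) ->
    forall a, - q <= a <= - p -> {for a, continuous (fun b => h (- b))}.
  move=> ch a /andP[qa ap]; apply: continuous_comp; first exact: opp_continuous.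
  by apply: ch; apply/andP; split; lra.
have [||||p' [q' [/andP[pp' pq'] q'q e1 e2 h]]] :=
    @band_crossing R _ _ _ (- q) (- p) _ (N _ cL) (N _ clo) (N _ cub).
- by rewrite lerN2.
- by move=> a /andP[qa ap]; apply: loup; apply/andP; split; lra.
- by rewrite /= !opprK.
- by rewrite /= !opprK.
exists (- q'), (- p'); split; [by apply/andP; split; lra|by lra| |by right].
apply: fin; [by lra|by lra|move=> a /andP[qa ap]].
by have := h (- a); rewrite opprK; apply; apply/andP; split; lra.
Qed.

Section Ends.
Variables (a : R) (a_gt0 : 0 < a) (a_le1 : a <= 1).

(** On the lower boundary curve the turning point becomes periodic and [L_(K+1)] is below the next
    band; on the upper one [Lk_upper_end] and [ubk_upper_end] put it at or above the top of that
    band. So the next band is crossed as well. *)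
Lemma Lk_lower_end K : adm a K -> Lk a K = Zk a (Q K.+1).+1 -> Lk a K.+1 = 0.
Proof.
move=> aK E; have okQ := adm_level_ok a_gt0 a_le1 aK (kneadQ_leS K).
have M0 := Mk_ge0 a_gt0 a_le1 aK (leqW (kneadQ_leS K)).
have LQ0 := Lk_ge0 a_gt0 a_le1 aK (kneadQ_leS K).
have E0 : gk a (Q K.+1) (Yk a (Q K.+1).+1) = 0 by apply: gk_YkS.
rewrite LkS E /Zk rt_exp ?E0 ?oppr0//.
move: LQ0; rewrite le_eqVlt => /predU1P[LQ0|LQ0]; last by apply: ltW; apply: Yk_gt0S.
by have := th_Lk okQ; rewrite -LQ0 => <-.
Qed.

Lemma Lk_upper_end K : adm a K -> Lk a K = ubk a K ->
  Lk a K.+1 = if K == 3%N then Lk a 1 else Mk m a (Q K.+1).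
Proof.
move=> aK; rewrite /ubk; case: eqP => [->|K3] E.
  by rewrite LkS E kneadQ_small gk0 Lk1 Lk0; ring.
have okQ := adm_level_ok a_gt0 a_le1 aK (kneadQ_leS K).
have M0 := Mk_ge0 a_gt0 a_le1 aK (leqW (kneadQ_leS K)).
have E0 : gk a (Q K.+1) (Yk a (Q K.+1)) = - Mk m a (Q K.+1) by apply: gk_Yk.
rewrite LkS E /Zk rt_exp ?E0 ?opprK//.
by apply/ltW/(Yk_gt0 a_gt0 a_le1 aK)/kneadQ_leS.
Qed.

Lemma ubk_upper_end K : adm a K.+1 ->
  ubk a K.+1 <= if K == 3%N then Lk a 1 else Mk m a (Q K.+1).
Proof.
move=> aK; have Zn := Zk_noninc a_gt0 a_le1 aK.
have ZL i : (i < K.+1)%N -> Zk a (Q i.+1).+1 <= Lk a i by move=> /aK/andP[].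
rewrite /ubk eqSS; case: (eqVneq K 3%N) => [K3|K3].
  rewrite K3 /=; apply: le_trans (ZL 1%N _); last by rewrite K3.
  by rewrite !kneadQ_small Zn// K3.
have [K2|K2] := leqP K 1.
  rewrite (kneadQ_eq0 (k := K.+1))// /Mk -(Zk0 m a).
  by rewrite ifF ?Zn ?kneadQSS_le ?(leq_trans (kneadQSS_le _))//; case: (K) K2 => [|[]].
have [->|K4] := eqVneq K 2%N; first by rewrite /= kneadQ_small.
have K5 : (4 < K.+1)%N by rewrite ltnS ltn_neqAle eq_sym K3 ltn_neqAle eq_sym K4.
have := kneadQ_gt0 K5; rewrite /Mk; case E : (Q K.+1) => [//|q] _; rewrite -E.
apply: le_trans (ZL _ _); last exact: leqW (kneadQQS_lt K5).
by apply: Zn; [exact: kneadQQQS_lt|apply: leqW; exact: kneadQSS_le].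
Qed.

Lemma Zk_lo_ge0 K : adm a K.+1 -> 0 <= Zk a (Q K.+2).+1.
Proof. by move=> aK; apply: (Zk_ge0 a_gt0 a_le1 aK); rewrite ltnS kneadQSS_le. Qed.

End Ends.

Lemma half_exp : (0 < m)%N -> (1 / 2 : R) ^+ l <= 1 / 3.
Proof.
move=> m0; have l2 : (2 <= l)%N by rewrite -[X in (X <= _)%N]expn1 leq_exp2l.
apply: (@le_trans _ _ ((1 / 2) ^+ 2)); last by rewrite expr2; lra.
by rewrite ler_wiXn2l//; lra.
Qed.

Lemma adm_interval K : (0 < m)%N -> exists p q, [/\ 1 / 2 <= p, p <= q, q <= 1,
  (forall a, p <= a <= q -> adm a K) &
  ((Lk p K <= Zk p (Q K.+1).+1 /\ ubk q K <= Lk q K) \/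
   (Lk q K <= Zk q (Q K.+1).+1 /\ ubk p K <= Lk p K))].
Proof.
move=> m0; elim: K => [|K [p [q [p2 pq q1 aK ends]]]].
  (* [L_0 = a] and the band is from [Z_1] to 1. The value 1 is at its top, and [1 / 2] is below it
     because [(1 / 2)^l <= 1 / 3], which is [Y_1] for this parameter. *)
  exists (1 / 2), 1; split; [by []|by lra|by []|by move=> a _ i; rewrite ltn0|left].
  rewrite kneadQ_small /ubk /= kneadQ_small Zk0 !Lk0; split=> //.
  have h0 : (0 : R) <= 1 / 2 by lra.
  rewrite -[leLHS](exp_rt m h0); apply: rt_ler; first exact: exprn_ge0.
  by apply: le_trans (half_exp m0) _; rewrite /Yk th0 (_ : (1 / 2 - 0) / (1 + 1 / 2) = 1 / 3 :> R)//; field.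
have [p' [q' [/andP[pp' pq'] q'q aK' ends']]] := adm_step m0 p2 pq q1 aK ends.
exists p', q'; split=> //; try lra.
have pin : p' <= p' <= q' by rewrite lexx.
have qin : p' <= q' <= q' by rewrite lexx pq'.
have p0 : 0 < p' by lra. have p1 : p' <= 1 by lra.
have q0 : 0 < q' by lra. have q1' : q' <= 1 by lra.
have aKp : adm p' K by move=> i iK; apply: aK' => //; apply: ltnW.
have aKq : adm q' K by move=> i iK; apply: aK' => //; apply: ltnW.
case: ends' => [[E1 E2]|[E1 E2]]; [left|right]; split.
- by rewrite (Lk_lower_end p0 p1 aKp E1); apply: Zk_lo_ge0 => //; apply: aK'.
- by rewrite (Lk_upper_end q0 q1' aKq E2); apply: ubk_upper_end => //; apply: aK'.
- by rewrite (Lk_lower_end q0 q1' aKq E1); apply: Zk_lo_ge0 => //; apply: aK'.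
- by rewrite (Lk_upper_end p0 p1 aKp E2); apply: ubk_upper_end => //; apply: aK'.
Qed.

(** The conditions are closed in [a]: a cluster point of parameters admissible up to level [K], as
    [K] grows, satisfies all of them. *)
Lemma adm_param : (0 < m)%N -> exists a, [/\ 1 / 2 <= a, a <= 1 & forall K, adm a K].
Proof.
move=> m0; pose P (K : nat) (b : R) := [/\ 1 / 2 <= b, b <= 1 & adm b K].
have /choice[b bP] : forall K, exists b, P K b.
  move=> K; have [p [q [p2 pq q1 aK _]]] := adm_interval K m0.
  by exists p; split=> //; [lra|apply: aK; rewrite lexx].
have FA : (b @ \oo) `[1 / 2, 1]%classic.
  by exists 0%N => // n _ /=; have [b2 b1 _] := bP n; rewrite in_itv /= b2.
have [a [/= aI ca]] := @segment_compact R (1 / 2) 1 (b @ \oo) _ FA.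
move: aI; rewrite in_itv /= => /andP[a2 a1]; exists a; split=> // K i iK.
have a0 : 0 < a by lra.
have key (u v : R -> R) : {for a, continuous u} -> {for a, continuous v} ->
    (forall n, (i < n)%N -> u (b n) <= v (b n)) -> u a <= v a.
  move=> cu cv uv; rewrite leNgt; apply/negP => vu.
  have N : \forall x \near a, 0 < u x - v x.
    by apply: (cvgr_gt _ (continuousB cu cv) 0); rewrite subr_gt0.
  have F : (b @ \oo) [set x | u x <= v x].
    by exists i.+1 => // n /= ni; apply: uv.
  have [x [/= xF xN]] := ca _ _ F N.
  by move: xN; rewrite subr_gt0 ltNge xF.
have adn n : (i < n)%N -> Zk (b n) (Q i.+1).+1 <= Lk (b n) i <= ubk (b n) i.
  by move=> ni; have [_ _] := bP n; apply.
apply/andP; split.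
  by apply: (key (Zk ^~ _) (Lk ^~ i)); [exact: Zk_continuous|exact: Lk_continuous|move=> n /adn/andP[]].
by apply: (key (Lk ^~ i) (ubk ^~ i)); [exact: Lk_continuous|exact: ubk_continuous|move=> n /adn/andP[]].
Qed.

(** Equality below makes [L_(i+1)] vanish, against its own lower bound. Equality above propagates to
    all later levels and gives [Z_(Q (i+6)) = L_s] with [s = Q (Q (i+5))], against the strict lower
    bound at [s]. *)
Lemma adm_strict a : 0 < a -> a <= 1 -> (forall K, adm a K) ->
  forall i, Zk a (Q i.+1).+1 < Lk a i < ubk a i.
Proof.
move=> a0 a1 aK.
have lo i : Zk a (Q i.+1).+1 < Lk a i.
  have /andP[h _] := aK i.+1 i (ltnSn i); rewrite lt_neqAle h andbT.
  apply/eqP => /esym/(Lk_lower_end a0 a1 (aK i)) E.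
  by have := Lk_gt0 a0 a1 (aK i.+2) (ltnSn i.+1); rewrite E ltxx.
suff up i : Lk a i < ubk a i by move=> i; rewrite lo up.
have /andP[_ h] := aK i.+1 i (ltnSn i); rewrite lt_neqAle h andbT; apply/eqP => E.
have EE n : Lk a (i + n) = ubk a (i + n).
  elim: n => [|n IH]; first by rewrite addn0.
  rewrite addnS; apply/eqP; rewrite eq_le; have /andP[_ ->] := aK _ _ (ltnSn (i + n).+1).
  by rewrite (Lk_upper_end a0 a1 (aK _) IH) (ubk_upper_end a0 a1 (aK _)).
have := EE 5%N; rewrite addnS => E5.
have E4 := EE 4%N; have := Lk_upper_end a0 a1 (aK _) E4; rewrite E5.
have K5 : (4 < (i + 4).+1)%N by rewrite ltnS leq_addl.
have := kneadQ_gt0 K5; rewrite /Mk; case Eq : (Q (i + 4).+1) => [//|q] _; rewrite -Eq.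
have -> : (i + 4 == 3)%N = false by rewrite !addnS.
rewrite /ubk; have -> : ((i + 4).+1 == 3)%N = false by rewrite !addnS.
move=> E6; have := lo (Q (Q (i + 4).+1)); rewrite -E6 ltNge => /negP; apply.
by apply: (Zk_noninc a0 a1 (aK (i + 4).+2)); [exact: kneadQQQS_lt|do 2 apply: leqW; exact: kneadQSS_le].
Qed.

End Param.

(** * A priori bounds *)

Module Height.

Section LogEstimates.
Context {R : realType}.
Implicit Types (w t x y : R).

Lemma ln_diff_exp w w' : 0 < w -> 0 < w' -> w' = w * expR (- (ln w - ln w')).
Proof.
move=> w0 w'0; rewrite opprB expRD expRN !lnK ?posrE//.
by rewrite mulrCA divff ?mulr1// gt_eqF.
Qed.

Lemma sub_le_ln w w' : 0 < w -> 0 < w' -> w - w' <= (ln w - ln w') * w.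
Proof.
move=> w0 w'0; rewrite {1}(ln_diff_exp w0 w'0); set t := ln w - ln w'.
by have := expR_ge1Dx (- t); nra.
Qed.

Lemma ln_le_sub w w' : 0 < w -> 0 < w' -> (ln w - ln w') * w' <= w - w'.
Proof.
move=> w0 w'0; rewrite {2}(ln_diff_exp w'0 w0) opprB; set t := ln w - ln w'.
by have := expR_ge1Dx t; nra.
Qed.

Lemma expR_le_1D2x t : 0 <= t -> t <= 1 / 2 -> expR t <= 1 + 2 * t.
Proof.
move=> t0 t1; have h := expR_ge1Dx (- t).
have e0 := expR_gt0 t; have := expRxMexpNx_1 t.
move: (expR (- t)) h => e h E; nra.
Qed.

Lemma sub_le_2ln w w' : 0 < w' -> w' <= w -> ln w - ln w' <= 1 / 2 ->
  w - w' <= 2 * (ln w - ln w') * w'.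
Proof.
move=> w'0 w'w; have w0 : 0 < w by lra.
have t0 : 0 <= ln w - ln w' by rewrite subr_ge0 ler_ln.
move=> t1; rewrite {1}(ln_diff_exp w'0 w0) opprB; move: (ln w - ln w') t0 t1 => t t0 t1.
by have := expR_le_1D2x t0 t1; nra.
Qed.

Lemma half_ln_le_sub w w' : 0 < w' -> w' <= w -> ln w - ln w' <= 1 ->
  (ln w - ln w') / 2 * w <= w - w'.
Proof.
move=> w'0 w'w; have w0 : 0 < w by lra.
have t0 : 0 <= ln w - ln w' by rewrite subr_ge0 ler_ln.
move=> t1; rewrite {2}(ln_diff_exp w0 w'0); move: (ln w - ln w') t0 t1 => t t0 t1.
have h := expR_ge1Dx t; have e0 := expR_gt0 (- t); have := expRxMexpNx_1 t.
move: (expR t) (expR (- t)) h e0 => e e' h e0 E.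
have te : (1 + t) * e' <= 1 by rewrite -E; nra.
have : t / 2 <= 1 - e' by case: (lerP (1 / 2) e') => ?; nra.
by nra.
Qed.

End LogEstimates.

Section CrossDrop.
Context {R : realType} (phi : R -> R) (p q : R).
Hypothesis (dec : forall x y, p <= x -> x < y -> y <= q -> phi y < phi x).
Hypothesis (cr : crcontr phi p q).
Implicit Types (a b c d : R).

Lemma crcontr_mul a b c d : p <= a -> a < b -> b < c -> c < d -> d <= q ->
  ((phi a - phi d) * (phi b - phi c)) * ((b - a) * (d - c)) <=
  ((d - a) * (c - b)) * ((phi a - phi b) * (phi c - phi d)).
Proof.
move=> pa ab bc cd dq.
have yab : phi b < phi a by apply: dec; lra.
have ybc : phi c < phi b by apply: dec; lra.
have ycd : phi d < phi c by apply: dec; lra.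
have := cr pa ab bc cd dq; rewrite -cross_rev /cross.
rewrite ler_pdivlMr; last by rewrite mulr_gt0// subr_gt0.
rewrite mulrAC ler_pdivrMr; last by rewrite mulr_gt0// subr_gt0.
by move=> h; apply: (le_trans _ (le_trans h _)); rewrite le_eqVlt; apply/orP; left;
  apply/eqP; ring.
Qed.

(** The factor [(phi a - phi d) / (phi c - phi d) >= 1] of the image cross-ratio is discarded;
    [crcontr_drop2] discards [(phi a - phi d) / (phi a - phi b)] instead. *)
Lemma crcontr_drop1 a b c d : p <= a -> a < b -> b < c -> c < d -> d <= q ->
  (phi b - phi c) * ((b - a) * (d - c)) <= ((d - a) * (c - b)) * (phi a - phi b).
Proof.
move=> pa ab bc cd dq; have := crcontr_mul pa ab bc cd dq.
have yab : phi b < phi a by apply: dec; lra.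
have ybc : phi c < phi b by apply: dec; lra.
have ycd : phi d < phi c by apply: dec; lra.
rewrite [X in _ <= X]mulrA => h.
have y0 : 0 < phi c - phi d by lra.
rewrite -(ler_pM2r y0); apply: le_trans h.
rewrite mulrAC ler_pM2r; last by rewrite mulr_gt0//; lra.
by rewrite mulrC ler_pM2r; lra.
Qed.

Lemma crcontr_drop2 a b c d : p <= a -> a < b -> b < c -> c < d -> d <= q ->
  (phi b - phi c) * ((b - a) * (d - c)) <= ((d - a) * (c - b)) * (phi c - phi d).
Proof.
move=> pa ab bc cd dq; have := crcontr_mul pa ab bc cd dq.
have yab : phi b < phi a by apply: dec; lra.
have ybc : phi c < phi b by apply: dec; lra.
have ycd : phi d < phi c by apply: dec; lra.
rewrite [(phi a - phi b) * _]mulrC [X in _ <= X]mulrA => h.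
have y0 : 0 < phi a - phi b by lra.
rewrite -(ler_pM2r y0); apply: le_trans h.
rewrite mulrAC ler_pM2r; last by rewrite mulr_gt0//; lra.
by rewrite mulrC ler_pM2r; lra.
Qed.
End CrossDrop.

Section Heights.
Context {R : realType} (m : nat) (a : R).
Implicit Types (w x y : R) (i j k K : nat).

Local Notation l := (2 ^ m)%N.
Local Notation lr := ((2 ^ m)%:R : R).
Local Notation Q := kneadQ.
Local Notation rt := (rt m).
Local Notation th := (th m a).
Local Notation gk := (gk m a).
Local Notation Lk := (Lk m a).
Local Notation Zk := (Zk m a).
Local Notation Yk := (Yk m a).
Local Notation Mk := (Mk m a).
Local Notation Xk := (Xk m a).
Local Notation ubk := (ubk m a).
Local Notation adm := (adm m a).

Hypotheses (a_gt0 : 0 < a) (a_le1 : a <= 1) (admK : forall K, adm K).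
Arguments admK : clear implicits.

(* Logarithmic coordinates [- l ln x] of [Z_k], [L_k] and [X_k]; the a priori bounds say
   that the differences [gap], [off] and [ext] are neither large nor small. *)
Definition height k := - ln (Yk k).
Definition gap k := height k.+1 - height k.
Definition lheight k := - (lr * ln (Lk k)).
Definition xheight k := - (lr * ln (Xk k)).
Definition ext k := lheight k - xheight k.
Definition off k := height (Q k.+1).+1 - lheight k.

Lemma lok k : level_ok m a k.
Proof. exact: (adm_level_ok a_gt0 a_le1 (admK k) (leqnn k)). Qed.

Lemma Y_gt0 k : 0 < Yk k. Proof. exact: (Yk_gt0 a_gt0 a_le1 (admK k)). Qed.
Lemma Z_gt0 k : 0 < Zk k. Proof. exact/rt_gt0/Y_gt0. Qed.
Lemma L_gt0 k : 0 < Lk k. Proof. exact: (Lk_gt0 a_gt0 a_le1 (admK k.+1)). Qed.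
Lemma M_gt0 k : 0 < Mk k. Proof. by case: k => [|k]; [exact: ltr01|exact: L_gt0]. Qed.
Lemma LX k : Lk k <= Xk k. Proof. by have [/andP[]] := lok k. Qed.
Lemma X_gt0 k : 0 < Xk k. Proof. exact: lt_le_trans (L_gt0 k) (LX k). Qed.
Lemma L_gtZ k : Zk (Q k.+1).+1 < Lk k.
Proof. by have /andP[] := adm_strict a_gt0 a_le1 admK k. Qed.
Lemma L_ltub k : Lk k < ubk k.
Proof. by have /andP[] := adm_strict a_gt0 a_le1 admK k. Qed.
Lemma ub_leZ k : ubk k <= Zk (Q k.+1).
Proof. by rewrite /ubk; case: eqP => [->|//]; rewrite kneadQ_small Zk0 Lk0. Qed.
Lemma L_ltZ k : Lk k < Zk (Q k.+1).
Proof. exact: lt_le_trans (L_ltub k) (ub_leZ k). Qed.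

Lemma th_dec k x y : - Mk k <= x -> x < y -> y <= Xk k -> th k y < th k x.
Proof.
have [_ _ _ _ br] := lok k.
by have [dec _ _] := br (- Mk k) (Xk k) (or_intror (conj (lexx _) (lexx _))); exact: dec.
Qed.

Lemma th_cr k : crcontr (th k) (- Mk k) (Xk k).
Proof.
have [_ _ _ _ br] := lok k.
by have [_ cr _] := br (- Mk k) (Xk k) (or_intror (conj (lexx _) (lexx _))).
Qed.

Lemma th_gk k y : 0 <= y <= Yk k -> th k (gk k y) = y.
Proof. by have [_ _ inv _ _] := lok k => /inv[]. Qed.

Lemma gk_bounds k y : 0 <= y <= Yk k -> - Mk k <= gk k y <= Lk k.
Proof. by have [_ _ inv _ _] := lok k => /inv[]. Qed.

Lemma gk_th k w : - Mk k <= w <= Xk k -> gk k (th k w) = w.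
Proof.
have [_ _ _ _ br] := lok k.
by have [_ _ h] := br (- Mk k) (Xk k) (or_intror (conj (lexx _) (lexx _))); exact: h.
Qed.

Lemma thL k : th k (Lk k) = 0. Proof. exact: th_Lk (lok k). Qed.
Lemma thM k : th k (- Mk k) = Yk k. Proof. by have [] := lok k. Qed.
Lemma th0E k : th k 0 = Yk k.+1. Proof. by []. Qed.

Lemma thZ k : th k (Zk (Q k.+1).+1) = Yk k.+2.
Proof. by rewrite [RHS]/= thS oppr0. Qed.

Lemma Y_ltS k : Yk k.+1 < Yk k.
Proof.
rewrite -(th0E k) -(thM k); apply: th_dec; rewrite ?lexx ?oppr_lt0 ?M_gt0//.
exact/ltW/X_gt0.
Qed.

Lemma Y_noninc i j : (i <= j)%N -> Yk j <= Yk i.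
Proof. by move=> ij; apply: (Yk_noninc a_gt0 a_le1 (admK j)). Qed.

Lemma Z_noninc i j : (i <= j)%N -> Zk j <= Zk i.
Proof. by move=> ij; apply: (Zk_noninc a_gt0 a_le1 (admK j)). Qed.

Lemma Z_ltS k : Zk k.+1 < Zk k.
Proof. by apply: rt_ltr; [exact/ltW/Y_gt0|exact: Y_ltS]. Qed.

Lemma lr_gt0 : 0 < lr. Proof. by rewrite ltr0n expn_gt0. Qed.

Lemma lnZ k : ln (Zk k) = - height k / lr.
Proof.
have Z0 := Z_gt0 k; rewrite /height opprK.
have -> : Yk k = Zk k ^+ l by rewrite /Zk rt_exp// ltW// Y_gt0.
by rewrite lnXn// -[ln _ *+ _]mulr_natr mulfK// gt_eqF// lr_gt0.
Qed.

Lemma lnL k : ln (Lk k) = - lheight k / lr.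
Proof. by rewrite /lheight opprK mulrC mulKf// gt_eqF// lr_gt0. Qed.

Lemma lnX k : ln (Xk k) = - xheight k / lr.
Proof. by rewrite /xheight opprK mulrC mulKf// gt_eqF// lr_gt0. Qed.

Lemma gap_gt0 k : 0 < gap k.
Proof. by rewrite /gap /height opprK addrC subr_gt0 ltr_ln ?posrE ?Y_gt0// Y_ltS. Qed.

Lemma height0 : height 0 = 0. Proof. by rewrite /height ln1 oppr0. Qed.

Lemma height_mono i j : (i <= j)%N -> height i <= height j.
Proof. by move=> ij; rewrite lerN2 ler_ln ?posrE ?Y_gt0// Y_noninc. Qed.

Lemma expR_gap k : expR (gap k) = Yk k / Yk k.+1.
Proof. by rewrite /gap /height opprK addrC expRD expRN !lnK ?posrE ?Y_gt0. Qed.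

Lemma lheight_gt k : height (Q k.+1) < lheight k.
Proof.
have := L_ltZ k; rewrite -ltr_ln ?posrE ?Z_gt0 ?L_gt0// lnZ lnL.
by rewrite ltr_pM2r ?invr_gt0 ?lr_gt0// ltrN2.
Qed.

Lemma off_gt0 k : 0 < off k.
Proof.
have := L_gtZ k; rewrite -ltr_ln ?posrE ?Z_gt0 ?L_gt0// lnZ lnL.
by rewrite ltr_pM2r ?invr_gt0 ?lr_gt0// ltrN2 /off subr_gt0.
Qed.

Lemma off_lt k : off k < gap (Q k.+1).
Proof. by rewrite /off /gap ltrD2l ltrN2 lheight_gt. Qed.

Lemma height_sub i j A : (i <= j)%N -> (forall k, (i <= k < j)%N -> gap k <= A) ->
  height j - height i <= (j - i)%:R * A.
Proof.
elim: j => [|j IH]; first by rewrite leqn0 => /eqP-> _; rewrite !subrr mul0r.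
rewrite leq_eqVlt => /predU1P[->|ij] gA; first by rewrite subnn subrr mul0r.
rewrite subSn// -natr1 mulrDl mul1r.
have -> : height j.+1 - height i = (height j - height i) + gap j by rewrite /gap; ring.
apply: lerD; last by apply: gA; apply/andP.
by apply: IH => // k /andP[ik kj]; apply: gA; rewrite ik ltnW.
Qed.

Lemma subNdiv (x y z : R) : - x / z - (- y / z) = (y - x) / z.
Proof. by ring. Qed.

Lemma lnLZ k : ln (Lk k) - ln (Zk (Q k.+1).+1) = off k / lr.
Proof. by rewrite lnL lnZ subNdiv. Qed.

Lemma lnXL k : ln (Xk k) - ln (Lk k) = ext k / lr.
Proof. by rewrite lnX lnL subNdiv. Qed.

Lemma expR_off k : expR (off k) = Lk k ^+ l / Yk (Q k.+1).+1.
Proof.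
rewrite /off /height /lheight opprK addrC expRD expRN lnK ?posrE ?Y_gt0//; congr (_ * _).
by rewrite mulr_natl -lnXn ?L_gt0// lnK// posrE exprn_gt0 ?L_gt0.
Qed.

Lemma ext_gt0_lt k : 0 < ext k -> Lk k < Xk k.
Proof.
move=> e0; rewrite -ltr_ln ?posrE ?L_gt0 ?X_gt0// -subr_gt0 lnXL.
by rewrite divr_gt0 ?lr_gt0.
Qed.

Lemma mulr_mono4 (p r s t u v s' t' u' v' : R) : 0 <= p -> 0 <= r ->
  0 <= s' -> s' <= s -> 0 <= t' -> t' <= t -> 0 <= u -> u <= u' -> 0 <= v -> v <= v' ->
  p * (s * t) <= (u * v) * r -> p * (s' * t') <= (u' * v') * r.
Proof.
move=> p0 r0 s0 ss t0 tt u0 uu v0 vv h.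
apply: (@le_trans _ _ (p * (s * t))); first by rewrite ler_wpM2l// ler_pM.
by apply: le_trans h _; rewrite ler_wpM2r// ler_pM.
Qed.

(** Contraction at [0 < Z < L_k < X_k], where [Z = Z_(Q (k+1) + 1)]; [th k] sends these points to
    [Y_(k+1)], [Y_(k+2)], 0 and below. Both short intervals have relative length of order [1 / l],
    so [l] cancels. *)
Lemma gap_lower k : 0 < ext k -> ext k <= lr -> 2 * off k <= lr ->
  ext k <= 4 * off k * (expR (gap k.+1) - 1).
Proof.
move=> e0 el ol; have lr0 := lr_gt0; have o0 := off_gt0 k.
have Z0 := Z_gt0 (Q k.+1).+1; have LZ := L_gtZ k; have LX' := ext_gt0_lt e0.
have Y1 := Y_gt0 k.+1; have Y2 := Y_gt0 k.+2; have Y12 := Y_ltS k.+1.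
have M0 := M_gt0 k; have L0 := L_gt0 k; have X0 := X_gt0 k.
have M0' : - Mk k <= 0 by lra.
have := crcontr_drop1 (@th_dec k) (@th_cr k) M0' Z0 LZ LX' (lexx _).
rewrite thL thZ th0E !subr0 => h.
have hX : ext k / lr / 2 * Xk k <= Xk k - Lk k.
  by rewrite -lnXL half_ln_le_sub ?LX// lnXL ler_pdivrMr// mul1r.
have hL : Lk k - Zk (Q k.+1).+1 <= 2 * (off k / lr) * Zk (Q k.+1).+1.
  by rewrite -lnLZ sub_le_2ln ?(ltW LZ)// lnLZ ler_pdivrMr//; lra.
have := mulr_mono4 _ _ _ (lexx _) _ hX _ (lexx _) _ hL h.
move=> /(_ (ltW Y2) _ (ltW Z0) _ (ltW X0) _) H.
have {}H : Yk k.+2 * (Zk (Q k.+1).+1 * (ext k / lr / 2 * Xk k)) <=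
    Xk k * (2 * (off k / lr) * Zk (Q k.+1).+1) * (Yk k.+1 - Yk k.+2).
  apply: H; first by lra.
    by rewrite mulr_ge0 ?divr_ge0// ltW.
  by lra.
rewrite expR_gap.
have c0 : 0 < Zk (Q k.+1).+1 * Xk k / lr / 2 * Yk k.+2.
  by rewrite mulr_gt0// divr_gt0// divr_gt0// mulr_gt0.
rewrite -(ler_pM2l c0); apply: le_trans (le_trans H _); rewrite le_eqVlt; apply/orP; left;
  apply/eqP; field; rewrite ?gt_eqF//.
Qed.

(** Contraction at [- M_k < 0 < Z < L_k]. Only the last interval has relative length of order
    [1 / l], hence the factor [l]: this is the crude bound. *)
Lemma gap_upper k : Lk k <= 2 * Mk k -> off k * (expR (gap k.+1) - 1) <= 3 * lr.
Proof.
move=> LM; have lr0 := lr_gt0; have o0 := off_gt0 k.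
have Z0 := Z_gt0 (Q k.+1).+1; have LZ := L_gtZ k.
have Y1 := Y_gt0 k.+1; have Y2 := Y_gt0 k.+2; have Y12 := Y_ltS k.+1.
have M0 := M_gt0 k; have M0' : - Mk k < 0 by lra.
have := crcontr_drop2 (@th_dec k) (@th_cr k) (lexx _) M0' Z0 LZ (LX k).
rewrite thL thZ th0E subr0 subr0 sub0r opprK => h.
have hL : off k / lr * Zk (Q k.+1).+1 <= Lk k - Zk (Q k.+1).+1.
  by rewrite -lnLZ ln_le_sub// L_gt0.
have {}h : (Yk k.+1 - Yk k.+2) * (Mk k * (off k / lr * Zk (Q k.+1).+1)) <=
   3 * Mk k * Zk (Q k.+1).+1 * Yk k.+2.
  apply: mulr_mono4 h => //; rewrite ?subr_ge0 ?(ltW Y12) ?(ltW Y2) ?(ltW M0) ?(ltW Z0)//; try lra.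
  by rewrite mulr_ge0 ?divr_ge0// ltW.
rewrite expR_gap; have c0 : 0 < Mk k * Zk (Q k.+1).+1 / lr * Yk k.+2.
  by rewrite mulr_gt0// divr_gt0// mulr_gt0.
rewrite -(ler_pM2l c0); apply: le_trans (le_trans h _); rewrite le_eqVlt; apply/orP; left;
  apply/eqP; field; rewrite ?gt_eqF//.
Qed.

Lemma Ll_range k : 0 <= Lk k ^+ l <= Yk (Q k.+1).
Proof.
apply/andP; split; first exact/exprn_ge0/ltW/L_gt0.
by apply: exp_rt_le; [exact/ltW/L_gt0|exact/ltW/Y_gt0|exact/ltW/L_ltZ].
Qed.

Lemma th_opp_L k : th (Q k.+1) (- Lk k.+1) = Lk k ^+ l.
Proof. by rewrite LkS opprK th_gk// Ll_range. Qed.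

Lemma th_Q_gt0 k w : 0 < w -> w < Lk k -> 0 < th k w < Yk k.+1.
Proof.
move=> w0 wL; have M0 := M_gt0 k; have := LX k => LX'; apply/andP; split.
  by rewrite -(thL k); apply: th_dec => //; lra.
by rewrite -th0E; apply: th_dec => //; lra.
Qed.

Section OffLower.
Variables (k j : nat) (kj : Q k.+1 = j.+1) (w : R).
Let q := Q j.+1.
Hypotheses (w_gt0 : 0 < w) (w_lt : w < Lk q).

(** The logarithmic distance of [th q w] from [th q 0]. It is used with [w = L_(k+1)], for which
    [L_k^l = th j (rt (th q w))]. *)
Definition thdrop := ln (Yk q.+1) - ln (th q w).

Lemma thdrop_gt0 : 0 < thdrop.
Proof.
have /andP[t0 tY] := th_Q_gt0 w_gt0 w_lt.
by rewrite subr_gt0 ltr_ln ?posrE// Y_gt0.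
Qed.

Lemma expR_thdrop : expR thdrop = Yk q.+1 / th q w.
Proof.
have /andP[t0 tY] := th_Q_gt0 w_gt0 w_lt.
by rewrite /thdrop expRD expRN !lnK ?posrE// Y_gt0.
Qed.

Lemma thdrop_lower F : 0 < ext q -> ext q <= lr -> (ln (Lk q) - ln w) * lr <= F -> 2 * F <= lr ->
  ext q <= 4 * F * (expR thdrop - 1).
Proof.
move=> e0 el wF Fl; have lr0 := lr_gt0; have wl := w_lt; have wg := w_gt0.
have /andP[t0 tY] := th_Q_gt0 w_gt0 w_lt.
have LX' := ext_gt0_lt e0; have M0 := M_gt0 q; have X0 := X_gt0 q; have L0 := L_gt0 q.
have Y1 := Y_gt0 q.+1; have M0' : - Mk q <= 0 by lra.
have := crcontr_drop1 (@th_dec q) (@th_cr q) M0' w_gt0 w_lt LX' (lexx _).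
rewrite thL th0E !subr0 => h.
have hX : ext q / lr / 2 * Xk q <= Xk q - Lk q.
  by rewrite -lnXL half_ln_le_sub ?LX// lnXL ler_pdivrMr// mul1r.
have F' : ln (Lk q) - ln w <= F / lr by rewrite ler_pdivlMr.
have hL : Lk q - w <= 2 * (F / lr) * w.
  apply: (@le_trans _ _ (2 * (ln (Lk q) - ln w) * w)).
    apply: sub_le_2ln; [by []|exact: ltW|].
    by apply: le_trans F' _; rewrite ler_pdivrMr//; lra.
  by rewrite ler_pM2r// ler_pM2l.
have {}h : th q w * (w * (ext q / lr / 2 * Xk q)) <=
    Xk q * (2 * (F / lr) * w) * (Yk q.+1 - th q w).
  apply: mulr_mono4 h => //; try lra.
  by rewrite mulr_ge0 ?divr_ge0// ltW.
rewrite expR_thdrop; have c0 : 0 < w * Xk q / lr / 2 * th q w.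
  by rewrite mulr_gt0// divr_gt0// divr_gt0// mulr_gt0.
rewrite -(ler_pM2l c0); apply: le_trans (le_trans h _); rewrite le_eqVlt; apply/orP; left;
  apply/eqP; field; rewrite ?gt_eqF//.
Qed.

Lemma th_rt_dom : [/\ 0 < rt (th q w), rt (th q w) < Zk q.+1 & Zk q.+1 < Lk j].
Proof.
have /andP[t0 tY] := th_Q_gt0 w_gt0 w_lt.
by split; [exact: rt_gt0|exact: rt_ltr (ltW t0) tY|exact: L_gtZ].
Qed.

Lemma ln_rt x : 0 < x -> ln (rt x) = ln x / lr.
Proof.
move=> x0; rewrite -{2}(rt_exp m (ltW x0)) lnXn ?rt_gt0//.
by rewrite -[ln _ *+ _]mulr_natr mulfK// gt_eqF// lr_gt0.
Qed.

Lemma lnZ_rt : ln (Zk q.+1) - ln (rt (th q w)) = thdrop / lr.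
Proof.
have /andP[t0 tY] := th_Q_gt0 w_gt0 w_lt.
by rewrite /Zk !ln_rt ?Y_gt0// -mulrBl.
Qed.

(** Contraction at [rt (th q w) < Z_(q+1) < L_j < X_j], which [th j] sends to [L_k^l], [Y_(j+2)], 0
    and below: the first interval is not too short, so neither is its image, and
    [exp (off k) = L_k^l / Y_(j+2)]. *)
Lemma off_lower : w = Lk k.+1 -> thdrop <= lr -> 0 < ext j -> ext j <= lr -> 2 * off j <= lr ->
  thdrop * ext j <= 8 * (expR (off k) - 1) * ((ext j + off j + thdrop) * off j).
Proof.
move=> wE dl e0 el ol; have lr0 := lr_gt0; have d0 := thdrop_gt0.
have wl := w_lt; have wg := w_gt0.
have [s0 sZ ZL] := th_rt_dom; have LX' := ext_gt0_lt e0.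
have o0 := off_gt0 j; have Z0 := Z_gt0 q.+1; have X0 := X_gt0 j; have L0 := L_gt0 j.
have vE : th j (rt (th q w)) = Lk k ^+ l.
  by rewrite -th_opp_L kj thS opprK -wE.
have M0 := M_gt0 j; have M0' : - Mk j <= rt (th q w) by lra.
have := crcontr_drop1 (@th_dec j) (@th_cr j) M0' sZ ZL LX' (lexx _).
rewrite thL thZ vE subr0 => h.
have vY : Yk j.+2 < Lk k ^+ l.
  by rewrite -vE -thZ; apply: th_dec => //; lra.
have Y2 := Y_gt0 j.+2.
have h1 : thdrop / lr / 2 * Zk q.+1 <= Zk q.+1 - rt (th q w).
  rewrite -lnZ_rt; apply: half_ln_le_sub; [by []|exact: ltW|].
  by rewrite lnZ_rt ler_pdivrMr// mul1r.
have h2 : ext j / lr / 2 * Xk j <= Xk j - Lk j.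
  by rewrite -lnXL half_ln_le_sub ?LX// lnXL ler_pdivrMr// mul1r.
have h3 : Xk j - rt (th q w) <= (ext j + off j + thdrop) / lr * Xk j.
  apply: (le_trans (sub_le_ln X0 s0)); rewrite ler_pM2r//.
  rewrite (_ : ln (Xk j) - ln (rt (th q w)) = (ln (Xk j) - ln (Lk j)) +
    (ln (Lk j) - ln (Zk q.+1)) + (ln (Zk q.+1) - ln (rt (th q w)))); last by ring.
  by rewrite lnXL lnLZ lnZ_rt -!mulrDl.
have h4 : Lk j - Zk q.+1 <= 2 * (off j / lr) * Zk q.+1.
  by rewrite -lnLZ sub_le_2ln ?(ltW ZL)// lnLZ ler_pdivrMr//; lra.
have {}h : Yk j.+2 * ((thdrop / lr / 2 * Zk q.+1) * (ext j / lr / 2 * Xk j)) <=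
   ((ext j + off j + thdrop) / lr * Xk j * (2 * (off j / lr) * Zk q.+1)) * (Lk k ^+ l - Yk j.+2).
  apply: mulr_mono4 h => //; try lra.
    by rewrite mulr_ge0 ?divr_ge0// ltW.
  by rewrite mulr_ge0 ?divr_ge0// ltW.
rewrite expR_off kj; have c0 : 0 < Xk j * Zk q.+1 / lr / lr / 4 * Yk j.+2.
  by rewrite mulr_gt0// divr_gt0// divr_gt0// divr_gt0// mulr_gt0.
rewrite -(ler_pM2l c0); apply: le_trans (le_trans h _); rewrite le_eqVlt; apply/orP; left;
  apply/eqP; field; rewrite ?gt_eqF//.
Qed.

End OffLower.

Lemma lnLL i j : ln (Lk i) - ln (Lk j) = (lheight j - lheight i) / lr.
Proof. by rewrite !lnL subNdiv. Qed.

Section GapUpper.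
Variables (k j : nat) (kj : Q k.+1 = j.+1).
Let q := Q j.+1.
Let w0 := Lk k.+1.
Let w1 := Zk (Q k.+2).+1.
Let t0 := th q w0.
Let t1 := th q w1.
Let D := thdrop j w0.
Let G := ln t1 - ln t0.
Let F := lheight k.+1 - lheight q.
Hypotheses (w0L : w0 < Lk q) (e0 : 0 < ext q) (el : ext q <= lr) (Fl : 2 * F <= lr)
  (ol : off k.+1 <= lr) (ojl : off j <= lr) (okl : 2 * off k <= lr) (Dl : 2 * D <= lr).

Let w10 : w1 < w0. Proof. exact: L_gtZ. Qed.
Let w1_gt0 : 0 < w1. Proof. exact: Z_gt0. Qed.
Let w0_gt0 : 0 < w0. Proof. exact: L_gt0. Qed.
Let t0_gt0 : 0 < t0. Proof. by have /andP[] := th_Q_gt0 w0_gt0 w0L. Qed.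
Let t01 : t0 < t1.
Proof.
apply: th_dec => //; last exact: le_trans (ltW w0L) (LX q).
by have := M_gt0 q; have := w1_gt0; lra.
Qed.
Let t1Y : t1 < Yk q.+1.
Proof. by have /andP[] := th_Q_gt0 w1_gt0 (lt_trans w10 w0L). Qed.

Let G_gt0 : 0 < G.
Proof. by rewrite subr_gt0 ltr_ln ?posrE// (lt_trans t0_gt0). Qed.

Let GD : G < D.
Proof.
have t1p : 0 < t1 by apply: lt_trans t01.
by rewrite /G /D /thdrop ltrD2r ltr_ln ?posrE// Y_gt0.
Qed.

(** First of three branches [th q], [th j], [th k] which, with roots in between, carry 0, [w1] and
    [w0] to [Y_(k+2)], [Y_(k+3)] and 0. Contraction at [w1 < w0 < L_q < X_q] bounds the logarithmic
    distance [G] of the first images from below. *)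
Lemma gap_upper_aux : off k.+1 * ext q <= 8 * (expR G - 1) * ((ext q + F + off k.+1) * F).
Proof.
have lr0 := lr_gt0; have LX' := ext_gt0_lt e0; have M0 := M_gt0 q; have X0 := X_gt0 q.
have e0' := e0; have el' := el; have Fl' : 2 * (lheight k.+1 - lheight q) <= lr := Fl; have ol' := ol.
have wL := w0L; have ww := w10; have wp := w1_gt0; have t0p := t0_gt0; have tt := t01.
have L0 := L_gt0 q; have M0' : - Mk q <= w1 by lra. have o0 := off_gt0 k.+1.
have w0p : 0 < w0 by lra. have t1p : 0 < t1 by lra.
have := crcontr_drop1 (@th_dec q) (@th_cr q) M0' ww wL LX' (lexx _).
rewrite thL -/t0 -/t1 subr0 => h.
have hw : off k.+1 / lr / 2 * w0 <= w0 - w1.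
  rewrite -lnLZ; apply: half_ln_le_sub; [by []|exact: ltW|].
  by rewrite lnLZ ler_pdivrMr// mul1r.
have hX : ext q / lr / 2 * Xk q <= Xk q - Lk q.
  by rewrite -lnXL half_ln_le_sub ?LX// lnXL ler_pdivrMr// mul1r.
have hXw : Xk q - w1 <= (ext q + F + off k.+1) / lr * Xk q.
  apply: (le_trans (sub_le_ln X0 wp)); rewrite ler_pM2r//.
  rewrite (_ : ln (Xk q) - ln w1 = (ln (Xk q) - ln (Lk q)) +
    (ln (Lk q) - ln w0) + (ln w0 - ln w1)); last by ring.
  by rewrite lnXL lnLL lnLZ -!mulrDl.
have hL : Lk q - w0 <= 2 * (F / lr) * w0.
  rewrite -lnLL; apply: sub_le_2ln; [by []|exact: ltW|].
  by rewrite lnLL ler_pdivrMr//; lra.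
have {}h : t0 * ((off k.+1 / lr / 2 * w0) * (ext q / lr / 2 * Xk q)) <=
   ((ext q + F + off k.+1) / lr * Xk q * (2 * (F / lr) * w0)) * (t1 - t0).
  apply: mulr_mono4 h => //; try lra.
    by rewrite mulr_ge0 ?divr_ge0// ltW.
  by rewrite mulr_ge0 ?divr_ge0// ltW.
have -> : expR G = t1 / t0 by rewrite /G expRD expRN !lnK ?posrE.
have c0 : 0 < Xk q * w0 / lr / lr / 4 * t0.
  by rewrite mulr_gt0// divr_gt0// divr_gt0// divr_gt0// mulr_gt0.
rewrite -(ler_pM2l c0); apply: le_trans (le_trans h _); rewrite le_eqVlt; apply/orP; left;
  apply/eqP; field; rewrite ?gt_eqF//.
Qed.

Let v0 := Lk k ^+ l.
Let v1 := th j (rt t1).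
Let v2 := Yk j.+2.

Let v0E : th j (rt t0) = v0.
Proof. by rewrite /v0 -th_opp_L kj thS opprK. Qed.

Let s01 : rt t0 < rt t1. Proof. by apply: rt_ltr => //; exact: ltW. Qed.
Let s12 : rt t1 < Zk q.+1.
Proof. by apply: rt_ltr => //; apply/ltW/(lt_trans t0_gt0). Qed.
Let s0_gt0 : 0 < rt t0. Proof. exact: rt_gt0. Qed.

Let v10 : v1 < v0.
Proof.
rewrite -v0E; apply: th_dec => //.
  by have := M_gt0 j; have := s0_gt0; lra.
by apply: le_trans (LX j); apply/ltW/(lt_trans s12)/L_gtZ.
Qed.

Let v21 : v2 < v1.
Proof.
rewrite /v2 -thZ; apply: th_dec => //.
  by have := M_gt0 j; have := s0_gt0; have := s01; lra.
by apply: le_trans (LX j); apply/ltW/L_gtZ.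
Qed.

(** Second branch, at [rt t0 < rt t1 < Z_(q+1) < L_j]: [v1] does not come too close to [v0]. All
    lengths are of relative order [1 / l], which cancels. *)
Let gap_upper_mid : (v1 - v2) * (G * off j) <= (8 * (off j + D) * D) * (v0 - v1).
Proof.
have lr0 := lr_gt0; have M0 := M_gt0 j; have L0 := L_gt0 j; have o0 := off_gt0 j.
have s0p := s0_gt0; have s01' := s01; have s12' := s12; have v21' := v21; have v10' := v10.
have ojl' := ojl; have Dl' := Dl; have GD' := GD; have G0 := G_gt0.
have t0p := t0_gt0; have tt := t01; have t1p : 0 < t1 by lra.
have M0' : - Mk j <= rt t0 by lra.
have := crcontr_drop1 (@th_dec j) (@th_cr j) M0' s01 s12 (L_gtZ j) (LX j).
rewrite thZ v0E -/v1 -/v2 => h.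
have lns : ln (rt t1) - ln (rt t0) = G / lr by rewrite !ln_rt// -mulrBl.
have lns2 : ln (Zk q.+1) - ln (rt t0) = D / lr by apply: lnZ_rt.
have h1 : G / lr / 2 * rt t1 <= rt t1 - rt t0.
  rewrite -lns; apply: half_ln_le_sub; [by []|exact: ltW|].
  by rewrite lns ler_pdivrMr// mul1r; lra.
have h2 : off j / lr / 2 * Lk j <= Lk j - Zk q.+1.
  rewrite -lnLZ; apply: half_ln_le_sub; [exact: Z_gt0|exact/ltW/L_gtZ|].
  by rewrite lnLZ ler_pdivrMr// mul1r.
have h3 : Lk j - rt t0 <= (off j + D) / lr * Lk j.
  apply: (le_trans (sub_le_ln L0 s0p)); rewrite ler_pM2r//.
  rewrite (_ : ln (Lk j) - ln (rt t0) = (ln (Lk j) - ln (Zk q.+1)) +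
    (ln (Zk q.+1) - ln (rt t0))); last by ring.
  by rewrite lnLZ lns2 -!mulrDl.
have h4 : Zk q.+1 - rt t1 <= 2 * (D / lr) * rt t1.
  have E : ln (Zk q.+1) - ln (rt t1) <= D / lr.
    rewrite -lns2 lerB// ler_ln ?posrE//; first exact: ltW.
    exact: lt_trans s01.
  apply: (@le_trans _ _ (2 * (ln (Zk q.+1) - ln (rt t1)) * rt t1)).
    apply: sub_le_2ln; [exact: lt_trans s01|exact: ltW|].
    by apply: le_trans E _; rewrite ler_pdivrMr//; lra.
  by rewrite ler_pM2r ?ler_pM2l//; lra.
have ZL := L_gtZ j.
have {}h : (v1 - v2) * ((G / lr / 2 * rt t1) * (off j / lr / 2 * Lk j)) <=
   ((off j + D) / lr * Lk j * (2 * (D / lr) * rt t1)) * (v0 - v1).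
  apply: mulr_mono4 h => //; rewrite -/q; try lra.
    by rewrite mulr_ge0 ?divr_ge0//; lra.
  by rewrite mulr_ge0 ?divr_ge0//; lra.
have c0 : 0 < Lk j * rt t1 / lr / lr / 4.
  by rewrite divr_gt0// divr_gt0// divr_gt0// mulr_gt0//; lra.
rewrite -(ler_pM2l c0); apply: le_trans (le_trans h _); rewrite le_eqVlt; apply/orP; left;
  apply/eqP; field; rewrite ?gt_eqF//.
Qed.

(** Third branch, at [0 < rt v2 < rt v1 < L_k]. The middle interval is now as short as the last one,
    of relative order [1 / l]; this removes the factor [l] of [gap_upper]. *)
Let gap_upper_last : (Yk k.+2 - Yk k.+3) * (v0 - v1) <= 2 * off k * v0 * Yk k.+3.
Proof.
have lr0 := lr_gt0; have L0 := L_gt0 k; have o0 := off_gt0 k; have okl' := okl.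
have v21' := v21; have v10' := v10; have v2p : 0 < v2 by apply: Y_gt0.
have Y3 := Y_gt0 k.+3; have Y23 := Y_ltS k.+2.
have M0 := M_gt0 k; have M0' : - Mk k <= 0 by lra.
have u0E : rt v0 = Lk k by rewrite /v0 exp_rt// ltW.
have u2E : rt v2 = Zk (Q k.+1).+1 by rewrite kj.
have u21 : rt v2 < rt v1 by apply: rt_ltr; lra.
have u10 : rt v1 < Lk k by rewrite -u0E; apply: rt_ltr; lra.
have u2p : 0 < rt v2 by apply: rt_gt0.
have := crcontr_drop2 (@th_dec k) (@th_cr k) M0' u2p u21 u10 (LX k).
have E1 : th k (rt v1) = Yk k.+3 by rewrite -thZ thS kj thS opprK.
have E2 : th k (rt v2) = Yk k.+2 by rewrite u2E thZ.
rewrite E1 E2 thL !subr0 => h.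
have lnu : ln (Lk k) - ln (rt v2) = off k / lr by rewrite u2E lnLZ.
have u1p : 0 < rt v1 by lra.
have v1p : 0 < v1 by lra. have v0p : 0 < v0 by lra.
have h1 : (v0 - v1) / v0 / lr * rt v1 <= Lk k - rt v1.
  apply: (le_trans _ (ln_le_sub L0 u1p)); rewrite ler_pM2r//.
  rewrite -u0E !ln_rt// -mulrBl ler_pM2r ?invr_gt0//.
  by rewrite ler_pdivrMr// sub_le_ln.
have h2 : rt v1 - rt v2 <= off k / lr * rt v1.
  apply: (le_trans (sub_le_ln u1p u2p)); rewrite ler_pM2r// -lnu lerD2r.
  by rewrite ler_ln ?posrE// ltW.
have h3 : Lk k <= 2 * rt v2.
  have := sub_le_2ln u2p (ltW (lt_trans u21 u10)); rewrite lnu => H.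
  have : off k / lr <= 1 / 2 by rewrite ler_pdivrMr//; lra.
  move=> H2; have := H H2; have : 2 * (off k / lr) * rt v2 <= 1 * rt v2.
    by rewrite ler_pM2r//; lra.
  lra.
have {}h : (Yk k.+2 - Yk k.+3) * (rt v2 * ((v0 - v1) / v0 / lr * rt v1)) <=
    ((2 * rt v2) * (off k / lr * rt v1)) * Yk k.+3.
  apply: mulr_mono4 h => //; try lra.
  by rewrite mulr_ge0 ?divr_ge0//; lra.
have c0 : 0 < rt v2 * rt v1 / lr / v0.
  by rewrite divr_gt0// divr_gt0// mulr_gt0.
rewrite -(ler_pM2l c0); apply: le_trans (le_trans h _); rewrite le_eqVlt; apply/orP; left;
  apply/eqP; field; rewrite ?gt_eqF//.
Qed.

Lemma gap_upper2 : (expR (gap k.+2) - 1) * (G * off j) <=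
  2 * (1 + off k) * (G * off j + 8 * (off j + D) * D).
Proof.
have v21' := v21; have v10' := v10; have v2p : 0 < v2 by apply: Y_gt0.
have Y3 := Y_gt0 k.+3; have Y23 := Y_ltS k.+2; have o0 := off_gt0 k.
have GD' := GD; have G0 := G_gt0; have oj0 := off_gt0 j.
have v0p : 0 < v0 by lra.
have := gap_upper_mid; have := gap_upper_last.
set P := 8 * (off j + D) * D; set S := G * off j.
have S0 : 0 < S by apply: mulr_gt0.
have P0 : 0 < P by rewrite mulr_gt0 ?mulr_gt0//; lra.
rewrite expR_gap; set r := Yk k.+2 / Yk k.+3.
have rE : Yk k.+2 = r * Yk k.+3 by rewrite /r divfK// gt_eqF.
have r1 : 1 < r by rewrite /r ltr_pdivlMr// mul1r.
rewrite rE => hl hm.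
have {}hl : (r - 1) * (v0 - v1) <= 2 * off k * v0.
  by rewrite -(ler_pM2r Y3) (le_trans _ hl)// le_eqVlt; apply/orP; left; apply/eqP; ring.
have hv : off k * v0 <= (1 + off k) * (v0 - v2).
  have : v2 * (1 + off k) <= v0.
    rewrite (_ : v0 = v2 * expR (off k)); first by rewrite ler_pM2l// expR_ge1Dx.
    by rewrite expR_off kj -/v0 mulrCA divff ?mulr1// gt_eqF.
  lra.
have hs : (v0 - v2) * S <= (v0 - v1) * (S + P) by lra.
have c0 : 0 < off k * v0 by apply: mulr_gt0.
rewrite -(ler_pM2r c0).
apply: (@le_trans _ _ ((r - 1) * S * ((1 + off k) * (v0 - v2)))).
  by rewrite ler_pM2l// mulr_gt0//; lra.
apply: (@le_trans _ _ ((r - 1) * (1 + off k) * ((v0 - v1) * (S + P)))).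
  rewrite (_ : _ * S * _ = (r - 1) * (1 + off k) * ((v0 - v2) * S)); last by ring.
  by rewrite ler_pM2l// mulr_gt0//; lra.
rewrite (_ : _ * _ * _ = (r - 1) * (v0 - v1) * ((1 + off k) * (S + P))); last by ring.
apply: (@le_trans _ _ ((2 * off k * v0) * ((1 + off k) * (S + P)))).
  by rewrite ler_pM2r// mulr_gt0//; lra.
by rewrite le_eqVlt; apply/orP; left; apply/eqP; ring.
Qed.

End GapUpper.

End Heights.

End Height.
Import Height.

(** * Bounds for [ext] and [off] in terms of an upper bound for [gap] *)

Section Bootstrap.
Context {R : realType} (m : nat) (a : R).
Implicit Types (w x y A : R) (i j k K : nat).

Local Notation l := (2 ^ m)%N.
Local Notation lr := ((2 ^ m)%:R : R).
Local Notation Q := kneadQ.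
Local Notation Lk := (Lk m a).
Local Notation Zk := (Zk m a).
Local Notation Yk := (Yk m a).
Local Notation Mk := (Mk m a).
Local Notation Xk := (Xk m a).
Local Notation gap := (gap m a).
Local Notation off := (off m a).
Local Notation ext := (ext m a).
Local Notation height := (height m a).
Local Notation lheight := (lheight m a).
Local Notation xheight := (xheight m a).

Hypotheses (a_gt0 : 0 < a) (a_le1 : a <= 1) (admK : forall K, adm m a K).
Arguments admK : clear implicits.

Let hm := height_mono a_gt0 a_le1 admK.
Let lgt := lheight_gt a_gt0 a_le1 admK.
Let o0 := off_gt0 a_gt0 a_le1 admK.
Let olt := off_lt a_gt0 a_le1 admK.
Let g0 := gap_gt0 a_gt0 a_le1 admK.

Definition gapsle A k := forall i, (k <= i + 14)%N -> (i <= Q k.+1)%N -> gap i <= A.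

Lemma lheight_lt k : lheight k < height (Q k.+1).+1.
Proof. by rewrite -subr_gt0; exact: o0. Qed.

Lemma xheight_small k : (k <= 2)%N -> xheight k = - ln 2.
Proof.
move=> k2; rewrite /xheight /Branch.Xk k2; congr (- _).
have two : 0 < (2 : R) by [].
by rewrite ln_rt// mulrC divfK// gt_eqF// lr_gt0.
Qed.

Lemma xheight_big k : (4 < k)%N -> xheight k = lheight (Q (Q k)).
Proof.
move=> k4; rewrite /xheight /Branch.Xk ifF; last by apply/negbTE; rewrite -ltnNge (ltn_trans _ k4).
by rewrite ifF//; apply/negbTE; rewrite gtn_eqF.
Qed.

Lemma ln2_le1 : ln 2 <= 1 :> R.
Proof. by apply: (le_trans (le_ln1Dx _)) => //; lra. Qed.

Lemma ln_ge_half (x : R) : 0 <= x -> x <= 1 -> x / 2 <= ln (1 + x).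
Proof.
move=> x0 x1; rewrite -[X in X <= _]expRK ler_ln ?posrE ?expR_gt0//; last by lra.
by apply: (le_trans (expR_le_1D2x _ _)); lra.
Qed.

(** For [k > 4], [L_k] and [X_k = L_(Q (Q k))] are at most sixteen levels apart; for small [k] there
    are at most five gaps above 1, and [X_k] contributes at most [ln 2 <= 1]. *)
Lemma ext_upper A k : 1 <= A -> gapsle A k -> ext k <= 16 * A.
Proof.
move=> A1 gA; rewrite /Height.ext.
have hk := lheight_lt k.
have sub i j : (i <= j)%N -> (j <= (Q k.+1).+1)%N -> (k <= i + 14)%N -> height j - height i <= (j - i)%:R * A.
  move=> ij jk ki; apply: height_sub => // n /andP[n1 n2]; apply: gA; lia.
have [k4|k4] := leqP k 4; last first.
  rewrite xheight_big//; have h1 := lgt (Q (Q k)).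
  have := sub (Q (Q (Q k)).+1) (Q k.+1).+1.
  have := kneadQQQ_ge k; have := kneadQQQ_ge' k; have := kneadQ_leS k.
  have := kneadQQQ_lt k4.
  move: (Q (Q (Q k)).+1) (Q k.+1) h1 hk => i j h1 hk n0 n1 n2 n3 n4.
  have {}n4 : height j.+1 - height i <= (j.+1 - i)%:R * A by apply: n4; lia.
  have : (j.+1 - i)%:R <= (16 : R) by rewrite ler_nat; lia.
  move=> c; have c' : (j.+1 - i)%:R * A <= 16 * A by rewrite ler_pM2r//; lra.
  lra.
have hx : - 1 <= xheight k.
  have [k2|k2] := leqP k 2; first by rewrite xheight_small//; have := ln2_le1; lra.
  rewrite /xheight /Branch.Xk leqNgt k2 /=; case: ifPn => k4'.
    have h1 := lgt 1; rewrite kneadQ_small height0 in h1.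
    by rewrite -/(lheight 1); lra.
  have -> : k = 3%N by move: k2 k4 k4'; case: (k) => [|[|[|[|[|]]]]].
  rewrite !kneadQ_small; have h1 := lgt 0; rewrite kneadQ_small height0 in h1.
  by rewrite -/(lheight 0); lra.
have jk := kneadQ_leS k; have k25 : (k <= 0 + 14)%N by rewrite (leq_trans k4).
have := sub 0%N (Q k.+1).+1 isT (leqnn _) k25.
rewrite height0 !subr0 subn0 => h.
have : (Q k.+1).+1%:R <= (5 : R) by rewrite ler_nat ltnS (leq_trans jk).
move=> c; have c' : (Q k.+1).+1%:R * A <= 5 * A by rewrite ler_pM2r//; lra.
lra.
Qed.

Lemma off_upper A k : gapsle A k -> off k <= A.
Proof.
move=> gA; apply: (le_trans (ltW (olt k))); apply: gA => //.
by have := kneadQ_ge k.+1; lia.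
Qed.

(** With [s = Q (Q k)], [kneadQQ_lt] gives [ext k >= gap (s+1) + off s], while [gap_lower] gives
    [ext s <= 8 off s gap (s+1)] when the gap is small. So [ext k] is at least the square root of
    [ext s / 2], which is at least [2 ext s] as long as [ext s <= 1 / 8]. *)
Lemma ext_step A k : 1 <= A -> 16 * A <= lr -> (4 < k)%N ->
  gapsle A (Q (Q k)) -> 0 < ext (Q (Q k)) ->
  1 / 4 <= ext k \/ 2 * ext (Q (Q k)) <= ext k.
Proof.
move=> A1 Al k4 gA e0; set s := Q (Q k).
have es := ext_upper A1 gA; have os := off_upper gA; have os0 := o0 s.
have J := gap_lower a_gt0 a_le1 admK e0.
have {}J : ext s <= 4 * off s * (expR (gap s.+1) - 1) by apply: J; rewrite -/s; lra.
have ek : gap s.+1 + off s <= ext k.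
  rewrite /Height.ext xheight_big// -/s /Height.gap /Height.off.
  have h1 := lgt k; have h2 := @hm s.+2 (Q k.+1); have h3 := @hm (Q s.+1).+1 s.+1.
  have n1 : (s.+2 <= Q k.+1)%N by rewrite -addn2; exact: kneadQQ_lt.
  have := h2 n1; have := h3 (kneadQ_leS s); lra.
have gs := g0 s.+1.
have [g4|g4] := leP (1 / 4) (gap s.+1); first by left; lra.
have ex := expR_le_1D2x (ltW gs) _.
have {}ex : expR (gap s.+1) <= 1 + 2 * gap s.+1 by apply: ex; lra.
have e8 : ext s <= 8 * off s * gap s.+1.
  apply: (le_trans J); rewrite (_ : 8 * off s * gap s.+1 = 4 * off s * (2 * gap s.+1)); last by ring.
  by rewrite ler_pM2l; lra.
have sq : ext s <= 2 * (gap s.+1 + off s) ^+ 2.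
  have := sqr_ge0 (gap s.+1 - off s); rewrite !expr2 => sq; apply: (le_trans e8); nra.
have [E|E] := leP (ext s) (1 / 8); [right|left].
  suff H : 2 * ext s <= gap s.+1 + off s by exact: le_trans H ek.
  rewrite leNgt; apply/negP => H; have : (gap s.+1 + off s) ^+ 2 < (2 * ext s) ^+ 2.
    by rewrite ltr_pXn2r ?nnegrE//; lra.
  by rewrite [X in _ < X]expr2 => H2; have : 0 < ext s by []; nra.
rewrite leNgt; apply/negP => H; have : (gap s.+1 + off s) ^+ 2 < (1 / 4) ^+ 2.
  by rewrite ltr_pXn2r ?nnegrE//; lra.
by rewrite [X in _ < X]expr2 => H2; lra.
Qed.

Lemma lheight_lt_LL i k : lheight i < lheight k -> Lk k < Lk i.
Proof.
move=> h; rewrite -ltr_ln ?posrE ?(L_gt0 a_gt0 a_le1 admK)// -subr_gt0 lnLL//.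
by rewrite divr_gt0 ?subr_gt0 ?lr_gt0.
Qed.

Lemma lheight_QQ k : (4 < k)%N -> lheight (Q (Q k)) < lheight k.
Proof.
move=> k4; apply: (lt_trans (lheight_lt _)); apply: (le_lt_trans _ (lgt k)).
by apply: hm; have := kneadQQQ_lt k4; lia.
Qed.

Lemma ext_big k : (4 < k)%N -> ext k = lheight k - lheight (Q (Q k)).
Proof. by move=> k4; rewrite /Height.ext xheight_big. Qed.

Lemma off_ge_alg (A e D E oo O X : R) : 1 <= A -> 0 < e -> e <= 1 -> 0 < D -> D <= A ->
  e / (128 * A) <= D -> D * E <= 8 * (X - 1) * ((E + oo + D) * oo) -> 0 < oo -> oo <= A ->
  e <= E -> 0 < O -> X <= 1 + 2 * O -> e ^+ 2 / (24 * 16 * 16 * A ^+ 3) <= O.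
Proof.
move=> A1 e0 e1 D0 DA Dlow OL oj oj0 ej1 ok0 xo.
have A0 : 0 < A by lra. have E0 : 0 < E by lra. have E2 : 0 < E + 2 * A by lra.
have A3 : 0 < 24 * 16 * 16 * A ^+ 3 by apply: mulr_gt0; [lra|exact: exprn_gt0].
have h1 : e / (128 * A) * E <= 16 * O * ((E + 2 * A) * A).
  apply: (@le_trans _ _ (D * E)); first by rewrite ler_pM2r.
  apply: (le_trans OL); apply: (@le_trans _ _ (16 * O * ((E + oo + D) * oo))).
    by rewrite ler_wpM2r; [lra|rewrite mulr_ge0//; lra|lra].
  by rewrite ler_pM2l; [apply: ler_pM; lra|lra].
have h2 : e * (E + 2 * A) <= 3 * A * E.
  have t1 : e * E <= A * E by rewrite ler_pM2r//; lra.
  have t2 : e * A <= E * A by rewrite ler_pM2r.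
  lra.
have h3 : e * E <= 8 * 16 * 16 * O * A ^+ 2 * (E + 2 * A).
  have A128 : 0 < 128 * A by lra.
  move: h1; rewrite -(ler_pM2l A128) => h1; apply: (le_trans (le_trans _ h1)).
    by rewrite le_eqVlt; apply/orP; left; apply/eqP; field; rewrite gt_eqF.
  by rewrite le_eqVlt; apply/orP; left; apply/eqP; ring.
rewrite ler_pdivrMr// -(ler_pM2r (mulr_gt0 E0 E2)).
apply: (@le_trans _ _ ((e * E) * (e * (E + 2 * A)))).
  by rewrite le_eqVlt; apply/orP; left; apply/eqP; ring.
apply: (@le_trans _ _ ((8 * 16 * 16 * O * A ^+ 2 * (E + 2 * A)) * (3 * A * E))).
  by apply: ler_pM => //; rewrite mulr_ge0//; lra.
by rewrite le_eqVlt; apply/orP; left; apply/eqP; ring.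
Qed.

(** [L_(k+1)] lies below [Z_(Q (q+1) + 1)], which [th q] sends to [Y_(q+2)], where [q = Q (j+1)]. *)
Lemma thdrop_le A k j : Q k.+1 = j.+1 -> ((Q (Q j.+1).+1).+1 <= Q k.+2)%N ->
  gap (Q j.+1).+1 <= A -> thdrop m a j (Lk k.+1) <= A.
Proof.
move=> kj hq; apply: le_trans; have w0 := L_gt0 a_gt0 a_le1 admK k.+1.
rewrite /thdrop /Height.gap /Height.height opprK addrC lerD2r lerN2.
have Y2 := Y_gt0 a_gt0 a_le1 admK (Q j.+1).+2.
have wZ : Lk k.+1 < Zk (Q (Q j.+1).+1).+1.
  apply: (lt_le_trans (L_ltZ a_gt0 a_le1 admK k.+1)).
  exact: (Z_noninc a_gt0 a_le1 admK).
have h : Yk (Q j.+1).+2 < Branch.th m a (Q j.+1) (Lk k.+1).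
  rewrite -(thZ m a (Q j.+1)); apply: (th_dec a_gt0 a_le1 admK) => //.
    by have := M_gt0 a_gt0 a_le1 admK (Q j.+1); lra.
  by apply: le_trans (LX a_gt0 a_le1 admK _); apply/ltW/(L_gtZ a_gt0 a_le1 admK).
by rewrite ler_ln ?posrE// ?ltW// (lt_trans Y2).
Qed.

(** [ext q] bounds [thdrop] from below, and [thdrop] with [ext j] bounds [off k]: hence the square
    of [e]. The powers of [A] come from the upper bounds of the remaining lengths. *)
Lemma off_ge A e k : 1 <= A -> 32 * A <= lr -> 0 < e -> e <= 1 -> (3 < k)%N ->
  (forall i, (k <= i + 25)%N -> (i <= k)%N -> gap i <= A) ->
  (forall i, (k <= i + 9)%N -> (i <= k)%N -> e <= ext i) ->
  e ^+ 2 / (24 * 16 * 16 * A ^+ 3) <= off k.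
Proof.
move=> + + + + k3; have k4 : (4 < k.+1)%N by [].
have [j kj [[jk kj9 hq1 hq2 hq3] [hq4 hq5 ww wj wk]]] := kneadQ_pack k3.
move=> A1 Al e0 e1 gA eA.
have qq : lheight (Q j.+1) < lheight k.+1 by rewrite -kj; exact: lheight_QQ.
have wL := lheight_lt_LL qq; have w0 := L_gt0 a_gt0 a_le1 admK k.+1.
have gq : gapsle A (Q j.+1) by move=> i i1 i2; have [] := ww i i1 i2 => ? ?; apply: gA.
have gj : gapsle A j by move=> i i1 i2; have [] := wj i i1 i2 => ? ?; apply: gA.
have gk : gapsle A k.+1 by move=> i i1 i2; have [] := wk i i1 i2 => ? ?; apply: gA.
have eq1 : e <= ext (Q j.+1) by apply: eA.
have ej1 : e <= ext j by apply: eA.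
have eq2 := ext_upper A1 gq; have ej2 := ext_upper A1 gj; have ek2 := ext_upper A1 gk.
rewrite ext_big// kj in ek2.
have oj := off_upper gj; have oj0 := o0 j.
have lr0 : 0 < lr by apply: lr_gt0.
have D0 := thdrop_gt0 a_gt0 a_le1 admK w0 wL.
have DA : thdrop m a j (Lk k.+1) <= A by apply: thdrop_le => //; apply: gA.
have TL : ext (Q j.+1) <= 4 * (16 * A) * (expR (thdrop m a j (Lk k.+1)) - 1).
  apply: (thdrop_lower a_gt0 a_le1 admK w0 wL); [by lra|by lra| |by lra].
  by rewrite lnLL// divfK ?gt_eqF.
have Dlow : e / (128 * A) <= thdrop m a j (Lk k.+1).
  have A64 : 0 < 64 * A by lra.
  have h : 1 + e / (64 * A) <= expR (thdrop m a j (Lk k.+1)).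
    rewrite -lerBrDl ler_pdivrMr//; lra.
  have x0 : 0 <= e / (64 * A) by rewrite divr_ge0//; lra.
  have x1 : e / (64 * A) <= 1 by rewrite ler_pdivrMr//; lra.
  have h1 := ln_ge_half x0 x1.
  have h2 : ln (1 + e / (64 * A)) <= thdrop m a j (Lk k.+1).
    by rewrite -[X in _ <= X]expRK ler_ln ?posrE ?expR_gt0//; lra.
  apply: (le_trans _ (le_trans h1 h2)); rewrite le_eqVlt; apply/orP; left; apply/eqP.
  by field; rewrite gt_eqF//; lra.
have OL := off_lower a_gt0 a_le1 admK kj w0 wL erefl.
have {}OL : thdrop m a j (Lk k.+1) * ext j <=
    8 * (expR (off k) - 1) * ((ext j + off j + thdrop m a j (Lk k.+1)) * off j).
  by apply: OL; lra.
have A3 : 0 < 24 * 16 * 16 * A ^+ 3 by apply: mulr_gt0; [lra|apply: exprn_gt0; lra].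
have [h2|h2] := leP (1 / 2) (off k).
  apply: le_trans h2; rewrite ler_pdivrMr//.
  have : 1 <= A ^+ 3 by rewrite exprn_ege1.
  have : e ^+ 2 <= 1 by rewrite expr_le1// ltW.
  lra.
have ok0 := o0 k; have xo := expR_le_1D2x (ltW ok0) (ltW h2).
by apply: (off_ge_alg A1 e0 e1 D0 DA Dlow OL oj0 oj ej1 ok0 xo).
Qed.

End Bootstrap.

Lemma off2_ge_alg {R : realType} (D E o O X : R) : 1 / 2 <= D -> 1 / 2 <= E ->
  o <= 2 -> D * E <= 8 * (X - 1) * ((E + o + D) * o) -> 0 < O -> X <= 1 + 2 * O ->
  0 < o -> 1 / (24 * 16) <= O.
Proof.
move=> D2 E2 o2 OL O0 xo o00.
have h1 : D * E <= 16 * O * ((E + 2 + D) * 2).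
  apply: (le_trans OL); apply: (@le_trans _ _ (16 * O * ((E + o + D) * o))).
    by rewrite ler_wpM2r; [by []|rewrite mulr_ge0//; lra|lra].
  by rewrite ler_pM2l; [apply: ler_pM; lra|lra].
have h2 : (E + 2 + D) / 12 <= D * E by nra.
have EP : 0 < E + 2 + D by lra.
rewrite -(ler_pM2r EP); lra.
Qed.

(** * Initial levels and crude bounds up to a given level *)

Section Crude.
Context {R : realType} (m : nat) (a : R).
Implicit Types (w x y A : R) (i j k K : nat).

Local Notation l := (2 ^ m)%N.
Local Notation lr := ((2 ^ m)%:R : R).
Local Notation Q := kneadQ.
Local Notation Lk := (Lk m a).
Local Notation Zk := (Zk m a).
Local Notation Yk := (Yk m a).
Local Notation Mk := (Mk m a).
Local Notation Xk := (Xk m a).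
Local Notation gap := (gap m a).
Local Notation off := (off m a).
Local Notation ext := (ext m a).
Local Notation height := (height m a).
Local Notation lheight := (lheight m a).
Local Notation xheight := (xheight m a).

Hypotheses (a_gt0 : 0 < a) (a_le1 : a <= 1) (admK : forall K, adm m a K).
Arguments admK : clear implicits.

Let hm := height_mono a_gt0 a_le1 admK.
Let lgt := lheight_gt a_gt0 a_le1 admK.
Let o0 := off_gt0 a_gt0 a_le1 admK.
Let olt := off_lt a_gt0 a_le1 admK.
Let g0 := gap_gt0 a_gt0 a_le1 admK.

(** [tiny] is the lower bound for the worst initial value, [ext 3]; [floor] is what [off_ge] makes
    of it. *)
Notation tiny := ((16 * 16 * lr)^-1).
Notation floor A := (tiny ^+ 2 / (24 * 16 * 16 * A ^+ 3)).

Lemma Z_ge_half i : height i <= lr / 2 -> 1 / 2 <= Zk i.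
Proof.
move=> hi; have Z0 := Z_gt0 a_gt0 a_le1 admK i.
have := sub_le_ln ltr01 Z0; rewrite ln1 sub0r mulr1 lnZ// mulNr opprK => h.
have lr0 : 0 < lr by apply: lr_gt0.
suff : height i / lr <= 1 / 2 by lra.
by rewrite ler_pdivrMr//; lra.
Qed.

(** Here [th 0] is explicit and [exp (off k) = 1 + L_(k+1) / a >= 3 / 2]. *)
Lemma off_base k : Q k.+1 = 0%N -> 1 / 2 <= Lk k.+1 -> 1 / 4 <= off k.
Proof.
move=> Qk L2; rewrite leNgt; apply/negP => o4; have ok := o0 k.
have : expR (off k) <= 1 + 2 * off k by apply: expR_le_1D2x; lra.
have a0 := a_gt0; have a1 := a_le1; have a1p : 1 + a != 0 by rewrite gt_eqF//; lra.
rewrite expR_off// -th_opp_L// Qk th0 -(th0E m a 0) th0 subr0 opprK.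
have -> : (a + Lk k.+1) / (1 + a) / (a / (1 + a)) = 1 + Lk k.+1 / a.
  by field; rewrite a1p/= gt_eqF.
suff : 1 / 2 <= Lk k.+1 / a by lra.
by rewrite ler_pdivlMr//; lra.
Qed.

(** If [M_k <= L_k] and [k > 0], five gaps separate them at most, which is no more than [l / 2] in
    the logarithmic scale. *)
Lemma L_le_2M A k : 0 <= A -> 10 * A <= lr ->
  (forall i, (k <= i + 14)%N -> (i <= k)%N -> gap i <= A) -> Lk k <= 2 * Mk k.
Proof.
move=> A0 Al gA; have [ML|LM] := leP (Mk k) (Lk k); last first.
  by have := M_gt0 a_gt0 a_le1 admK k; lra.
case: k gA ML => [|k] gA ML; first by rewrite Lk0 /=; have := a_le1; lra.
have M0 := M_gt0 a_gt0 a_le1 admK k.+1; have lr0 : 0 < lr by apply: lr_gt0.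
have n1 := kneadQ_leS (Q k.+1); have n2 := kneadQ_leS k; have n3 := kneadQ_ge k.+2.
have n4 := kneadQSS_le k.
have h : lheight (Q k.+1) - lheight k.+1 <= 5 * A.
  have h1 := lheight_lt a_gt0 a_le1 admK (Q k.+1); have h2 := lgt k.+1.
  have h3 : height (Q (Q k.+1).+1).+1 <= height k.+1 by apply: hm; lia.
  have h4 : height k.+1 - height (Q k.+2) <= (k.+1 - Q k.+2)%:R * A.
    by apply: height_sub; [lia|move=> i /andP[i1 i2]; apply: gA; lia].
  have h5 : (k.+1 - Q k.+2)%:R * A <= 5 * A by rewrite ler_wpM2r// ler_nat; lia.
  lra.
have := sub_le_2ln M0 ML; rewrite /Branch.Mk lnLL => H.
have h6 : (lheight (Q k.+1) - lheight k.+1) / lr <= 1 / 2 by rewrite ler_pdivrMr//; lra.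
have := H h6; set t := _ / lr; rewrite -/t in h6 => H'.
have M0' : 0 < Lk (Q k.+1) := M0.
have : 2 * t * Lk (Q k.+1) <= 1 * Lk (Q k.+1) by rewrite ler_pM2r//; lra.
change (Mk k.+1) with (Lk (Q k.+1)); lra.
Qed.

Lemma gap_next A b k : 0 < A -> 10 * A <= lr ->
  (forall i, (k <= i + 14)%N -> (i <= k)%N -> gap i <= A) ->
  0 < b -> b <= off k -> 1 + 3 * lr / b <= expR A -> gap k.+1 <= A.
Proof.
move=> A0 Al gA b0 bk eA; rewrite -[leLHS]expRK -[leRHS]expRK ler_ln ?posrE ?expR_gt0//.
apply: le_trans eA.
have h := gap_upper a_gt0 a_le1 admK (L_le_2M (ltW A0) Al gA).
rewrite -lerBlDl ler_pdivlMr// mulrC; apply: le_trans h.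
have := expR_ge1Dx (gap k.+1); have := g0 k.+1 => h1 h2.
by rewrite ler_wpM2r//; lra.
Qed.

Hypothesis a_ge : 1 / 2 <= a.

Lemma gap0_le2 : gap 0 <= 2.
Proof.
rewrite -[leLHS]expRK -[leRHS]expRK ler_ln ?posrE ?expR_gt0//.
apply: (@le_trans _ _ 3); last by have := expR_ge1Dx (2 : R); lra.
have a0 := a_gt0; have a2 := a_ge; have a1p : 1 + a != 0 by rewrite gt_eqF//; lra.
rewrite expR_gap// -(th0E m a 0) th0 subr0 [Branch.Yk _ _ _]/=.
have -> : 1 / (a / (1 + a)) = (1 + a) / a by field; rewrite a1p/= gt_eqF.
by rewrite ler_pdivrMr//; lra.
Qed.

Lemma ext_small k : (k <= 2)%N -> 1 / 2 <= ext k.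
Proof.
move=> k2; rewrite /Height.ext xheight_small// opprK.
have h1 := lgt k; have := hm (leq0n (Q k.+1)); rewrite height0 => h2.
have : 1 / 2 <= ln (1 + 1 : R) by apply: ln_ge_half; lra.
have -> : (1 + 1 : R) = 2 by ring.
lra.
Qed.

Section Inductive.
Variables (A : R) (n : nat).
Hypotheses (A2 : 2 <= A) (Al : 64 * A <= lr) (gA : forall i, (i <= n)%N -> gap i <= A).

Let lr0 : 0 < lr. Proof. exact: lr_gt0. Qed.

Lemma heightA i : (i <= n.+1)%N -> height i <= i%:R * A.
Proof.
move=> i_n; have := @height_sub R m a 0 i A (leq0n i); rewrite height0 !subr0 subn0; apply.
by move=> j /andP[_ ji]; apply: gA; rewrite -ltnS (leq_trans ji).
Qed.

Lemma Z_ge_half3 i : (i <= 3)%N -> (i <= n.+1)%N -> 1 / 2 <= Zk i.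
Proof.
move=> i3 i_n; apply: Z_ge_half; apply: (le_trans (heightA i_n)).
have A2' := A2; have Al' := Al.
by apply: (@le_trans _ _ (3 * A)); [rewrite ler_wpM2r ?ler_nat//; lra|lra].
Qed.

Lemma gap1_ge : 1 / 32 <= gap 1.
Proof.
have A2' := A2; have Al' := Al; have e0 := ext_small (isT : (0 <= 2)%N).
rewrite leNgt; apply/negP => g1; have g10 := g0 1.
have e00 : 0 < ext 0 by lra.
have gs : gapsle m a A 0 by move=> i _; rewrite kneadQ_small leqn0 => /eqP->; apply: gA.
have A1 : 1 <= A by lra.
have eu := ext_upper a_gt0 a_le1 admK A1 gs.
have ou : off 0 <= 2.
  by apply: (le_trans (ltW (olt 0))); rewrite kneadQ_small; exact: gap0_le2.
have := gap_lower a_gt0 a_le1 admK e00.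
have ex : expR (gap 1) <= 1 + 2 * gap 1 by apply: expR_le_1D2x; lra.
move=> H; have {}H : ext 0 <= 4 * off 0 * (expR (gap 1) - 1) by apply: H; lra.
have o00 := o0 0.
have : 4 * off 0 * (expR (gap 1) - 1) <= 4 * off 0 * (2 * gap 1) by rewrite ler_pM2l; lra.
have : 4 * off 0 * (2 * gap 1) <= 8 * (2 * gap 1) by rewrite ler_pM2r; lra.
lra.
Qed.

Lemma ext4_ge : 1 / 32 <= ext 4.
Proof.
have g1 := gap1_ge; rewrite /Height.ext.
have -> : xheight 4 = lheight 1 by [].
have h1 := lgt 4; have h2 := lheight_lt a_gt0 a_le1 admK 1.
rewrite kneadQ_small in h1; rewrite kneadQ_small in h2.
by move: g1; rewrite /Height.gap; lra.
Qed.

(** [X_3 = L_0] is separated from [L_3] only by the special value [ubk 3]. Quantitatively, [(1 + a)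
    (L_0^l - L_3^l) = L_1 - L_4 > Z_1 - Z_2], and the last difference is of order [1 / l]. *)
Lemma ext3_ge : (0 < n)%N -> tiny <= ext 3.
Proof.
move=> n0; have g1 := gap1_ge; have g1A := gA n0; have Al' := Al; have A2' := A2.
have l0 := lr0; have a0 := a_gt0; have a1 := a_le1.
have xE : ext 3 = lr * ln (Lk 0) - lr * ln (Lk 3).
  by rewrite /Height.ext /Height.lheight /Height.xheight opprK addrC /Branch.Xk /= !kneadQ_small.
have L0 := L_gt0 a_gt0 a_le1 admK 0; have L3 := L_gt0 a_gt0 a_le1 admK 3.
have E3 : Lk 0 ^+ l - Lk 3 ^+ l <= ext 3.
  have := sub_le_ln (exprn_gt0 l L0) (exprn_gt0 l L3).
  rewrite !lnXn// -![ln _ *+ _]mulr_natl -xE => h; apply: (le_trans h).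
  have L01 : Lk 0 ^+ l <= 1 by rewrite Lk0 exprn_ile1// ltW.
  have e0 : 0 < ext 3.
    by rewrite xE subr_gt0 ltr_pM2l// ltr_ln ?posrE//; exact: (L_ltub a_gt0 a_le1 admK 3).
  by rewrite -[X in _ <= X]mulr1 ler_pM2l.
apply: le_trans E3.
have E1 : Lk 1 = (1 + a) * Lk 0 ^+ l - a by rewrite Lk1 Lk0.
have E4 : Lk 4 = (1 + a) * Lk 3 ^+ l - a by rewrite LkS kneadQ_small gk0 opprB.
have h1 : Zk 1 < Lk 1 by have := L_gtZ a_gt0 a_le1 admK 1; rewrite kneadQ_small.
have h4 : Lk 4 < Zk 2 by have := L_ltZ a_gt0 a_le1 admK 4; rewrite kneadQ_small.
have Z2 := Z_gt0 a_gt0 a_le1 admK 2; have Z12 := Z_ltS a_gt0 a_le1 admK 1.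
have Zh := @Z_ge_half3 1 isT isT.
have lnz : ln (Zk 1) - ln (Zk 2) = gap 1 / lr by rewrite !lnZ// subNdiv.
have := half_ln_le_sub Z2 (ltW Z12); rewrite lnz => H.
have {}H : gap 1 / lr / 2 * Zk 1 <= Zk 1 - Zk 2.
  by apply: H; rewrite ler_pdivrMr// mul1r; lra.
have h5 : 1 / 32 / lr / 2 * (1 / 2) <= gap 1 / lr / 2 * Zk 1.
  apply: ler_pM; [by rewrite !divr_ge0// ltW|lra| |lra].
  by rewrite ler_pM2r// ler_pM2r ?invr_gt0.
have t0 : 0 < lr^-1 by rewrite invr_gt0.
have tE : tiny = lr^-1 / 16 / 16 by field; rewrite gt_eqF.
have h6 : (1 + a) * (Lk 0 ^+ l - Lk 3 ^+ l) <= 2 * (Lk 0 ^+ l - Lk 3 ^+ l).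
  rewrite ler_wpM2r//; last lra.
  by rewrite subr_ge0 ler_pXn2r ?nnegrE ?ltW// ?expn_gt0//; exact: (L_ltub a_gt0 a_le1 admK 3).
rewrite tE; lra.
Qed.

Lemma tiny_gt0 : 0 < tiny.
Proof. by rewrite invr_gt0 mulr_gt0 ?lr0//; lra. Qed.

Lemma tiny_le : tiny <= 1 / 32.
Proof.
have l0 := lr0; have A2' := A2; have Al' := Al.
by rewrite -[leRHS]invrK lef_pV2 ?posrE; lra.
Qed.

Lemma ext_all k : (0 < n)%N -> (k <= n)%N -> tiny <= ext k.
Proof.
move=> n0; have t0 := tiny_gt0; have t1 := tiny_le; have A2' := A2; have Al' := Al.
elim/ltn_ind: k => k IH kn.
have [k2|k2] := leqP k 2; first by have := ext_small k2; lra.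
have [->|k3] := eqVneq k 3%N; first exact: ext3_ge.
have [->|k4] := eqVneq k 4%N; first by have := ext4_ge; lra.
have k5 : (4 < k)%N by rewrite ltn_neqAle eq_sym k4 ltn_neqAle eq_sym k3.
have sk : (Q (Q k) < k)%N by apply: kneadQQ_ltk.
have es : tiny <= ext (Q (Q k)) by apply: IH => //; apply: leq_trans (ltnW sk) kn.
have e0 : 0 < ext (Q (Q k)) by lra.
have A1 : 1 <= A by lra. have A16 : 16 * A <= lr by lra.
have gs : gapsle m a A (Q (Q k)).
  move=> i _ iQ; apply: gA; apply: (leq_trans iQ); apply: (leq_trans (kneadQ_leS _)).
  exact: leq_trans (ltnW sk) kn.
by have [|] := ext_step a_gt0 a_le1 admK A1 A16 k5 gs e0; lra.
Qed.

Hypothesis tiny_exp : 2 * tiny ^- 2 <= expR lr.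

(** Level 2 is covered neither by [off_ge] nor by [off_base]. The chain of [off_lower] has
    [j = q = 0], and [exp thdrop = a / (a - L_3)] is at least 2 because [L_3 >= 1 / 2]. *)
Lemma off2_ge : (1 < n)%N -> 1 / (24 * 16) <= off 2.
Proof.
move=> n1; have a0 := a_gt0; have a1 := a_le1; have A2' := A2; have Al' := Al; have l0 := lr0.
have w0 := L_gt0 a_gt0 a_le1 admK 3.
have wL : Lk 3 < Lk (Q 1) by rewrite kneadQ_small; exact: (L_ltub a_gt0 a_le1 admK 3).
have kj : Q 3 = 1%N by rewrite kneadQ_small.
have L3h : 1 / 2 <= Lk 3.
  apply: ltW; apply: (le_lt_trans (@Z_ge_half3 1 isT isT)).
  by have := L_gtZ a_gt0 a_le1 admK 3; rewrite kneadQ_small.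
have D0 := @thdrop_gt0 R m a a_gt0 a_le1 admK 0 _ w0 wL.
have DE := @expR_thdrop R m a a_gt0 a_le1 admK 0 _ w0 wL.
rewrite kneadQ_small Lk0 in wL.
have a1p : 1 + a != 0 by rewrite gt_eqF//; lra.
have La : 0 < a - Lk 3 by rewrite subr_gt0.
have DE' : expR (thdrop m a 0 (Lk 3)) = a / (a - Lk 3).
  rewrite DE kneadQ_small -(th0E m a 0) !th0 subr0.
  by field; rewrite a1p/= gt_eqF.
have Dlow : 1 / 2 <= thdrop m a 0 (Lk 3).
  have h : 1 / 2 <= ln (1 + 1 : R) by apply: ln_ge_half; lra.
  apply: (le_trans h); rewrite -[leRHS]expRK ler_ln ?posrE ?expR_gt0 ?addr_gt0//.
  by rewrite DE' ler_pdivlMr//; lra.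
have e3 := ext3_ge (ltnW n1); have t0 := tiny_gt0.
(* By the bound on [ext 3], [a - L_3] is at least [tiny^2 a / 2], so [tiny_exp] applies. *)
have Dup : thdrop m a 0 (Lk 3) <= lr.
  rewrite -[leLHS]expRK -[leRHS]expRK ler_ln ?posrE ?expR_gt0//.
  apply: le_trans tiny_exp; rewrite DE' ler_pdivrMr//.
  have xE : ln (Lk 0) - ln (Lk 3) = ext 3 / lr.
    by rewrite lnLL /Height.ext /Height.xheight /Branch.Xk /= !kneadQ_small.
  have := half_ln_le_sub w0 (ltW (L_ltub a_gt0 a_le1 admK 3)).
  rewrite /Branch.ubk /= xE => H.
  have tl : tiny <= lr^-1 by rewrite lef_pV2 ?posrE ?mulr_gt0//; lra.
  have h1 : tiny * tiny <= ext 3 / lr by apply: ler_pM => //; exact: ltW.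
  have gs3 : gapsle m a A 3 by move=> i _; rewrite kneadQ_small leqn0 => /eqP->; apply: gA.
  have A1' : 1 <= A by lra.
  have eu3 := ext_upper a_gt0 a_le1 admK A1' gs3.
  have e1 : ext 3 / lr <= 1 by rewrite ler_pdivrMr//; lra.
  have := H e1; rewrite Lk0 => {}H.
  have h2 : tiny ^+ 2 / 2 * a <= a - Lk 3.
    by apply: le_trans H; rewrite ler_pM2r// ler_pM2r// expr2.
  have T0 : 0 < tiny ^+ 2 by rewrite exprn_gt0.
  by rewrite [leRHS]mulrAC ler_pdivlMr//; lra.
have e0 := ext_small (isT : (0 <= 2)%N).
have gs : gapsle m a A 0 by move=> i _; rewrite kneadQ_small leqn0 => /eqP->; apply: gA.
have A1 : 1 <= A by lra.
have eu := ext_upper a_gt0 a_le1 admK A1 gs.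
have ou : off 0 <= 2.
  by apply: (le_trans (ltW (olt 0))); rewrite kneadQ_small; exact: gap0_le2.
have wL' : Lk 3 < Lk (Q 1) by rewrite kneadQ_small Lk0.
have OL := off_lower a_gt0 a_le1 admK kj w0 wL' erefl.
have {}OL : thdrop m a 0 (Lk 3) * ext 0 <=
    8 * (expR (off 2) - 1) * ((ext 0 + off 0 + thdrop m a 0 (Lk 3)) * off 0).
  by apply: OL; lra.
have [h2|h2] := leP (1 / 2) (off 2); first lra.
have ok0 := o0 2; have xo := expR_le_1D2x (ltW ok0) (ltW h2).
have o00 := o0 0.
exact: (off2_ge_alg Dlow e0 ou OL).
Qed.

End Inductive.
End Crude.

(** The inequality of [gap_upper_aux] gives [G >= b / (16^4 A^2)], and that of [gap_upper2] then
    bounds [exp g]. *)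
Lemma gap_late_alg {R : realType} (A b g G o oj ok1 eq F D : R) : 1 <= A -> 0 < b -> b <= 1 ->
  0 < oj ->
  ok1 * eq <= 8 * (expR G - 1) * ((eq + F + ok1) * F) ->
  (expR g - 1) * (G * oj) <= 2 * (1 + o) * (G * oj + 8 * (oj + D) * D) ->
  0 < o -> o <= A -> oj <= A -> ok1 <= A -> b <= oj -> b <= ok1 -> 1 / 4 <= eq -> eq <= 16 * A ->
  0 < F -> F <= 16 * A -> 0 < D -> D <= A ->
  expR g <= 16 ^+ 6 * (A ^+ 5 / b ^+ 2).
Proof.
move=> A1 b0 b1 oj0 aux up oo oA ojA ok1A boj bok eq4 eqA F0 FA D0 DA.
have G0 : 0 < G.
  rewrite ltNge; apply/negP => G0; have : 0 < ok1 * eq by rewrite mulr_gt0//; lra.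
  apply/negP; rewrite -leNgt; apply: (le_trans aux); rewrite mulr_le0_ge0//.
    have : expR G <= 1 by rewrite -expR0 ler_expR.
    lra.
  by rewrite mulr_ge0//; lra.
have c1 : 16 ^+ 4 = 16 * 16 * 16 * 16 :> R by ring.
have GB : b <= G * (16 ^+ 4 * A ^+ 2).
  have AA : 1 <= A ^+ 2 by rewrite exprn_ege1.
  have [G2|G2] := leP (1 / 2) G.
    rewrite c1; apply: (le_trans b1); apply: (@le_trans _ _ (1 / 2 * (16 * 16 * 16 * 16 * A ^+ 2))); first lra.
    by rewrite ler_wpM2r//; lra.
  have h1 := expR_le_1D2x (ltW G0) (ltW G2).
  have h2 : b / 4 <= ok1 * eq.
    by apply: (@ler_pM _ b ok1 (4^-1) eq); lra.
  have h3 : 8 * (expR G - 1) * ((eq + F + ok1) * F) <= 16 * G * ((33 * A) * (16 * A)).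
    apply: ler_pM; [|by rewrite mulr_ge0//; lra|lra|].
      by have := expR_ge1Dx G; lra.
    by apply: ler_pM; lra.
  have : 16 * G * ((33 * A) * (16 * A)) = (16 * 33 * 16) * (G * A ^+ 2) by ring.
  have GA : 0 < G * A ^+ 2 by rewrite mulr_gt0// (lt_le_trans ltr01).
  by rewrite mulrCA c1; lra.
have A0 : 0 < A by lra.
have C0 : 0 < 16 ^+ 4 * A ^+ 2 by rewrite mulr_gt0 ?exprn_gt0.
have S0 : 0 < G * oj by rewrite mulr_gt0.
have b2 : 0 < b ^+ 2 by rewrite exprn_gt0.
have SB : b ^+ 2 <= G * oj * (16 ^+ 4 * A ^+ 2).
  by rewrite expr2 mulrAC; apply: ler_pM => //; rewrite ltW.
have P16 : 8 * (oj + D) * D <= 16 * A ^+ 2.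
  apply: (@le_trans _ _ (8 * (A + A) * A)); last by rewrite le_eqVlt; apply/orP; left; apply/eqP; ring.
  by apply: ler_pM; lra.
have H : (expR g - 1) * (G * oj) <= 4 * A * (G * oj + 16 * A ^+ 2).
  apply: (le_trans up); apply: ler_pM; [lra| |lra|lra].
  by rewrite addr_ge0 ?(ltW S0)// mulr_ge0 ?ltW//; lra.
have X1 : A <= A ^+ 5 / b ^+ 2.
  rewrite ler_pdivlMr//; apply: (@le_trans _ _ (A * 1)).
    by rewrite ler_pM2l// exprn_ile1// ltW.
  by rewrite mulr1 -{1}(expr1 A); apply: ler_weXn2l.
rewrite -(ler_pM2r S0).
have -> : expR g * (G * oj) = (expR g - 1) * (G * oj) + G * oj by ring.
have T : A ^+ 3 <= A ^+ 5 / b ^+ 2 * 16 ^+ 4 * (G * oj).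
  have -> : A ^+ 5 / b ^+ 2 * 16 ^+ 4 * (G * oj) = A ^+ 3 / b ^+ 2 * (G * oj * (16 ^+ 4 * A ^+ 2)).
    by ring.
  by rewrite -{1}[A ^+ 3](@divfK _ (b ^+ 2)) ?gt_eqF// ler_pM2l// divr_gt0 ?exprn_gt0.
have XS : A * (G * oj) <= A ^+ 5 / b ^+ 2 * (G * oj) by rewrite ler_pM2r.
have AS : 1 * (G * oj) <= A * (G * oj) by rewrite ler_pM2r.
have c6 : 16 ^+ 6 = 16 * 16 * 16 ^+ 4 :> R by ring.
have c40 : (1:R) <= 16 ^+ 4 by apply: exprn_ege1; lra.
set X := A ^+ 5 / b ^+ 2 in X1 T XS *; set S := G * oj in S0 SB H T XS AS *.
have XS0 : 0 < X * S by rewrite mulr_gt0//; lra.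
rewrite c6; set c := 16 ^+ 4 in c40 T *.
have T' : A ^+ 3 <= c * (X * S) by rewrite mulrCA mulrA.
have : X * S <= c * (X * S) by rewrite -{1}[X * S]mul1r ler_pM2r.
have e1 : 16 * 16 * c * X * S = 256 * (c * (X * S)) by ring.
have e2 : 4 * A * (S + 16 * A ^+ 2) = 4 * (A * S) + 64 * A ^+ 3 by ring.
move: X S c {C0 P16 GB up aux SB} X1 S0 H T XS AS XS0 c40 T' e1 e2 => X S c X1 S0 H T XS AS XS0 c40 T' e1 e2.
lra.
Qed.

(** * Bounds on all levels, and their improvement on large ones *)

Section Late.
Context {R : realType} (m : nat) (a : R).
Implicit Types (w x y A : R) (i j k K : nat).

Local Notation l := (2 ^ m)%N.
Local Notation lr := ((2 ^ m)%:R : R).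
Local Notation Q := kneadQ.
Local Notation Lk := (Lk m a).
Local Notation Zk := (Zk m a).
Local Notation Yk := (Yk m a).
Local Notation Mk := (Mk m a).
Local Notation Xk := (Xk m a).
Local Notation gap := (gap m a).
Local Notation off := (off m a).
Local Notation ext := (ext m a).
Local Notation height := (height m a).
Local Notation lheight := (lheight m a).
Local Notation xheight := (xheight m a).

Hypotheses (a_gt0 : 0 < a) (a_le1 : a <= 1) (admK : forall K, adm m a K).
Arguments admK : clear implicits.

Let hm := height_mono a_gt0 a_le1 admK.
Let lgt := lheight_gt a_gt0 a_le1 admK.
Let o0 := off_gt0 a_gt0 a_le1 admK.
Let olt := off_lt a_gt0 a_le1 admK.
Let g0 := gap_gt0 a_gt0 a_le1 admK.

Notation tiny := ((16 * 16 * lr)^-1).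
Notation floor A := (tiny ^+ 2 / (24 * 16 * 16 * A ^+ 3)).

(** Levels 0, 1 and 3 have [Q (k+1) = 0] and fall under [off_base]; level 2 is [off2_ge], and from
    level 4 on [off_ge] applies. *)
Lemma off_floor A k : 1 / 2 <= a -> 2 <= A -> 64 * A <= lr -> 2 * tiny ^- 2 <= expR lr ->
  (forall i, (i <= k)%N -> gap i <= A) -> floor A <= off k.
Proof.
move=> a_ge A2 Al te gA; have l0 : 0 < lr by apply: lr_gt0.
have t0 : 0 < tiny by rewrite invr_gt0 mulr_gt0 ?l0//; lra.
have t1 : tiny <= 1 / 32 by rewrite -[leRHS]invrK lef_pV2 ?posrE; lra.
have A3 : 1 <= A ^+ 3 by rewrite exprn_ege1//; lra.
have T2 : tiny ^+ 2 <= 1 by rewrite expr_le1//; lra.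
have F1 : floor A <= 1 / (24 * 16) by rewrite ler_pdivrMr; lra.
have ZL i : (k < 4)%N -> k = i -> Q k.+1 = 0%N -> floor A <= off k.
  move=> k4 ki Qk; suff : 1 / 4 <= off k by lra.
  apply: (off_base a_gt0 a_le1 admK Qk); apply: ltW; apply: le_lt_trans (L_gtZ a_gt0 a_le1 admK k.+1).
  have q3 : ((Q k.+2).+1 <= 3)%N.
    by move: k4 Qk; clear; case: k => [|[|[|[|//]]]]; rewrite !kneadQ_small.
  have qk : ((Q k.+2).+1 <= k.+1)%N.
    by move: k4 Qk; clear; case: k => [|[|[|[|//]]]]; rewrite !kneadQ_small.
  exact: (Z_ge_half3 a_gt0 a_le1 admK A2 Al gA).
have [k3|k3] := ltnP 3 k.
  apply: (@off_ge R m a a_gt0 a_le1 admK A tiny k) => //; try lra.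
    by move=> i _; exact: gA.
  move=> i _ ik; apply: (ext_all a_gt0 a_le1 admK a_ge A2 Al gA) => //.
  by apply: leq_trans k3.
have [k2|k2] := eqVneq k 2%N.
  apply: (le_trans F1); rewrite k2; apply: (off2_ge a_gt0 a_le1 admK a_ge A2 Al gA te).
  by rewrite k2.
apply: (ZL k) => //; move: k2 k3; clear.
by case: k => [|[|[|[|//]]]]; rewrite ?kneadQ_small.
Qed.

Section Global.
Hypothesis a_ge : 1 / 2 <= a.
Variable A : R.
Hypotheses (A2 : 2 <= A) (Al : 64 * A <= lr) (tiny_exp : 2 * tiny ^- 2 <= expR lr)
  (floor_exp : 1 + 3 * lr / floor A <= expR A).

Lemma floor_gt0 : 0 < floor A.
Proof.
have l0 : 0 < lr by apply: lr_gt0.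
have A2' := A2; have A0 : 0 < A by lra.
by rewrite divr_gt0 ?mulr_gt0 ?exprn_gt0 ?invr_gt0 ?mulr_gt0.
Qed.

(** Gaps bounded by [A] up to level [k] give [off k >= floor A], and [gap_upper] bounds the next gap
    by [ln (1 + 3 l / floor A)]. This is at most [A] by [floor_exp], which [A] of order [ln l] can
    satisfy. *)
Lemma gap_le k : gap k <= A.
Proof.
have A2' := A2; have Al' := Al; have f0 := floor_gt0.
elim/ltn_ind: k => -[_|k IH]; first by have := gap0_le2 a_gt0 a_le1 admK a_ge; lra.
have gA i : (i <= k)%N -> gap i <= A by move=> ik; apply: IH.
apply: (gap_next a_gt0 a_le1 admK _ _ _ f0 (off_floor _ A2 _ _ gA)) => //; try lra.
by move=> i _; exact: gA.
Qed.

Lemma off_ge_floor k : floor A <= off k.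
Proof. by apply: off_floor => // i _; exact: gap_le. Qed.

Lemma ext_ge_tiny k : tiny <= ext k.
Proof.
apply: (ext_all a_gt0 a_le1 admK a_ge A2 Al (fun i _ => gap_le i) (n := k.+1)) => //.
Qed.

Lemma ext_late_step n k : (10 * n + 5 <= k)%N -> 1 / 4 <= ext k \/ 2 ^+ n * tiny <= ext k.
Proof.
elim: n k => [|n IH] k kn; first by right; rewrite mul1r; exact: ext_ge_tiny.
have k4 : (4 < k)%N by apply: leq_trans kn; rewrite leq_addl.
have qk : (10 * n + 5 <= Q (Q k))%N.
  by have := kneadQQ_ge k; move: kn; clear; lia.
have A2' := A2; have Al' := Al.
have A1 : 1 <= A by lra. have A16 : 16 * A <= lr by lra.
have l0 : 0 < lr by apply: lr_gt0.
have t0 : 0 < tiny by rewrite invr_gt0 mulr_gt0 ?l0//; lra.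
have et := ext_ge_tiny (Q (Q k)).
have e0 : 0 < ext (Q (Q k)) by lra.
have [|H] := ext_step a_gt0 a_le1 admK A1 A16 k4 (fun i _ _ => gap_le i) e0; first by left.
have [e1|e1] := IH _ qk; first by left; lra.
by right; rewrite exprS -mulrA; lra.
Qed.

(** As [tiny = 2^-(m+8)], [m + 8] doublings by [ext_step] suffice, and each takes at most ten
    levels. *)
Lemma ext_late : exists K, forall k, (K <= k)%N -> 1 / 4 <= ext k.
Proof.
have l0 : 0 < lr by apply: lr_gt0.
have t0 : 0 < tiny by rewrite invr_gt0 mulr_gt0 ?l0//; lra.
exists (10 * (m + 8) + 5)%N => k /ext_late_step[//|]; apply: le_trans.
have -> : 2 ^+ (m + 8) = 16 * 16 * lr :> R by rewrite exprD natrX mulrC; congr (_ * _); ring.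
by rewrite divff; [lra|rewrite gt_eqF// mulr_gt0//; lra].
Qed.

Section LateGap.
Variables (K : nat) (b : R).
Hypotheses (extK : forall k, (K <= k)%N -> 1 / 4 <= ext k) (b_gt0 : 0 < b) (b_le1 : b <= 1)
  (offK : forall k, (K <= k)%N -> b <= off k).

(** The bound no longer contains [l]: with [A = O(m)] and [b] of order [A^-3] it is [O(ln m)]. *)
Lemma gap_late k : (K + 30 <= k)%N -> gap k.+2 <= ln (16 ^+ 6 * (A ^+ 5 / b ^+ 2)).
Proof.
move=> kK; have k3 : (3 < k)%N by apply: leq_trans (leq_trans _ (leq_addl K 30)) kK.
have [j kj [[jk kj9 hq1 hq2 hq3] [hq4 hq5 _ _ _]]] := kneadQ_pack k3.
have KQ : (K <= Q j.+1)%N by move: kK hq2; clear; lia.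
have Kj : (K <= j)%N by move: kK kj9; clear; lia.
have Kk : (K <= k.+1)%N by move: kK; clear; lia.
have k4 : (4 < k.+1)%N by [].
have A2' := A2; have Al' := Al; have b0 := b_gt0; have b1 := b_le1.
have A1 : 1 <= A by lra.
have qq : lheight (Q j.+1) < lheight k.+1 by rewrite -kj; exact: (lheight_QQ a_gt0 a_le1 admK k4).
have wL := lheight_lt_LL a_gt0 a_le1 admK qq; have w0 := L_gt0 a_gt0 a_le1 admK k.+1.
have gs i : gapsle m a A i by move=> ? _ _; exact: gap_le.
have eu i := ext_upper a_gt0 a_le1 admK A1 (gs i).
have ou i := off_upper a_gt0 a_le1 admK (gs i).
have ek := eu k.+1; rewrite ext_big// kj in ek.
have D0 := thdrop_gt0 a_gt0 a_le1 admK w0 wL.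
have DA : thdrop m a j (Lk k.+1) <= A by apply: (thdrop_le a_gt0 a_le1 admK kj hq5); exact: gap_le.
have e0 : 0 < ext (Q j.+1) by have := extK KQ; lra.
have el : ext (Q j.+1) <= lr by have := eu (Q j.+1); lra.
have Fl : 2 * (lheight k.+1 - lheight (Q j.+1)) <= lr by lra.
have oj := ou j; have oj0 := o0 j; have ok := ou k; have ok0 := o0 k; have ok1 := ou k.+1.
have F0 : 0 < lheight k.+1 - lheight (Q j.+1) by lra.
have aux := gap_upper_aux a_gt0 a_le1 admK wL e0 el Fl.
have up := gap_upper2 a_gt0 a_le1 admK kj wL.
rewrite -[leLHS]expRK ler_ln ?posrE ?expR_gt0//; last first.
  by rewrite !(mulr_gt0, exprn_gt0, invr_gt0)//; lra.
have l1 : off k.+1 <= lr by lra. have l2 : off j <= lr by lra.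
have l3 : 2 * off k <= lr by lra. have l4 : 2 * thdrop m a j (Lk k.+1) <= lr by lra.
have {}aux := aux l1; have {}up := up l2 l3 l4.
have boj := offK Kj; have bok := offK Kk; have eq4 := extK KQ.
have eqA := eu (Q j.+1).
exact: (gap_late_alg A1 b0 b1 oj0 aux up).
Qed.

End LateGap.
End Global.
End Late.

(** The source of the exponent [l = 2^m]: [n = 2^7], [m = 2^n] and [J = m / 2]. The factor [2^60]
    leaves room for the constants in the distortion. *)
Lemma pow2_dominates {R : realType} : exists n J : nat, [/\ (7 <= n)%N, (2 ^ n = 2 * J)%N, (2 ^ 7 * n <= J)%N,
   2 ^+ 60 * n%:R ^+ 4 <= J%:R :> R & exists J', J = (2 ^ J')%N].
Proof.
have n7 : (2 ^ 7 = 128)%N by [].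
exists (2 ^ 7)%N, (2 ^ 127)%N; split; last by exists 127.
- by rewrite n7.
- by rewrite n7 -expnS.
- by rewrite -expnD leq_exp2l.
- by rewrite -!natrX -natrM ler_nat -expnM -expnD leq_exp2l.
Qed.

Lemma pow2_gt n : (7 <= n)%N -> (17 + 2 * n <= 2 ^ n)%N.
Proof.
elim: n => // n IH; rewrite leq_eqVlt => /orP[/eqP<-//|n7].
have := IH n7; rewrite expnS; lia.
Qed.

Lemma pow2_expR {R : realType} n : 2 ^+ n <= expR n%:R :> R.
Proof.
rewrite -[n%:R]mulr1 expRM_natl lerXn2r ?nnegrE ?expR_ge0//.
by have := expR_ge1Dx (1 : R); lra.
Qed.

(* [tame_J] makes the sum of [1 / (1 + i D)], [0 < i < 2^J], at least [6] for the
   distortion [D = 4 A / b]; [tame_lr] says that [2^J] gaps are short compared with [l]. *)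
Record tame {R : realType} (m : nat) (a A b : R) (K J : nat) : Prop := Tame {
  tame_l : (0 < m)%N; tame_a : 1 / 2 <= a; tame_a1 : a <= 1;
  tame_adm : forall K, adm m a K;
  tame_A : 1 <= A; tame_b : 0 < b;
  tame_gap : forall k, (K <= k)%N -> gap m a k <= A;
  tame_off : forall k, (K <= k)%N -> b <= off m a k;
  tame_lr : 2 * 2 ^+ J * A <= (2 ^ m)%:R;
  tame_J : 6 * (1 + 2 * (4 * A / b)) <= J%:R;
  tame_unif : exists B e, [/\ 1 <= B, 4 * B <= (2 ^ m)%:R :> R, 0 < e, forall k, gap m a k <= B & forall k, e <= off m a k]
}.

Lemma tame_exists {R : realType} : exists m (a A b : R) K J, tame m a A b K J.
Proof.
have [n [J [n7 nJ nJ7 + [J' JE]]]] := @pow2_dominates R.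
move=> nJ60; move E : (2 ^ n)%N nJ => m nJ; have [m9 m7] : (n + 9 <= m)%N /\ (7 <= m)%N by move: nJ nJ7 n7; clear; lia.
have m0 : (0 < m)%N by rewrite -E expn_gt0.
have [a [a2 a1 admK]] := @adm_param R m m0.
have a0 : 0 < a by lra.
pose M : R := n%:R.
have lE : (2 ^ m)%:R = 2 ^+ m :> R by rewrite natrX.
(* The crude bound [A = 8 m]. *)
pose A : R := 2 ^+ (n + 3).
have A2 : 2 <= A by rewrite /A -{1}(expr1 2); apply: ler_weXn2l; lia || lra.
have p2 i j : (i <= j)%N -> 2 ^+ i <= 2 ^+ j :> R by move=> ij; apply: ler_weXn2l => //; lra.

have Al : 64 * A <= (2 ^ m)%:R.
  rewrite lE; apply: (@le_trans _ _ (2 ^+ (n + 9))); last exact: p2.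
  by rewrite le_eqVlt; apply/orP; left; apply/eqP; rewrite /A !exprD; ring.
have te : 2 * (16 * 16 * (2 ^ m)%:R)^-1 ^- 2 <= expR (2 ^ m)%:R :> R.
  apply: (le_trans _ (pow2_expR _)).
  apply: (@le_trans _ _ (2 ^+ (17 + 2 * m))); last exact: p2 (pow2_gt m7).
  rewrite -exprVn invrK lE le_eqVlt; apply/orP; left; apply/eqP; rewrite exprD mulnC exprM; ring.
have l0 : 0 < 2 ^+ m :> R by rewrite exprn_gt0.
have A0 : 0 < A by lra.
have fe : 1 + 3 * (2 ^ m)%:R / ((16 * 16 * (2 ^ m)%:R)^-1 ^+ 2 / (24 * 16 * 16 * A ^+ 3)) <= expR A.
  have AE : A = (m * 8)%:R by rewrite -E -[8%N]/(2 ^ 3)%N -expnD natrX.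
  rewrite [in leRHS]AE; apply: (le_trans _ (pow2_expR _)); rewrite lE.
  have -> : 3 * 2 ^+ m / ((16 * 16 * 2 ^+ m)^-1 ^+ 2 / (24 * 16 * 16 * A ^+ 3)) =
     3 * 24 * 16 * 16 * 16 * 16 * 16 * 16 * ((2 ^+ m) ^+ 3 * A ^+ 3).
    by field; rewrite !gt_eqF.
  rewrite /A -!exprM -exprD; set e := (m * 3 + _)%N; have P1 : 1 <= 2 ^+ e :> R by rewrite -(expr0 2) p2.
  apply: (@le_trans _ _ (2 ^+ (e + 32))).
    rewrite exprD; have -> : 2 ^+ 32 = 16 * 16 * 16 * 16 * 16 * 16 * 16 * 16 :> R by ring.
    lra.
  apply: p2; rewrite /e; move: m9 m7; clear; lia.
have [K1 extK] := ext_late a0 a1 admK a2 A2 Al te fe.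
have gA := gap_le a0 a1 admK a2 A2 Al te fe.
have offE A' K' : 1 <= A' -> 32 * A' <= (2 ^ m)%:R -> (K1 <= K')%N -> 
    (forall k, (K' <= k)%N -> gap m a k <= A') ->
    forall k, (K' + 30 <= k)%N -> (1 / 4) ^+ 2 / (24 * 16 * 16 * A' ^+ 3) <= off m a k.
  move=> A1' Al' KK gA' k kK.
  apply: (off_ge a0 a1 admK A1' Al'); [lra|lra|by move: kK; clear; lia| |].
    by move=> i ik _; apply: gA'; move: ik kK; clear; lia.
  by move=> i ik _; apply: extK; move: ik kK KK; clear; lia.
have A1 : 1 <= A by lra.
have Al32 : 32 * A <= (2 ^ m)%:R by lra.
have offb := offE A K1 A1 Al32 (leqnn _) (fun k _ => gA k).
have A3 : 0 < 24 * 16 * 16 * A ^+ 3 by rewrite mulr_gt0// exprn_gt0.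
have b0 : 0 < (1 / 4) ^+ 2 / (24 * 16 * 16 * A ^+ 3) by rewrite divr_gt0 ?exprn_gt0.
have b1 : (1 / 4) ^+ 2 / (24 * 16 * 16 * A ^+ 3) <= 1.
  have : 1 <= A ^+ 3 by rewrite exprn_ege1.
  by rewrite ler_pdivrMr// expr2; lra.
have extK' k : (K1 + 30 <= k)%N -> 1 / 4 <= ext m a k.
  by move=> kK; apply: extK; apply: leq_trans kK; rewrite leq_addr.
have gl := gap_late a0 a1 admK a2 A2 Al te fe extK' b0 b1 offb.
(* The improved bound, [128] times the binary logarithm of [m]: the argument of the logarithm in
   [gap_late] is at most [2^58 A^11 = 2^(91 + 11 n)]. *)
pose A' : R := 2 ^+ 7 * n%:R.
have n1 : 1 <= n%:R :> R by rewrite ler1n (leq_trans _ n7).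
have A1' : 1 <= A'.
  by rewrite -[leLHS]mulr1; apply: ler_pM => //; rewrite exprn_ege1//; lra.
have gA' k : (K1 + 100 <= k)%N -> gap m a k <= A'.
  case: k => [|[|k]] kK; [by move: kK; clear; lia..|].
  apply: (le_trans (gl k _)); first by move: kK; clear; lia.
  rewrite -[leRHS]expRK ler_ln ?posrE ?expR_gt0//; last by rewrite mulr_gt0 ?divr_gt0 ?exprn_gt0.
  have -> : A' = (2 ^ 7 * n)%:R by rewrite natrM natrX.
  apply: (le_trans _ (pow2_expR _)).
  have -> : 16 ^+ 6 * (A ^+ 5 / ((1 / 4) ^+ 2 / (24 * 16 * 16 * A ^+ 3)) ^+ 2) =
      16 ^+ 6 * (16 * 24 * 16 * 16) ^+ 2 * A ^+ 11 by field; rewrite gt_eqF.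
  apply: (@le_trans _ _ (2 ^+ 58 * A ^+ 11)).
    rewrite ler_pM2r ?exprn_gt0// (_ : 2 ^+ 58 = 16 ^+ 6 * (16 * 32 * 16 * 16) ^+ 2); last by ring.
    by rewrite ler_pM2l ?exprn_gt0// ler_pXn2r ?nnegrE//; lra.
  by rewrite /A -exprM -exprD; apply: p2; move: n7; clear; lia.
have A0' : 0 < A' by lra.
have nJR : A' <= J%:R by rewrite /A' -natrX -natrM ler_nat.
have Jm : (17 + 2 * J <= 2 ^ J)%N by apply: pow2_gt; move: nJ7 n7; clear; lia.
have lJ : (2 ^ m)%:R = 2 ^+ J * 2 ^+ J :> R by rewrite lE nJ mulnC exprM expr2.
have JR : 17 + 2 * J%:R <= 2 ^+ J :> R by rewrite -natrX -natrM -natrD ler_nat.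
have lr' : 2 * 2 ^+ J * A' <= (2 ^ m)%:R.
  by rewrite lJ -mulrA mulrCA ler_pM2l ?exprn_gt0//; lra.
have Al' : 32 * A' <= (2 ^ m)%:R.
  apply: le_trans lr'; rewrite ler_pM2r//; have : 1 <= J%:R :> R by lra.
  lra.
have KK : (K1 <= K1 + 100)%N by rewrite leq_addr.
(* Second round: the lower bound for [off] is recomputed from the improved bound [A']. *)
have offb' := offE A' _ A1' Al' KK gA'.
have A3' : 0 < 24 * 16 * 16 * A' ^+ 3 by rewrite mulr_gt0// exprn_gt0.
exists m, a, A', ((1 / 4) ^+ 2 / (24 * 16 * 16 * A' ^+ 3)), (K1 + 100 + 30)%N, J; split => //.
- by rewrite divr_gt0 ?exprn_gt0.
- by move=> k kK; apply: gA'; move: kK; clear; lia.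
- have -> : 4 * A' / ((1 / 4) ^+ 2 / (24 * 16 * 16 * A' ^+ 3)) = 4 * 24 * 16 * 16 * 16 * A' ^+ 4.
    by field; rewrite gt_eqF.
  apply: le_trans nJ60; have -> : A' ^+ 4 = 16 ^+ 7 * n%:R ^+ 4 by rewrite /A' exprMn; congr (_ * _); ring.
  have : 1 <= n%:R ^+ 4 :> R by rewrite exprn_ege1.
  set N := n%:R ^+ 4 => N1.
  have -> : 2 ^+ 60 * N = 2 ^+ 32 * (16 ^+ 7 * N) by ring.
  have N2 : 1 <= 16 ^+ 7 * N.
    by rewrite -[leLHS]mulr1; apply: ler_pM => //; rewrite exprn_ege1//; lra.
  have -> : 2 ^+ 32 = 16 * 16 * 16 * 16 * 16 * 16 * 16 * 16 :> R by ring.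
  by move: (16 ^+ 7 * N) N2 => N' N2; lra.
(* [tame_unif] keeps the crude bounds, which hold on all levels. *)
exists A, ((16 * 16 * (2 ^ m)%:R)^-1 ^+ 2 / (24 * 16 * 16 * A ^+ 3)); split => //; first lra.
  by rewrite divr_gt0 ?exprn_gt0 ?invr_gt0 ?mulr_gt0 ?lE.
exact: (off_ge_floor a0 a1 admK a2 A2 Al te fe).
Qed.

(** * Drift *)

Section DriftAux.
Context {R : realType}.
Implicit Types (phi : R -> R) (m : nat -> R).

Lemma crcontr_opp phi p q : crcontr phi p q -> crcontr (fun x => - phi x) p q.
Proof.
move=> cr a b c d pa ab bc cd dq; apply: le_trans (cr a b c d pa ab bc cd dq).
rewrite -(@cross_affine _ (-1) 0 (phi a)) ?oppr_eq0 ?oner_eq0//.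
by rewrite !mulN1r !addr0.
Qed.

Lemma smono_addn phi p q x y z : smono phi p q -> p <= x -> x < y -> y < z -> z <= q ->
  `|phi z - phi x| = `|phi z - phi y| + `|phi y - phi x|.
Proof.
move=> [] mo px xy yz zq.
  have h1 := mo x y px xy; have h2 := mo y z; rewrite !gtr0_norm ?subr_gt0; [ring| | |];
    (apply: mo || apply: (lt_trans (h1 _))); lra.
rewrite !ltr0_norm ?subr_lt0; [ring| | |]; apply: mo; lra.
Qed.

(** For an inverse branch [phi], [|phi y - phi x|] is the measure of the points sent into [(x, y)];
    it is compared with the measure of those sent into [(0, x)] by [crcontr_drop1] at
    [0 < x < y < L]. *)
Lemma mass_drop phi L x y : smono phi 0 L -> crcontr phi 0 L -> 0 < x -> x < y -> y < L ->
  `|phi y - phi x| * (x * (L - y)) <= (L * (y - x)) * `|phi x - phi 0|.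
Proof.
move=> [] mo cr x0 xy yL; have h1 := mo 0 x (lexx _) x0; have h2 := mo x y (ltW x0) xy.
  rewrite !gtr0_norm ?subr_gt0 ?h1 ?h2; try lra.
  have dec u v : 0 <= u -> u < v -> v <= L -> - phi v < - phi u.
    by move=> u0 uv vL; rewrite ltrN2 mo.
  have := crcontr_drop1 dec (crcontr_opp cr) (lexx 0) x0 xy yL (lexx _); rewrite !subr0.
  by rewrite !opprK [- phi x + _]addrC [- phi 0 + _]addrC.
rewrite !ltr0_norm ?subr_lt0 ?h1 ?h2; try lra.
have := crcontr_drop1 mo cr (lexx 0) x0 xy yL (lexx _); rewrite !subr0.
by rewrite !opprB.
Qed.

(* Summation by parts: the mean of [rho^level] after a jump to the levels [>= t]. *)
Lemma abel_bound (rho : R) m N n t : 0 <= rho -> rho <= 1 -> (forall i, 0 <= m i) ->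
  (forall i, m i.+1 <= m i) ->
  \sum_(t <= i < N) rho ^+ i * (m i - m i.+1) <=
  rho ^+ t * m t - (1 - rho) * \sum_(1 <= i < n.+1) rho ^+ (t + i).-1 * m (t + i)%N.
Proof.
move=> r0 r1 m0 mS; elim: n t => [|n IH] t.
  rewrite [X in _ - _ * X]big_nil mulr0 subr0.
  have [tN|Nt] := leqP t N; last first.
    by rewrite big_geq ?mulr_ge0 ?exprn_ge0// ltnW.
  apply: (@le_trans _ _ (rho ^+ t * (m t - m N))); last by rewrite ler_wpM2l ?exprn_ge0// gerBl.
  have -> : m t - m N = \sum_(t <= i < N) (m i - m i.+1).
    rewrite (@telescope_sumr_eq _ t N (fun i => - m i)) ?opprK ?[- _ + _]addrC// => i _.
    by rewrite opprK addrC.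
  rewrite mulr_sumr; apply: ler_sum_nat => i /andP[ti _].
  by rewrite ler_wpM2r ?subr_ge0// ler_wiXn2l.
have step : \sum_(t <= i < N) rho ^+ i * (m i - m i.+1) <=
    rho ^+ t * (m t - m t.+1) + \sum_(t.+1 <= i < N) rho ^+ i * (m i - m i.+1).
  have [tN|Nt] := ltnP t N; first by rewrite big_ltn.
  by rewrite !big_geq ?addr0 ?mulr_ge0 ?exprn_ge0 ?subr_ge0// (leq_trans Nt).
apply: (le_trans step); apply: (le_trans (lerD (lexx _) (IH t.+1))).
rewrite [X in _ <= _ - _ * X]big_nat_recl// addn1 /=.
under [X in _ <= _ - _ * (_ + X)]eq_bigr do rewrite addnS -addSn.
rewrite le_eqVlt; apply/orP; left; apply/eqP; rewrite exprS; ring.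
Qed.

(** Each dyadic block [2^j <= i < 2^(j+1)] contributes at least [1 / (1 + 2 D)]. *)
Lemma harmonic_ge (D : R) J : 0 <= D ->
  J%:R / (1 + 2 * D) <= \sum_(1 <= i < 2 ^ J) (1 + i%:R * D)^-1.
Proof.
move=> D0; have D1 : 0 < 1 + 2 * D by rewrite ltr_wpDr// mulr_ge0.
elim: J => [|J IH]; first by rewrite mul0r expn0 big_geq.
rewrite (@big_cat_nat _ _ _ (2 ^ J)) ?expn_gt0 ?leq_exp2l//= -natr1 mulrDl lerD// mul1r.
apply: (@le_trans _ _ (\sum_(2 ^ J <= i < 2 ^ J.+1) (2 ^+ J * (1 + 2 * D))^-1)).
  rewrite sumr_const_nat expnS mul2n -addnn addnK -[_ *+ (2 ^ J)]mulr_natl natrX invfM mulVKf//.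
apply: ler_sum_nat => i /andP[_ iJ].
have J1 : 1 <= 2 ^+ J :> R by rewrite exprn_ege1// ler1n.
rewrite lef_pV2 ?posrE ?mulr_gt0 ?exprn_gt0//; last by rewrite ltr_wpDr// mulr_ge0.
rewrite mulrDr mulr1 lerD// mulrA ler_wpM2r//.
by rewrite -exprSr -natrX ler_nat ltnW.
Qed.

End DriftAux.

Section Drift.
Context {R : realType} (m : nat) (a A b : R) (K J : nat).
Hypothesis H : tame m a A b K J.
Implicit Types (phi : R -> R).

Local Notation l := (2 ^ m)%N.
Local Notation lr := ((2 ^ m)%:R : R).
Local Notation Q := kneadQ.
Local Notation Lk := (Lk m a).
Local Notation Zk := (Zk m a).
Local Notation gap := (gap m a).
Local Notation off := (off m a).

Lemma tame_a0 : 0 < a. Proof. by have := tame_a H; lra. Qed.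

Let a0 := tame_a0.
Let a1 := tame_a1 H.
Let admK := tame_adm H.
Arguments admK : clear implicits.

Let D := 4 * A / b.

Let A_gt0 : 0 < A. Proof. by have := tame_A H; lra. Qed.
Let D_gt0 : 0 < D. Proof. by rewrite divr_gt0 ?mulr_gt0 ?(tame_b H). Qed.

(** With [t = Q (k+1) + 1] and [s = t + i], [(Z_t - Z_s) / Z_s] is at most [2 i A / l] and
    [(L_k - Z_t) / L_k] at least [b / (2 l)]. The quotient [i D] in [mass_drop] is free of [l], and
    the measure of the points landing beyond [i] further levels decays only harmonically. *)
Lemma mass_tame k i phi : (K + 5 <= k)%N -> smono phi 0 (Lk k) -> crcontr phi 0 (Lk k) ->
  (i <= 2 ^ J)%N -> `|phi (Zk (Q k.+1).+1) - phi 0| * (1 + i%:R * D)^-1 <=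
  `|phi (Zk ((Q k.+1).+1 + i)) - phi 0|.
Proof.
move=> Kk mo cr iJ; set t := (Q k.+1).+1; have iD : 0 < 1 + i%:R * D.
  by rewrite ltr_wpDr// mulr_ge0// ltW.
rewrite ler_pdivrMr//; case: i iJ iD => [|i] iJ iD; first by rewrite addn0 mul0r addr0 mulr1.
set s := (t + i.+1)%N; have ZL := L_gtZ a0 a1 admK k; rewrite -/t in ZL.
have tK : (K <= t)%N by have := kneadQ_ge k.+1; rewrite /t; move: Kk; clear; lia.
have Zs := Z_gt0 a0 a1 admK s; have Zt := Z_gt0 a0 a1 admK t.
have ZZ : Zk s < Zk t.
  apply: (le_lt_trans _ (Z_ltS a0 a1 admK t)); apply: (Z_noninc a0 a1 admK).
  by rewrite /s addnS ltnS leq_addr.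
have drop := mass_drop mo cr Zs ZZ ZL.
have -> : `|phi (Zk t) - phi 0| = `|phi (Zk t) - phi (Zk s)| + `|phi (Zk s) - phi 0|.
  by apply: (smono_addn mo) => //; exact: ltW.
rewrite mulrDr mulr1 [X in X <= _]addrC lerD2l.
have l0 : 0 < lr by apply: lr_gt0.
have L0 := L_gt0 a0 a1 admK k.
set x := `|_ - _| in drop *; set y := `|_ - _| in drop *.
have x0 : 0 <= x := normr_ge0 _. have y0 : 0 <= y := normr_ge0 _.
have A0 := A_gt0; have A1 := tame_A H; have lr' := tame_lr H; have b0 := tame_b H.
have J1 : 1 <= 2 ^+ J :> R by rewrite exprn_ege1// ler1n.
have AJ : A <= 2 ^+ J * A by rewrite -{1}[A]mul1r ler_pM2r.
have oA : off k <= A.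
  apply: (le_trans (ltW (off_lt a0 a1 admK k))); apply: (tame_gap H).
  by have := kneadQ_ge k.+1; move: Kk; clear; lia.
have bo : b <= off k by apply: (tame_off H); exact: leq_trans (leq_addr _ _) Kk.
have h1 : b / lr / 2 * Lk k <= Lk k - Zk t.
  apply: (@le_trans _ _ (off k / lr / 2 * Lk k)); first by rewrite !ler_pM2r ?invr_gt0.
  rewrite -lnLZ//; apply: half_ln_le_sub; [by []|exact: ltW|].
  by rewrite lnLZ// ler_pdivrMr// mul1r -mulrA in lr' *; lra.
have hu : ln (Zk t) - ln (Zk s) <= i.+1%:R * A / lr.
  rewrite !lnZ// subNdiv ler_pM2r ?invr_gt0//.
  have -> : i.+1%:R = (s - t)%:R :> R by rewrite /s addKn.
  apply: height_sub; first exact: leq_addr.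
  by move=> j /andP[tj _]; apply: (tame_gap H); exact: leq_trans tj.
have u1 : i.+1%:R * A / lr <= 1 / 2.
  rewrite ler_pdivrMr//; have : i.+1%:R * A <= 2 ^+ J * A by rewrite ler_pM2r// -natrX ler_nat.
  by rewrite -mulrA in lr'; lra.
have h2 : Zk t - Zk s <= 2 * (i.+1%:R * A / lr) * Zk s.
  have hm : ln (Zk t) - ln (Zk s) <= 1 / 2 by exact: le_trans hu u1.
  apply: (le_trans (sub_le_2ln Zs (ltW ZZ) hm)); rewrite ler_pM2r// ler_pM2l//.
have c0 : 0 < Zk s * (b / lr / 2 * Lk k) by rewrite mulr_gt0// mulr_gt0// divr_gt0// divr_gt0.
rewrite -(ler_pM2r c0); apply: (@le_trans _ _ (x * (Zk s * (Lk k - Zk t)))).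
  by rewrite ler_wpM2l// ler_pM2l.
apply: (le_trans drop); apply: (@le_trans _ _ (Lk k * (2 * (i.+1%:R * A / lr) * Zk s) * y)).
  by rewrite ler_wpM2r// ler_pM2l.
rewrite le_eqVlt; apply/orP; left; apply/eqP; rewrite /D; field; rewrite !gt_eqF//.
Qed.

Let Rn := (2 ^ J)%N.
Let h : R := (24 * 2 ^+ J)^-1.
Definition drho : R := 1 - h.
(** The numerator is the gain in [abel_bound] when the harmonic weights add up to at least 6; the
    denominator pays for the four levels that a jump may lose. By the choice of [h],
    [rho^(2^J) >= 23 / 24], so the gain exceeds the loss of about [4 h]. *)
Definition dsigma : R := (1 - 6 * h * drho ^+ Rn) / drho ^+ 4.

Let h_gt0 : 0 < h. Proof. by rewrite invr_gt0 mulr_gt0// exprn_gt0. Qed.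
Let h_le : h <= 1 / 24.
Proof.
rewrite -[leRHS]invrK lef_pV2 ?posrE ?mulr_gt0 ?exprn_gt0//.
have : 1 <= 2 ^+ J :> R by rewrite exprn_ege1// ler1n.
lra.
Qed.

Lemma bernoulli_le (x : R) n : 0 <= x -> x <= 1 -> 1 - n%:R * x <= (1 - x) ^+ n.
Proof.
move=> x0 x1; elim: n => [|n IH]; first by rewrite mul0r subr0.
rewrite exprS; apply: (@le_trans _ _ ((1 - x) * (1 - n%:R * x))); last by rewrite ler_wpM2l//; lra.
rewrite -natr1; have : 0 <= n%:R * x * x by rewrite !mulr_ge0.
lra.
Qed.

Lemma drho_gt0 : 0 < drho. Proof. by have := h_le; rewrite /drho; lra. Qed.
Lemma drho_lt1 : drho < 1. Proof. by have := h_gt0; rewrite /drho; lra. Qed.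

Let rhoR : 23 / 24 <= drho ^+ Rn.
Proof.
have h1 := h_le; have h0 := h_gt0.
apply: le_trans (bernoulli_le Rn (ltW h0) _); last lra.
rewrite /Rn natrX /h invfM mulrCA divff; last by rewrite expf_neq0// pnatr_eq0.
lra.
Qed.
Let rhoR1 : drho ^+ Rn <= 1.
Proof. by apply: exprn_ile1; [exact: ltW drho_gt0|exact: ltW drho_lt1]. Qed.

Lemma dsigma_ge0 : 0 <= dsigma.
Proof.
have h1 := h_le; have h0 := h_gt0; have r := rhoR1.
rewrite divr_ge0 ?exprn_ge0//; last exact: ltW drho_gt0.
have : h * drho ^+ Rn <= h * 1 by rewrite ler_pM2l.
lra.
Qed.

Lemma dsigma_lt1 : dsigma < 1.
Proof.
have h1 := h_le; have h0 := h_gt0; have r := rhoR.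
rewrite ltr_pdivrMr ?exprn_gt0 ?drho_gt0// mul1r.
have : 1 - 4 * h <= drho ^+ 4 by apply: bernoulli_le; lra.
have : h * (23 / 24) <= h * drho ^+ Rn by rewrite ler_pM2l.
lra.
Qed.

(** One jump contracts [rho^level] in mean by the factor [sigma]: summation by parts expresses the
    mean through the measures of landing beyond given levels, which [mass_tame] bounds from
    below. *)
Lemma drift k N phi : (K + 5 <= k)%N -> smono phi 0 (Lk k) -> crcontr phi 0 (Lk k) ->
  \sum_((Q k.+1).+1 <= i < N) drho ^+ i * `|phi (Zk i) - phi (Zk i.+1)| <=
  dsigma * drho ^+ k.+1 * `|phi (Zk (Q k.+1).+1) - phi 0|.
Proof.
(* Freezing the index below [t] makes [M] nonincreasing everywhere, as [abel_bound] asks. *)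
move=> Kk mo cr; set t := (Q k.+1).+1; pose M i := `|phi (Zk (maxn t i)) - phi 0|.
have ZL := L_gtZ a0 a1 admK k; rewrite -/t in ZL.
have Z0 i : 0 < Zk i := Z_gt0 a0 a1 admK i.
have ZiL i : (t <= i)%N -> Zk i <= Lk k.
  by move=> ti; apply: (le_trans _ (ltW ZL)); exact: (Z_noninc a0 a1 admK).
have Md i : (t <= i)%N -> M i = `|phi (Zk i) - phi (Zk i.+1)| + M i.+1.
  move=> ti; rewrite /M (maxn_idPr ti) (maxn_idPr (leqW ti)).
  by apply: (smono_addn mo); rewrite ?lexx ?Z0 ?ZiL//; exact: (Z_ltS a0 a1 admK).
have MS i : M i.+1 <= M i.
  have [ti|it] := leqP t i; first by rewrite (Md i ti) lerDr.
  by rewrite /M (maxn_idPl (ltnW it)) (maxn_idPl it).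
have E : \sum_(t <= i < N) drho ^+ i * `|phi (Zk i) - phi (Zk i.+1)| =
    \sum_(t <= i < N) drho ^+ i * (M i - M i.+1).
  by apply: eq_big_nat => i /andP[ti _]; rewrite (Md i ti) addrK.
have r0 := drho_gt0; have r1 := drho_lt1.
have := abel_bound N (2 ^ J).-1 t (ltW r0) (ltW r1) (fun i => normr_ge0 _) MS.
rewrite -E prednK ?expn_gt0// => /le_trans; apply.
have Mt : M t = `|phi (Zk t) - phi 0| by rewrite /M maxnn.
rewrite -Mt; have Mt0 : 0 <= M t := normr_ge0 _.
have S6 : drho ^+ t * drho ^+ Rn * M t * 6 <= \sum_(1 <= i < 2 ^ J) drho ^+ (t + i).-1 * M (t + i)%N.
  apply: (@le_trans _ _ (\sum_(1 <= i < 2 ^ J) drho ^+ t * drho ^+ Rn * M t * (1 + i%:R * D)^-1)).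
    rewrite -mulr_sumr ler_wpM2l// ?mulr_ge0 ?exprn_ge0 ?(ltW r0)//.
    apply: le_trans (harmonic_ge J (ltW D_gt0)).
    rewrite ler_pdivlMr; first exact: (tame_J H).
    by rewrite ltr_wpDr// mulr_ge0// ltW// D_gt0.
  apply: ler_sum_nat => i /andP[i1 iJ]; rewrite -!mulrA mulrA; apply: ler_pM.
  - by rewrite mulr_ge0 ?exprn_ge0 ?(ltW r0).
  - by rewrite mulr_ge0// invr_ge0 addr_ge0// mulr_ge0 ?(ltW D_gt0).
  - rewrite -exprD; apply: ler_wiXn2l; [exact: ltW|exact: ltW|].
    by move: i1 iJ; rewrite -/Rn; clear; case: i => // i; lia.
  - by rewrite Mt /M (maxn_idPr (leq_addr _ _)) mass_tame// ltnW.
have h0 := h_gt0; have h1 := h_le.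
have -> : 1 - drho = h by rewrite /drho; ring.
apply: (@le_trans _ _ (drho ^+ t * M t - h * (drho ^+ t * drho ^+ Rn * M t * 6))).
  by rewrite lerB// ler_pM2l.
have -> : drho ^+ t * M t - h * (drho ^+ t * drho ^+ Rn * M t * 6) =
    drho ^+ t * (1 - 6 * h * drho ^+ Rn) * M t by ring.
rewrite ler_wpM2r//; apply: (@le_trans _ _ (drho ^+ (t + 4) * dsigma)).
  rewrite /dsigma exprD -[leRHS]mulrA [drho ^+ 4 * _]mulrC divfK//.
  by rewrite expf_neq0// gt_eqF.
rewrite mulrC ler_wpM2l ?dsigma_ge0//; apply: ler_wiXn2l; [exact: ltW|exact: ltW|].
by have := kneadQ_ge k.+1; rewrite /t; clear; lia.
Qed.

End Drift.

(** * The measure of the surviving points *)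

Section Leb.
Context {R : realType}.
Implicit Types (X Y : set R).

Local Notation leb := (@lebesgue_measure R).

(** Monotonicity, and countable subadditivity below, are those of the outer measure and hold for
    arbitrary sets. *)
Lemma leb_le X Y : X `<=` Y -> (leb X <= leb Y)%E.
Proof. by move=> XY; exact: (@le_mu_ext _ (ocitv_type R) R (wlength idfun) X Y XY). Qed.

Lemma leb_bigcup (F : nat -> set R) : (leb (\bigcup_n F n) <= \sum_(n <oo) leb (F n))%E.
Proof.
exact: (@mu_ext_sigma_subadditive _ (ocitv_type R) R (wlength idfun) (wlength_ge0 _)).
Qed.

Lemma leb0 : leb set0 = 0%E.
Proof. exact: measure0. Qed.

Lemma leb_setU X Y : (leb (X `|` Y) <= leb X + leb Y)%E.
Proof.
rewrite -bigcup2E; apply: (le_trans (leb_bigcup _)).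
rewrite (nneseries_split 0 2); last by move=> *; rewrite -leb0 leb_le.
rewrite eseries0 ?adde0; last by move=> [|[|i]] //= _ _; rewrite leb0.
by rewrite add0n big_nat_recl// big_nat1.
Qed.

Lemma leb_bigcup_nat (F : nat -> set R) (r : nat -> R) t N :
  (forall i, (t <= i < N)%N -> (leb (F i) <= (r i)%:E)%E) ->
  (leb [set x | exists2 i, (t <= i < N)%N & F i x] <= (\sum_(t <= i < N) r i)%:E)%E.
Proof.
elim: N => [|N IH] Fr.
  by rewrite big_geq// (_ : [set _ | _] = set0) ?leb0// -subset0 => x [i]; rewrite ltn0 andbF.
have [Nt|tN] := ltnP N t.
  rewrite big_geq// (_ : [set _ | _] = set0) ?leb0// -subset0 => x [i] /andP[ti iN].
  by have := leq_trans (leq_ltn_trans ti iN) Nt; rewrite ltnn.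
rewrite big_nat_recr//= EFinD.
apply: (@le_trans _ _ (leb ([set x | exists2 i, (t <= i < N)%N & F i x] `|` F N))).
  apply: leb_le => x [i] /andP[ti]; rewrite ltnS leq_eqVlt => /predU1P[->|iN] Fi; first by right.
  by left; exists i => //; rewrite ti.
apply: (le_trans (leb_setU _ _)); apply: leeD; last by apply: Fr; rewrite tN leqnn.
by apply: IH => i /andP[ti iN]; apply: Fr; rewrite ti ltnW.
Qed.

Lemma leb_itv_le X p q : (forall x, X x -> p <= x <= q) -> p <= q -> (leb X <= (q - p)%:E)%E.
Proof.
move=> Xpq pq; apply: (@le_trans _ _ (leb `[p, q]%classic)).
  by apply: leb_le => x /Xpq; rewrite /= in_itv.
rewrite lebesgue_measure_itv/= lte_fin; case: ifPn => // _; rewrite lee_fin subr_ge0//.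
Qed.

End Leb.

Section Measure.
Context {R : realType} (m : nat) (a A b : R) (K J : nat).
Hypothesis H : tame m a A b K J.
Implicit Types (phi : R -> R) (x y : R).

Local Notation l := (2 ^ m)%N.
Local Notation Q := kneadQ.
Local Notation gk := (gk m a).
Local Notation th := (th m a).
Local Notation Lk := (Lk m a).
Local Notation Zk := (Zk m a).
Local Notation Yk := (Yk m a).
Local Notation leb := (@lebesgue_measure R).

Let a0 := tame_a0 H.
Let a1 := tame_a1 H.
Let admK := tame_adm H.
Arguments admK : clear implicits.

Definition lev k : set R := [set x | Zk k.+1 < x <= Zk k].
(* [|f^(S_(k-1)) x|] *)
Definition jump k x := gk k.-1 (x ^+ l).

(* The points whose first [n] levels are at least [K0] and whose next level is at most
   [B].  Orbits which reach [0] have no level any more and are never [low]. *)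
Fixpoint low K0 n B : set R := if n is n'.+1
  then [set x | exists k, [/\ (K0 <= k)%N, lev k x & low K0 n' B (jump k x)]]
  else [set x | exists2 k, (k <= B)%N & lev k x].

Lemma lev_lt i j x : lev i x -> x < Zk j -> (j <= i)%N.
Proof.
move=> /andP[ix _] xj; rewrite leqNgt; apply/negP => ij.
by have := Z_noninc a0 a1 admK ij; lra.
Qed.

Lemma lev_inj i j x : lev i x -> lev j x -> i = j.
Proof.
move=> ix jx; apply/eqP; rewrite eqn_leq; apply/andP; split.
  rewrite leqNgt; apply/negP => ji; have := Z_noninc a0 a1 admK ji.
  by move: ix jx => /andP[? ?] /andP[? ?]; lra.
rewrite leqNgt; apply/negP => ji; have := Z_noninc a0 a1 admK ji.
by move: ix jx => /andP[? ?] /andP[? ?]; lra.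
Qed.

Lemma Zk_exp k : Zk k ^+ l = Yk k.
Proof. by rewrite /Branch.Zk rt_exp// ltW// (Y_gt0 a0 a1 admK). Qed.

Lemma jump_lev k x : lev k.+1 x -> 0 <= jump k.+1 x < Zk (Q k.+1).+1.
Proof.
move=> /andP[xl xu]; have Z2 := Z_gt0 a0 a1 admK k.+2.
have xl' : Yk k.+2 < x ^+ l by rewrite -Zk_exp ltrXn2r ?nnegrE ?expn_eq0//; lra.
have xu' : x ^+ l <= Yk k.+1 by rewrite -Zk_exp lerXn2r ?nnegrE//; lra.
have lo := lok a0 a1 admK k; have Y2 := Y_gt0 a0 a1 admK k.+2.
have YY := Y_ltS a0 a1 admK k.
have M0 := M_gt0 a0 a1 admK k.
apply/andP; split; rewrite /jump /=.
  rewrite -(gk_YkS a0 a1 lo (ltW M0)); have := xu'; rewrite le_eqVlt => /predU1P[->//|xlt].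
  by apply/ltW/(gk_lt a0 a1 lo) => //; [rewrite ltW// (lt_trans Y2)|exact: ltW].
have Lz := L_gtZ a0 a1 admK k; have LX := LX a0 a1 admK k; have Z0 := Z_gt0 a0 a1 admK (Q k.+1).+1.
rewrite -(gk_th a0 a1 admK (k := k) (w := Zk (Q k.+1).+1)); last by apply/andP; split; lra.
rewrite (thZ m a k); apply: (gk_lt a0 a1 lo) => //; first exact: ltW.
exact: le_trans xu' (ltW YY).
Qed.

Lemma jumpK k x : lev k.+1 x -> rt m (th k (jump k.+1 x)) = x.
Proof.
move=> /andP[xl xu]; have Z2 := Z_gt0 a0 a1 admK k.+2.
rewrite /jump /= (th_gk a0 a1 admK) ?exp_rt//; first by lra.
rewrite exprn_ge0/=; last lra.
by apply: le_trans (ltW (Y_ltS a0 a1 admK k)); rewrite -Zk_exp lerXn2r ?nnegrE//; lra.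
Qed.

Lemma low_lev K0 n B x : low K0 n B x -> exists i, lev i x.
Proof. by case: n => [|n] /= [k]; [move=> _ kx|case=> _ kx _]; exists k. Qed.

(* A jump loses at most four levels, so only finitely many levels matter and finite
   subadditivity suffices in [low_measure]. *)
Lemma low_ub K0 n B i x : (0 < K0)%N -> lev i x -> low K0 n B x -> (i <= B + 4 * n)%N.
Proof.
move=> K00; elim: n i x => [|n IH] i x ix /=.
  by move=> [k kB kx]; rewrite (lev_inj ix kx) muln0 addn0.
move=> [k [Kk kx lo]]; rewrite -(lev_inj kx ix) => {i ix}.
have [i ix] := low_lev lo; have := IH _ _ ix lo.
case: k kx Kk lo ix => [|k] kx Kk lo ix; first by rewrite leqn0 in Kk; rewrite (eqP Kk) in K00.
have /andP[_ jl] := jump_lev kx; have := lev_lt ix jl; have := kneadQ_ge k.+1.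
by clear; lia.
Qed.

Lemma th_dom k x : 0 <= x <= Lk k -> 0 <= th k x <= Yk k.+1.
Proof.
have M0 := M_gt0 a0 a1 admK k; have LX' := LX a0 a1 admK k.
move=> /andP[x0 xL]; apply/andP; split.
  rewrite -(thL a0 a1 admK k); move: xL; rewrite le_eqVlt => /predU1P[->//|xL].
  by apply/ltW/(th_dec a0 a1 admK) => //; lra.
rewrite -(th0E m a k); move: x0; rewrite le_eqVlt => /predU1P[<-//|x0].
by apply/ltW/(th_dec a0 a1 admK) => //; lra.
Qed.

Lemma branch_dom k x : 0 <= x <= Lk k -> 0 <= (rt m \o th k) x <= Zk k.+1.
Proof. by move=> /th_dom/andP[t0 tY]; rewrite /= rt_ge0//= rt_ler. Qed.

Let th_smono k : smono (th k) 0 (Lk k).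
Proof.
have M0 := M_gt0 a0 a1 admK k; have LX' := LX a0 a1 admK k.
by right => x y x0 xy yL; apply: (th_dec a0 a1 admK) => //; lra.
Qed.

Lemma branch_smono k : smono (rt m \o th k) 0 (Lk k).
Proof.
apply: (smono_comp (@th_smono k) (@th_dom k)).
by left => x y x0 xy _; exact: rt_ltr.
Qed.

Lemma branch_crcontr k : crcontr (rt m \o th k) 0 (Lk k).
Proof.
have M0 := M_gt0 a0 a1 admK k; have LX' := LX a0 a1 admK k.
have cth : crcontr (th k) 0 (Lk k).
  by apply: (crcontrW _ _ (@th_cr _ _ _ a0 a1 admK k)) => //; lra.
exact: (crcontr_comp (@th_smono k) (@cth) (@th_dom k) (@rt_crcontr _ _ _)).
Qed.

(** A Markov inequality for the weight [rho^level]. With no jump left, [rho^(j - B) >= 1] when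
    [j <= B]. Otherwise the first jump is absorbed into [phi] by composing with [rt \o th k], and
    [drift] sums the bounds over the landing levels. *)
Lemma low_measure K0 n B j phi : (K + 6 <= K0)%N -> smono phi 0 (Zk j) -> crcontr phi 0 (Zk j) ->
  (leb (phi @` (lev j `&` low K0 n B)) <=
   (drho J ^- B * dsigma J ^+ n * drho J ^+ j * `|phi (Zk j) - phi (Zk j.+1)|)%:E)%E.
Proof.
move=> KK; have r0 := @drho_gt0 R J; have r1 := @drho_lt1 R J; have s0 := @dsigma_ge0 R J.
have K00 : (0 < K0)%N by apply: leq_trans KK; rewrite addnS.
elim: n j phi => [|n IH] j phi mo cr.
  have ZZ := Z_ltS a0 a1 admK j; have Z1 := Z_gt0 a0 a1 admK j.+1.
  have [jB|Bj] := leqP j B; last first.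
    rewrite (_ : _ @` _ = set0) ?leb0 ?lee_fin ?mulr_ge0 ?invr_ge0 ?exprn_ge0 ?(ltW r0)//.
    rewrite -subset0 => y [x [jx [k kB kx]] _].
    by move: Bj; rewrite (lev_inj jx kx) ltnNge kB.
  apply: (@le_trans _ _ `|phi (Zk j) - phi (Zk j.+1)|%:E); last first.
    rewrite lee_fin expr0 mulr1 -[leLHS]mul1r ler_wpM2r// mulrC ler_pdivlMr ?exprn_gt0// mul1r.
    by apply: ler_wiXn2l => //; exact: ltW.
  case: mo => mo.
    have lt := mo _ _ (ltW Z1) ZZ (lexx _); rewrite gtr0_norm ?subr_gt0//.
    apply: leb_itv_le; last exact: ltW.
    move=> _ [x [/andP[x1 x2] _] <-]; apply/andP; split; first by apply/ltW/mo => //; exact: ltW.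
    by move: x2; rewrite le_eqVlt => /predU1P[->//|x2]; apply/ltW/mo => //; lra.
  have lt := mo _ _ (ltW Z1) ZZ (lexx _); rewrite ltr0_norm ?subr_lt0// opprB.
  apply: leb_itv_le; last exact: ltW.
  move=> _ [x [/andP[x1 x2] _] <-]; apply/andP; split; last by apply/ltW/mo => //; exact: ltW.
  by move: x2; rewrite le_eqVlt => /predU1P[->//|x2]; apply/ltW/mo => //; lra.
have [Kj|jK] := leqP K0 j; last first.
  rewrite (_ : _ @` _ = set0) ?leb0 ?lee_fin ?mulr_ge0 ?invr_ge0 ?exprn_ge0 ?(ltW r0)//.
  rewrite -subset0 => y [x [jx [k [kB kx _]]] _].
  by move: jK; rewrite (lev_inj jx kx) ltnNge kB.
case: j mo cr Kj => [|k] mo cr Kj; first by move: Kj; rewrite leqn0 => /eqP K0E; rewrite K0E in K00.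
pose psi := phi \o (rt m \o th k).
have rth := @branch_smono k; have crth := @branch_crcontr k; have rdom := @branch_dom k.
have mpsi : smono psi 0 (Lk k) by exact: (smono_comp rth rdom mo).
have cpsi : crcontr psi 0 (Lk k) by exact: (crcontr_comp rth (@crth) rdom (@cr)).
pose t := (Q k.+1).+1; pose N := (B + 4 * n).+1.
have ZtL i : (t <= i)%N -> Zk i <= Lk k.
  by move=> ti; apply: (le_trans _ (ltW (L_gtZ a0 a1 admK k))); exact: (Z_noninc a0 a1 admK).
apply: (@le_trans _ _ (leb [set y | exists2 i, (t <= i < N)%N &
    (psi @` (lev i `&` low K0 n B)) y])).
  apply: leb_le => _ [x [kx [k' [_ kx' lo]]] <-]; rewrite -(lev_inj kx kx') in lo.
  have [i ix] := low_lev lo; have /andP[_ jl] := jump_lev kx.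
  exists i; last by exists (jump k.+1 x) => //; rewrite /psi /= jumpK.
  by rewrite (lev_lt ix jl)/= /N ltnS (low_ub K00 ix lo).
apply: (@le_trans _ _ (\sum_(t <= i < N) (drho J ^- B * dsigma J ^+ n * drho J ^+ i *
    `|psi (Zk i) - psi (Zk i.+1)|))%:E).
  apply: leb_bigcup_nat => i /andP[ti _]; apply: IH.
    by apply: (smonoW _ _ mpsi) => //; exact: ZtL.
  by apply: (crcontrW _ _ cpsi) => //; exact: ZtL.
have Kk : (K + 5 <= k)%N by move: KK Kj; clear; lia.
have := drift H N Kk mpsi cpsi; rewrite -/t => dr.
rewrite lee_fin; under eq_bigr do rewrite -mulrA.
rewrite -mulr_sumr; apply: (@le_trans _ _ (drho J ^- B * dsigma J ^+ n *
    (dsigma J * drho J ^+ k.+1 * `|psi (Zk t) - psi 0|))).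
  by rewrite ler_wpM2l// mulr_ge0 ?invr_ge0 ?exprn_ge0// ltW.
have -> : psi (Zk t) = phi (Zk k.+2) by rewrite /psi /t /= thZ.
have -> : psi 0 = phi (Zk k.+1) by rewrite /psi /= th0E.
rewrite distrC [dsigma J ^+ n.+1]exprS le_eqVlt; apply/orP; left; apply/eqP; ring.
Qed.

End Measure.

Lemma exprn_small {R : realType} (x e : R) : 0 <= x -> x < 1 -> 0 < e -> exists n, x ^+ n < e.
Proof.
move=> x0 x1 e0; have xn : x ^+ n @[n --> \oo] --> (0 : R).
  by apply: cvg_expr; rewrite ger0_norm.
have [n _ /(_ n (leqnn n))] := cvgr_lt _ xn _ e0.
by exists n.
Qed.

Section Survive.
Context {R : realType} (m : nat) (a A b : R) (K J : nat).
Hypothesis H : tame m a A b K J.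
Implicit Types (phi : R -> R) (x y : R).

Local Notation l := (2 ^ m)%N.
Local Notation Q := kneadQ.
Local Notation gk := (gk m a).
Local Notation th := (th m a).
Local Notation Lk := (Lk m a).
Local Notation Zk := (Zk m a).
Local Notation Yk := (Yk m a).
Local Notation leb := (@lebesgue_measure R).

Let a0 := tame_a0 H.
Let a1 := tame_a1 H.
Let admK := tame_adm H.
Arguments admK : clear implicits.

(* The thresholds [kappa n] grow so slowly that the measures of the bad sets, at most
   [rho^(- kappa n) sigma^n], still form a convergent series. *)
Lemma survive : exists K0 k0 (kappa : nat -> nat),
  [/\ (0 < K0)%N, forall B, exists N, forall n, (N <= n)%N -> (B <= kappa n)%N,
    forall n, (K0 <= kappa n)%N &
    (0 < leb ((fun x => (1 + x) / 2)%R @`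
      [set x | lev m a k0 x /\ forall n, ~ low m a K0 n (kappa n) x]))%E].
Proof.
set rho := @drho R J; set sigma := @dsigma R J; set phi := fun x : R => (1 + x) / 2.
have r0 : 0 < rho := @drho_gt0 R J; have r1 : rho < 1 := @drho_lt1 R J.
have s0 : 0 <= sigma := @dsigma_ge0 R J; have s1 : sigma < 1 := @dsigma_lt1 R J.
(* Of [sigma^n = s^n s^n], one factor pays for [rho^-(n / p)], since [s^p <= rho], and the other one
   is summed. *)
pose s := Num.sqrt sigma; have ss : s * s = sigma by rewrite -expr2 sqr_sqrtr.
have ps0 : 0 <= s by apply: sqrtr_ge0.
have ps1 : s < 1 by rewrite -sqrtr1 ltr_sqrt.
have [p' sp'] := exprn_small ps0 ps1 r0.
have {p' sp'}[p p0 sp] : exists2 p, (0 < p)%N & s ^+ p <= rho.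
  exists p'.+1 => //; apply: le_trans (ltW sp'); rewrite exprS -[leRHS]mul1r.
  by rewrite ler_wpM2r ?exprn_ge0// ltW.
pose K0 := (K + 6)%N; pose kappa n := (K0 + n %/ p)%N.
have e0 : 0 < (1 - s) / 2 by rewrite divr_gt0// subr_gt0.
(* Starting [d] levels above [K0] gains [rho^d], and the bad sets then cover at most half of the
   starting level. *)
have [d rd] := exprn_small (ltW r0) r1 e0.
pose k0 := (K0 + d)%N.
have mo q : smono phi 0 q by left => x y _ xy _; rewrite /phi; lra.
have cr q : crcontr phi 0 q.
  have -> : phi = (fun x => 1 / 2 * x + 1 / 2) by apply/funext => x; rewrite /phi; field.
  by apply: crcontr_affine; rewrite gt_eqF.
pose E n := phi @` (lev m a k0 `&` low m a K0 n (kappa n)).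
pose G := phi @` [set x | lev m a k0 x /\ forall n, ~ low m a K0 n (kappa n) x].
pose de := phi (Zk k0) - phi (Zk k0.+1).
have ZZ := Z_ltS a0 a1 admK k0.
have de0 : 0 < de by rewrite /de /phi; lra.
have En n : (leb (E n) <= (rho ^+ d * de * s ^+ n)%:E)%E.
  apply: (le_trans (low_measure H n (kappa n) (leqnn _) (@mo _) (@cr _))); rewrite lee_fin -/rho -/sigma.
  rewrite gtr0_norm// -/de /kappa /k0 !exprD -ss exprMn.
  have sn : s ^+ n <= rho ^+ (n %/ p).
    rewrite {1}(divn_eq n p) exprD; apply: (@le_trans _ _ (s ^+ (n %/ p * p) * 1)).
      by rewrite ler_wpM2l ?exprn_ge0// exprn_ile1// ltW.
    by rewrite mulr1 mulnC exprM lerXn2r// nnegrE ?exprn_ge0// ltW.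
  rewrite [leLHS](_ : _ = (rho ^+ d * de * s ^+ n) * (s ^+ n / rho ^+ (n %/ p))); last first.
    by field; rewrite !expf_neq0// gt_eqF.
  rewrite -[leRHS]mulr1 ler_wpM2l ?mulr_ge0 ?exprn_ge0 ?(ltW de0) ?(ltW r0)//.
  by rewrite ler_pdivrMr ?exprn_gt0// mul1r.
have bad : (leb (\bigcup_n E n) <= (de / 2)%:E)%E.
  apply: (le_trans (leb_bigcup _)); apply: (@le_trans _ _ (\sum_(n <oo) (rho ^+ d * de * s ^+ n)%:E)%E).
    by apply: lee_nneseries => // n _; rewrite -(@leb0 R) leb_le.
  have gs : series (geometric (rho ^+ d * de) s) @ \oo --> rho ^+ d * de * (1 - s)^-1.
    by apply: cvg_geometric_series; rewrite ger0_norm.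
  rewrite (_ : (\sum_(n <oo) _)%E = (rho ^+ d * de * (1 - s)^-1)%:E); last first.
    apply: cvg_lim => //; under eq_fun do rewrite sumEFin.
    by apply: cvg_EFin; [exact: nearW|exact: gs].
  rewrite lee_fin ler_pdivrMr ?subr_gt0//.
  have : rho ^+ d * de <= (1 - s) / 2 * de by rewrite ler_pM2r// ltW.
  lra.
have tot : (de%:E <= leb G + leb (\bigcup_n E n))%E.
  apply: le_trans (leb_setU _ _).
  apply: (@le_trans _ _ (leb `]phi (Zk k0.+1), phi (Zk k0)]%classic)).
    by rewrite lebesgue_measure_itv/= lte_fin -subr_gt0 -/de de0.
  apply: leb_le => y; rewrite /= in_itv/= => /andP[y1 y2].
  have ly : lev m a k0 (2 * y - 1) by rewrite /lev /=; move: y1 y2; rewrite /phi => y1 y2; apply/andP; split; lra.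
  have phy : phi (2 * y - 1) = y by rewrite /phi; field.
  have [[n ln]|nl] := pselect (exists n, low m a K0 n (kappa n) (2 * y - 1)).
    by right; exists n => //; exists (2 * y - 1).
  by left; exists (2 * y - 1) => //; split => // n ln; apply: nl; exists n.
exists K0, k0, kappa; split.
- by rewrite /K0 addnS.
- move=> B; exists (B * p)%N => n Bn; rewrite /kappa (leq_trans _ (leq_addl _ _))//.
  by rewrite leq_divRL.
- by move=> n; rewrite leq_addr.
rewrite -/phi -/G ltNge; apply/negP => G0.
have : (de%:E <= 0 + (de / 2)%:E)%E by apply: (le_trans tot); exact: leeD.
by rewrite add0e lee_fin; lra.
Qed.

End Survive.

(** * Itineraries *)

Module Orbit.

Section Dynamics.
Context {R : realType} (m : nat) (a A b : R) (K J : nat).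
Hypothesis H : tame m a A b K J.
Implicit Types (x y : R).

Local Notation l := (2 ^ m)%N.
Local Notation lr := ((2 ^ m)%:R : R).
Local Notation Q := kneadQ.
Local Notation S := cuttime.
Local Notation gk := (gk m a).
Local Notation th := (th m a).
Local Notation Lk := (Lk m a).
Local Notation Mk := (Mk m a).
Local Notation Zk := (Zk m a).
Local Notation Yk := (Yk m a).

Let a0 := tame_a0 H.
Let a1 := tame_a1 H.
Let admK := tame_adm H.
Arguments admK : clear implicits.

Definition pmap x := a - (1 + a) * x ^+ l.
Local Notation f := pmap.

Let l_gt0 : (0 < l)%N. Proof. by rewrite expn_gt0. Qed.

Lemma even_exp x : (- x) ^+ l = x ^+ l.
Proof. by have := tame_l H; case: m => // n _; rewrite expnS !exprM sqrrN. Qed.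

Lemma abs_exp x : `|x| ^+ l = x ^+ l.
Proof. by have [//|_] := ger0P x; rewrite even_exp. Qed.

Lemma pmap_abs x : f `|x| = f x. Proof. by rewrite /pmap abs_exp. Qed.

Lemma pmap_abs_iter i x : (0 < i)%N -> iter i f `|x| = iter i f x.
Proof. by case: i => // i _; rewrite !iterSr pmap_abs. Qed.

Lemma pmap_range x : -1 <= x <= 1 -> -1 <= f x <= 1.
Proof.
move=> x1; have x1' : `|x| <= 1 by rewrite ler_norml.
have : 0 <= `|x| ^+ l <= 1 by rewrite exprn_ge0//= exprn_ile1.
rewrite abs_exp /pmap => /andP[u0 u1]; have a0' := a0; have a1' := a1.
have : 0 <= (1 + a) * x ^+ l by rewrite mulr_ge0//; lra.
have : (1 + a) * x ^+ l <= (1 + a) * 1 by rewrite ler_wpM2l//; lra.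
lra.
Qed.

Lemma pmap_iter_range i x : -1 <= x <= 1 -> -1 <= iter i f x <= 1.
Proof. by move=> x1; elim: i => //= i IH; exact: pmap_range. Qed.

Definition tau : nat -> R := kneadrec 1 (fun _ u => - u).

Lemma tauS k : tau k.+1 = - tau (Q k.+1).
Proof. by rewrite /tau kneadrecS. Qed.

Lemma tau_exp k : tau k = (-1) ^+ kneadneg (S k).
Proof.
elim/ltn_ind: k => -[_|k IH]; first by rewrite /tau /kneadrec.
by rewrite tauS IH ?ltnS ?kneadQ_leS// kneadneg_cutS signrN.
Qed.

Lemma tau_sq k : tau k ^+ l = 1.
Proof. by rewrite tau_exp; case: kneadneg; rewrite ?expr1 ?even_exp expr1n. Qed.

Lemma norm_tau k : `|tau k| = 1.
Proof. by rewrite tau_exp normr_sign. Qed.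

Lemma pmap_cut k x : iter (S k) f x = tau k * gk k (x ^+ l).
Proof.
elim/ltn_ind: k x => -[_|k IH] x; first by rewrite /tau /kneadrec mul1r gk0.
rewrite cuttimeS addnC iterD (IH k)// (IH (Q k.+1)) ?ltnS ?kneadQ_leS// exprMn tau_sq mul1r.
by rewrite tauS gkS mulrNN.
Qed.

Lemma gk_pos k x : 0 <= x -> x < Yk k.+1 -> 0 < gk k x.
Proof.
move=> x0 xY; have lo := lok a0 a1 admK k; rewrite -(gk_YkS a0 a1 lo (ltW (M_gt0 a0 a1 admK k))).
by apply: (gk_lt a0 a1 lo) => //; exact/ltW/(Y_ltS a0 a1 admK).
Qed.

Lemma gk_neg k x : Yk k.+1 < x -> x <= Yk k -> gk k x < 0.
Proof.
move=> x0 xY; have lo := lok a0 a1 admK k; rewrite -(gk_YkS a0 a1 lo (ltW (M_gt0 a0 a1 admK k))).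
by apply: (gk_lt a0 a1 lo) => //; exact/ltW/(Y_gt0 a0 a1 admK).
Qed.

Lemma gk_leL k x : 0 <= x <= Yk k -> gk k x <= Lk k.
Proof. by move=> /(gk_bounds a0 a1 admK)/andP[]. Qed.

Lemma exp_ltY k x : `|x| < Zk k -> x ^+ l < Yk k.
Proof.
by move=> xZ; rewrite -abs_exp -(Zk_exp H) ltrXn2r ?nnegrE ?gt_eqF// ltW// (Z_gt0 a0 a1 admK).
Qed.

Lemma exp_leY k x : `|x| <= Zk k -> x ^+ l <= Yk k.
Proof.
by move=> xZ; rewrite -abs_exp -(Zk_exp H) lerXn2r ?nnegrE// ltW// (Z_gt0 a0 a1 admK).
Qed.

Lemma exp_gtY k x : Zk k < `|x| -> Yk k < x ^+ l.
Proof.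
by move=> xZ; rewrite -abs_exp -(Zk_exp H) ltrXn2r ?nnegrE ?gt_eqF// ltW// (Z_gt0 a0 a1 admK).
Qed.

Lemma exp_ge0 x : 0 <= x ^+ l.
Proof. by rewrite -abs_exp exprn_ge0. Qed.

(** For the step to level [k + 1]: before [S_k] level [k] decides, and at [S_k] the sign of [gk k]
    does. After that the orbit has returned below [L_k < Z_(Q (k+1))] and repeats the pattern of
    level [Q (k+1)], as [kneadneg_cut] prescribes. *)
Lemma pmap_sign k j x : `|x| < Zk k -> (0 < j < S k)%N ->
  0 < (-1) ^+ kneadneg j * iter j f x.
Proof.
elim/ltn_ind: k j x => -[_|k IH] j x xZ /andP[j0]; first by rewrite ltnNge j0.
rewrite cuttimeS => jS; have xZk : `|x| < Zk k by rewrite (lt_trans xZ)// (Z_ltS a0 a1 admK).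
have [jk|] := ltnP j (S k); first by apply: (IH k) => //; rewrite j0.
rewrite leq_eqVlt => /predU1P[<-|kj].
  by rewrite pmap_cut tau_exp mulrA -signr_addb addbb mul1r gk_pos ?exp_ge0// exp_ltY.
have -> : j = (S k + (j - S k))%N by rewrite subnKC// ltnW.
have j1 : (0 < j - S k < S (Q k.+1))%N by move: (S k) (S (Q k.+1)) kj jS; clear; lia.
rewrite kneadneg_cut// addnC iterD; apply: (IH (Q k.+1)) => //; first by rewrite ltnS kneadQ_leS.
rewrite pmap_cut normrM norm_tau mul1r gtr0_norm ?gk_pos ?exp_ge0 ?exp_ltY//.
apply: (le_lt_trans (gk_leL _) (L_ltZ a0 a1 admK k)).
by rewrite exp_ge0/= exp_leY// ltW.
Qed.

Definition crit t : R := iter t f 0.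

Lemma crit_sign t : (0 < t)%N -> 0 < (-1) ^+ kneadneg t * crit t.
Proof.
move=> t0; apply: (@pmap_sign t); last by rewrite t0 cuttime_gtk.
by rewrite normr0 (Z_gt0 a0 a1 admK).
Qed.

Lemma crit_neq0 t : (0 < t)%N -> crit t != 0.
Proof. by move=> /crit_sign; apply: contraTN => /eqP->; rewrite mulr0 ltxx. Qed.

(** [off k] is less than the gap at [Q (k+1)], so every block of five levels contains a gap larger
    than [e]. *)
Lemma height_ge e n : (forall k, e <= off m a k) -> n%:R * e <= height m a (5 * n).
Proof.
move=> oe; elim: n => [|n IH]; first by rewrite mul0r muln0 height0.
have k1 := kneadQ_leS (5 * n + 4); have k2 := kneadQ_ge (5 * n + 4).+1.
have := oe (5 * n + 4)%N; have := off_lt a0 a1 admK (5 * n + 4); rewrite /gap.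
have hm := height_mono a0 a1 admK.
have : height m a (Q (5 * n + 4).+1).+1 <= height m a (5 * n.+1) by apply: hm; move: k1; clear; lia.
have : height m a (5 * n) <= height m a (Q (5 * n + 4).+1) by apply: hm; move: k2; clear; lia.
by rewrite -natr1 mulrDl mul1r; lra.
Qed.

Lemma Z_small e : 0 < e -> exists k, Zk k < e.
Proof.
move=> e0; have [B [w [B1 Bl w0 _ ow]]] := tame_unif H.
have l0 : 0 < lr by apply: lr_gt0.
have [n nB] : exists n : nat, - ln e * lr / w < n%:R.
  exists (Num.bound `|- ln e * lr / w|).
  exact: le_lt_trans (ler_norm _) (archi_boundP (normr_ge0 _)).
exists (5 * n)%N; have Z0 := Z_gt0 a0 a1 admK (5 * n).
rewrite -ltr_ln ?posrE// (lnZ a0 a1 admK) mulNr ltrNl ltr_pdivlMr//.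
apply: lt_le_trans (height_ge n ow); by rewrite -ltr_pdivrMr.
Qed.

End Dynamics.

End Orbit.
Import Orbit.

(** * Absence of homtervals *)

Section NoHomterval.
Context {R : realType} (m : nat) (a A b : R) (K J : nat).
Hypothesis H : tame m a A b K J.
Implicit Types (x y : R).

Local Notation l := (2 ^ m)%N.
Local Notation lr := ((2 ^ m)%:R : R).
Local Notation Q := kneadQ.
Local Notation S := cuttime.
Local Notation gk := (gk m a).
Local Notation th := (th m a).
Local Notation Lk := (Lk m a).
Local Notation Mk := (Mk m a).
Local Notation Zk := (Zk m a).
Local Notation Yk := (Yk m a).

Let a0 := tame_a0 H.
Let a1 := tame_a1 H.
Let admK := tame_adm H.
Arguments admK : clear implicits.

Local Notation f := (pmap m a).

(** Equal itineraries, with 0 counted on both sides; as a product, the condition is closed under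
    limits. *)
Definition homt x y := forall i, 0 <= iter i f x * iter i f y.

Lemma homt_iter j x y : homt x y -> homt (iter j f x) (iter j f y).
Proof. by move=> h i; rewrite -!iterD. Qed.

Lemma homt_sym x y : homt x y -> homt y x.
Proof. by move=> h i; rewrite mulrC. Qed.

Lemma homt_abs x y : homt x y -> homt `|x| `|y|.
Proof.
move=> h [|i]; first by rewrite mulr_ge0/=.
by rewrite !(pmap_abs_iter H)//; exact: h.
Qed.

Lemma homt_abs_eq x y : homt x y -> `|x| = `|y| -> x = y.
Proof.
move=> /(_ 0%N)/= xy /eqP; rewrite eqr_norm2 => /orP[/eqP//|/eqP xE].
move: xy; rewrite xE mulNr oppr_ge0 -expr2 => y2.
have /eqP : y ^+ 2 = 0 by apply/eqP; rewrite eq_le y2 sqr_ge0.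
by rewrite sqrf_eq0 => /eqP->; rewrite oppr0.
Qed.

Lemma lev_exists x : 0 < x -> x <= 1 -> exists k, lev m a k x.
Proof.
move=> x0 x1; have [k0 k0x] := Z_small H x0.
have ex : exists k, Zk k < x by exists k0.
case: (ex_minnP ex) => -[|k] kx kmin; first by move: kx; rewrite Zk0 ltNge x1.
by exists k; rewrite /lev /= kx leNgt; apply/negP => /kmin; rewrite ltnn.
Qed.

(** Points below [Z_(k+1)] and points of level [k] are on opposite sides at time [S_k]. *)
Lemma homt_lev k x y : lev m a k y -> 0 <= x -> x < y -> homt x y -> Zk k.+1 <= x.
Proof.
move=> /andP[yl yu] x0 xy h; rewrite leNgt; apply/negP => xZ.
have := h (S k); rewrite !(pmap_cut H) mulrACA -expr2 tau_exp sqrr_sign mul1r.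
have g1 : 0 < gk k (x ^+ l).
  by apply: (gk_pos H); [exact: (exp_ge0 H)|apply: (exp_ltY H); rewrite ger0_norm//; exact: xZ].
have g2 : gk k (y ^+ l) < 0.
  apply: (gk_neg H); first by apply: (exp_gtY H); rewrite gtr0_norm//; lra.
  by apply: (exp_leY H); rewrite gtr0_norm//; lra.
by rewrite pmulr_rge0// leNgt g2.
Qed.

(** Seen through any branch, a single level is at most [kap] times as long as what lies below it, by
    [mass_drop] with the bounds valid on all levels. It therefore takes up a fraction
    [kap / (1 + kap)] at most. *)
Lemma level_contr : exists2 theta : R, 0 <= theta < 1 & forall k phi i,
  smono phi 0 (Lk k) -> crcontr phi 0 (Lk k) -> ((Q k.+1).+1 <= i)%N ->
  `|phi (Zk i) - phi (Zk i.+1)| <= theta * `|phi (Zk (Q k.+1).+1) - phi 0|.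
Proof.
have [B [e [B1 Bl e0 gB oe]]] := tame_unif H.
have l0 : 0 < lr by apply: lr_gt0.
pose kap := 4 * B / e; have kap0 : 0 < kap by rewrite divr_gt0// mulr_gt0//; lra.
exists (kap / (1 + kap)).
  have kap1 : 0 < 1 + kap by lra.
  by rewrite divr_ge0 ?ltW//= ltr_pdivrMr// mul1r; lra.
move=> k phi i mo cr ti; set t := (Q k.+1).+1 in ti *.
have Z0 := Z_gt0 a0 a1 admK i.+1; have ZZ := Z_ltS a0 a1 admK i.
have ZL := L_gtZ a0 a1 admK k; rewrite -/t in ZL.
have Zit := Z_noninc a0 a1 admK ti.
have L0 := L_gt0 a0 a1 admK k.
have oB : off m a k <= B by apply: (le_trans (ltW (off_lt a0 a1 admK k))).
have drop := mass_drop mo cr Z0 ZZ (le_lt_trans Zit ZL).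
have add1 := smono_addn mo (lexx 0) Z0 ZZ (ltW (le_lt_trans Zit ZL)).
have T : `|phi (Zk i) - phi 0| <= `|phi (Zk t) - phi 0|.
  move: Zit; rewrite le_eqVlt => /predU1P[->//|Zit].
  by rewrite (smono_addn mo (lexx 0) (lt_trans Z0 ZZ) Zit (ltW ZL)) lerDr.
set x := `|phi (Zk i) - phi (Zk i.+1)| in drop add1 *; set y := `|_ - phi 0| in drop add1.
have x0 : 0 <= x := normr_ge0 _. have y0 : 0 <= y := normr_ge0 _.
have h1 : e / lr / 2 * Lk k <= Lk k - Zk i.
  apply: (@le_trans _ _ (Lk k - Zk t)); last by rewrite lerB.
  apply: (@le_trans _ _ (off m a k / lr / 2 * Lk k)).
    by rewrite !ler_pM2r ?invr_gt0.
  rewrite -(lnLZ a0 a1 admK); apply: half_ln_le_sub; [exact: (Z_gt0 a0 a1 admK _)|exact: (ltW ZL)|].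
  by rewrite (lnLZ a0 a1 admK) ler_pdivrMr// mul1r; lra.
have hu : ln (Zk i) - ln (Zk i.+1) <= B / lr.
  by rewrite !(lnZ a0 a1 admK) subNdiv ler_pM2r ?invr_gt0//; exact: gB.
have u1 : B / lr <= 1 / 2 by rewrite ler_pdivrMr//; lra.
have h2 : Zk i - Zk i.+1 <= 2 * (B / lr) * Zk i.+1.
  apply: (le_trans (sub_le_2ln Z0 (ltW ZZ) (le_trans hu u1))); rewrite ler_pM2r// ler_pM2l//.
have xy : x <= kap * y.
  have c0 : 0 < Zk i.+1 * (e / lr / 2 * Lk k) by rewrite mulr_gt0// mulr_gt0// divr_gt0// divr_gt0.
  rewrite -(ler_pM2r c0); apply: (@le_trans _ _ (x * (Zk i.+1 * (Lk k - Zk i)))).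
    by rewrite ler_wpM2l// ler_pM2l.
  apply: (le_trans drop); apply: (@le_trans _ _ (Lk k * (2 * (B / lr) * Zk i.+1) * y)).
    by rewrite ler_wpM2r// ler_pM2l.
  rewrite le_eqVlt; apply/orP; left; apply/eqP; rewrite /kap; field; rewrite !gt_eqF//.
rewrite mulrAC ler_pdivlMr ?addr_gt0//; apply: (@le_trans _ _ (kap * (x + y))).
  by lra.
by rewrite ler_pM2l// -add1.
Qed.

(* Pulling back along the itinerary, the common cylinders of [x] and [y] shrink by a
   uniform factor. *)
Lemma homt_contr : exists2 theta : R, 0 <= theta < 1 & forall n k phi x y,
  smono phi 0 (Lk k) -> crcontr phi 0 (Lk k) ->
  0 <= x -> x < y -> y <= Zk (Q k.+1).+1 -> homt x y ->
  `|phi x - phi y| <= theta ^+ n * `|phi (Zk (Q k.+1).+1) - phi 0|.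
Proof.
have [theta t01 contr] := level_contr; exists theta => //.
have th0 : 0 <= theta by case/andP: t01.
elim=> [|n IH] k phi x y mo cr x0 xy yZ h.
  have ZL := L_gtZ a0 a1 admK k; set t := (Q k.+1).+1 in yZ ZL *.
  rewrite mul1r; have h1 : `|phi x - phi y| <= `|phi y - phi 0|.
    move: x0; rewrite le_eqVlt => /predU1P[<-|x0]; first by rewrite distrC.
    by rewrite distrC (smono_addn mo (lexx 0) x0 xy (le_trans yZ (ltW ZL))) lerDl.
  apply: (le_trans h1); have y0 : 0 < y by lra.
  move: yZ; rewrite le_eqVlt => /predU1P[->//|yZ].
  by rewrite (smono_addn mo (lexx 0) y0 yZ (ltW ZL)) lerDr.
have y0 : 0 < y by lra.
have Z1 i : Zk i <= 1 by rewrite -(Zk0 m a) (Z_noninc a0 a1 admK).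
have [i iy] := lev_exists y0 (le_trans yZ (Z1 _)).
have ix := homt_lev iy x0 xy h; have /andP[yl yu] := iy.
have ti : ((Q k.+1).+1 <= i)%N.
  rewrite leqNgt; apply/negP => it; have := Z_noninc a0 a1 admK it; lra.
case: i iy ix yl yu ti => // i iy ix yl yu ti.
pose psi := phi \o (rt m \o th i).
have ZtL : Zk i.+1 <= Lk k.
  by apply: (le_trans _ (ltW (L_gtZ a0 a1 admK k))); exact: (Z_noninc a0 a1 admK).
have mo' : smono phi 0 (Zk i.+1) by apply: (smonoW _ ZtL mo).
have cr' : crcontr phi 0 (Zk i.+1) by apply: (crcontrW _ ZtL (@cr)).
have mpsi : smono psi 0 (Lk i) := smono_comp (branch_smono H i) (@branch_dom _ _ _ _ _ _ _ H i) mo'.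
have cpsi : crcontr psi 0 (Lk i) :=
  crcontr_comp (branch_smono H i) (@branch_crcontr _ _ _ _ _ _ _ H i) (@branch_dom _ _ _ _ _ _ _ H i) (@cr').
pose x' := gk i (x ^+ l); pose y' := gk i (y ^+ l).
have xE : rt m (th i x') = x.
  have := ix; rewrite le_eqVlt => /predU1P[xZ|xl].
    rewrite /x' -xZ (Zk_exp H) -(thZ m a i) (gk_th a0 a1 admK) ?thZ//.
    have := L_gtZ a0 a1 admK i; have := M_gt0 a0 a1 admK i; have := LX a0 a1 admK i.
    by have := Z_gt0 a0 a1 admK (Q i.+1).+1; lra.
  by apply: (jumpK H); rewrite /lev /= xl; lra.
have yE : rt m (th i y') = y by apply: (jumpK H).
have /andP[y'0 y'Z] : 0 <= y' < Zk (Q i.+1).+1 by exact: (jump_lev H).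
have Z2 := Z_gt0 a0 a1 admK i.+2.
have xyl : x ^+ l < y ^+ l by rewrite ltrXn2r ?nnegrE ?expn_eq0//; lra.
have yY : y ^+ l <= Yk i by apply: (exp_leY H); rewrite gtr0_norm//; apply: (le_trans yu); exact: (Z_noninc a0 a1 admK).
have y'x' : y' < x' by apply: (gk_lt a0 a1 (lok a0 a1 admK i)) => //; exact: (exp_ge0 H).
have x'Z : x' <= Zk (Q i.+1).+1.
  have := ix; rewrite le_eqVlt => /predU1P[xZ|xl].
    rewrite /x' -xZ (Zk_exp H) -(thZ m a i) (gk_th a0 a1 admK)//.
    have := L_gtZ a0 a1 admK i; have := M_gt0 a0 a1 admK i; have := LX a0 a1 admK i.
    by have := Z_gt0 a0 a1 admK (Q i.+1).+1; lra.
  have : lev m a i.+1 x by rewrite /lev /= xl; lra.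
  by move=> /(jump_lev H)/andP[_ /ltW].
have h' : homt y' x'.
  have := homt_abs (homt_iter (S i) h); rewrite !(pmap_cut H) !normrM !norm_tau !mul1r.
  rewrite -/x' -/y' (ger0_norm y'0) (ger0_norm (ltW (le_lt_trans y'0 y'x'))).
  exact: homt_sym.
have := IH i psi y' x' mpsi (@cpsi) y'0 y'x' x'Z h'.
rewrite /psi /= xE yE thZ th0E -/(Zk _) -/(Zk _) distrC => /le_trans; apply.
rewrite exprSr -mulrA ler_wpM2l ?exprn_ge0// distrC.
exact: (contr k phi i.+1 mo (@cr) ti).
Qed.

(** Below [Z_1], [homt_contr] with the identity for [phi] applies. Level 0 has no return branch, but
    there [|f|] at least doubles distances, which cannot continue forever inside [[0, 1]]. *)
Lemma no_homterval x y : -1 <= x <= 1 -> -1 <= y <= 1 -> homt x y -> x = y.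
Proof.
move=> x1 y1 h; apply: homt_abs_eq => //.
have {x1} x1 : 0 <= `|x| <= 1 by rewrite normr_ge0 ler_norml.
have {y1} y1 : 0 <= `|y| <= 1 by rewrite normr_ge0 ler_norml.
move: `|x| `|y| x1 y1 (homt_abs h) => {x y h}.
suff W x y : 0 <= x -> x < y -> y <= 1 -> homt x y -> False.
  move=> x y /andP[x0 x1] /andP[y0 y1] h; have [xy|yx|//] := ltgtP x y.
    by have := W x y x0 xy y1 h.
  by have := W y x y0 yx x1 (homt_sym h).
have Low u v : 0 <= u -> u < v -> v <= Zk 1 -> homt u v -> False.
  move=> u0 uv vZ h; have [theta /andP[t0 t1] C] := homt_contr.
  have Ct n : v - u <= theta ^+ n * Zk 1.
    have := C n 0%N id u v; rewrite kneadQ_small subr0 distrC [`|Zk 1|]gtr0_norm ?(Z_gt0 a0 a1 admK)//.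
    rewrite gtr0_norm ?subr_gt0//; apply => //; first by left.
  have Z10 := Z_gt0 a0 a1 admK 1.
  have e0 : 0 < (v - u) / Zk 1 by rewrite divr_gt0// subr_gt0.
  have [n] := exprn_small t0 t1 e0; rewrite ltr_pdivlMr// => /lt_le_trans/(_ (Ct n)).
  by rewrite ltxx.
move=> x0 xy y1 h.
suff D n u v : 0 <= u -> u < v -> v <= 1 -> homt u v -> 2 ^+ n * (v - u) <= 1.
  have e0 : 0 < y - x by rewrite subr_gt0.
  have [||n] := @exprn_small R (1 / 2) _ _ _ e0; [lra|lra|].
  have := D n x y x0 xy y1 h; rewrite expr_div_n expr1n ltr_pdivrMr ?exprn_gt0// mulrC; lra.
elim: n u v => [|n IH] u v u0 uv v1 hu; first by rewrite mul1r; lra.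
have [vZ|Zv] := leP v (Zk 1); first by have := Low u v u0 uv vZ hu.
have lv : lev m a 0 v by rewrite /lev /= Zv Zk0.
have Zu := homt_lev lv u0 uv hu.
have [B [e [B1 Bl e0 gB oe]]] := tame_unif H.
have Z10 := Z_gt0 a0 a1 admK 1.
have fE w : Zk 1 <= w -> w <= 1 -> `|f w| = (1 + a) * w ^+ l - a /\ 0 <= (1 + a) * w ^+ l - a <= 1.
  move=> w1 w2; have Y1 : (1 + a) * Yk 1 = a by rewrite /= th0 subr0 mulrC divfK// gt_eqF//; have := a0; lra.
  have wl : Yk 1 <= w ^+ l by rewrite -(Zk_exp H) lerXn2r ?nnegrE//; lra.
  have w1' : w ^+ l <= 1 by rewrite exprn_ile1//; lra.
  have a0' := a0.
  have : (1 + a) * Yk 1 <= (1 + a) * w ^+ l by rewrite ler_pM2l//; lra.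
  have : (1 + a) * w ^+ l <= (1 + a) * 1 by rewrite ler_pM2l//; lra.
  move=> h1 h2; split; last lra.
  by rewrite /pmap ler0_norm ?opprB//; lra.
have [fu /andP[fu0 fu1]] := fE u Zu (le_trans (ltW uv) v1).
have [fv /andP[fv0 fv1]] := fE v (ltW Zv) v1.
(* The difference quotient of [(1 + a) x^l] on [[u, v]] is at least [l (1 + a) u^l >= l a >= 2]. *)
have ex : 2 * (v - u) <= `|f v| - `|f u|.
  rewrite fu fv; have -> : (1 + a) * v ^+ l - a - ((1 + a) * u ^+ l - a) = (1 + a) * (v ^+ l - u ^+ l) by ring.
  have Yu : a <= (1 + a) * u ^+ l by move: fu0; lra.
  have ul : lr * u ^+ l <= \sum_(i < l) v ^+ (l.-1 - i) * u ^+ i.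
    have -> : lr * u ^+ l = \sum_(i < l) u ^+ l by rewrite sumr_const card_ord mulr_natl.
    apply: ler_sum => i _.
    have il : l = ((l.-1 - i).+1 + i)%N by have := ltn_ord i; move: (nat_of_ord i); move: (2 ^ m)%N; clear; lia.
    have -> : u ^+ l = u ^+ (l.-1 - i).+1 * u ^+ i by rewrite -exprD -il.
    rewrite ler_wpM2r ?exprn_ge0//; apply: (@le_trans _ _ (u ^+ (l.-1 - i))).
      by apply: ler_wiXn2l => //; lra.
    by rewrite lerXn2r ?nnegrE//; lra.
  have l4 : 4 <= lr by lra.
  rewrite subrXX mulrCA [leLHS]mulrC ler_pM2l ?subr_gt0//.
  have a2 := tame_a H; have a0' := a0.
  apply: (@le_trans _ _ ((1 + a) * (lr * u ^+ l))); last by rewrite ler_pM2l//; lra.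
  rewrite mulrCA; apply: (@le_trans _ _ (4 * ((1 + a) * u ^+ l))); first lra.
  by rewrite ler_wpM2r//; lra.
have uv' : `|f u| < `|f v| by have : 0 < v - u by [rewrite subr_gt0|lra]; lra.
have := IH _ _ _ uv' _ (homt_abs (homt_iter 1 hu)); rewrite fu fv => /(_ fu0 fv1) h2.
have : 2 ^+ n * (2 * (v - u)) <= 2 ^+ n * (`|f v| - `|f u|) by rewrite ler_pM2l ?exprn_gt0.
by rewrite fu fv exprSr -mulrA; lra.
Qed.

End NoHomterval.

(** * The critical orbit *)

Section Closeness.
Context {R : realType} (m : nat) (a A b : R) (K J : nat).
Hypothesis H : tame m a A b K J.
Implicit Types (x y : R).

Local Notation l := (2 ^ m)%N.
Local Notation lr := ((2 ^ m)%:R : R).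
Local Notation Q := kneadQ.
Local Notation S := cuttime.
Local Notation gk := (gk m a).
Local Notation th := (th m a).
Local Notation Lk := (Lk m a).
Local Notation Mk := (Mk m a).
Local Notation Zk := (Zk m a).
Local Notation Yk := (Yk m a).

Let a0 := tame_a0 H.
Let a1 := tame_a1 H.
Let admK := tame_adm H.
Arguments admK : clear implicits.

Local Notation f := (pmap m a).
Local Notation crit := (crit m a).

Lemma pmap_continuous : continuous f.
Proof.
move=> x; suff : {for x, continuous (fun y => a - (1 + a) * y ^+ l)} by [].
apply: continuousB; first exact: cst_continuous.
apply: continuousM; first exact: cst_continuous.
exact: exprn_continuous.
Qed.

Lemma pmap_iter_continuous i : continuous (iter i f).
Proof.
elim: i => [|i IH] x; first exact: cvg_id.
by apply: (@continuous_comp _ _ _ (iter i f) f); [exact: IH|exact: pmap_continuous].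
Qed.

(** By compactness: counterexamples with [N] growing and [d] shrinking would accumulate at two
    distinct points with equal itineraries, against [no_homterval]. *)
Lemma homt_uniform (e : R) : 0 < e -> exists N (d : R), 0 < d /\ forall x y, -1 <= x <= 1 -> -1 <= y <= 1 ->
  (forall i, (i < N)%N -> - d < iter i f x * iter i f y) -> `|x - y| < e.
Proof.
move=> e0; apply: contrapT => nE.
have bad n : exists xy : R * R, [/\ -1 <= xy.1 <= 1, -1 <= xy.2 <= 1,
    forall i, (i < n)%N -> - n.+1%:R^-1 < iter i f xy.1 * iter i f xy.2 & e <= `|xy.1 - xy.2|].
  apply: contrapT => nb; apply: nE; exists n, n.+1%:R^-1; split; first by rewrite invr_gt0.
  move=> x y x1 y1 h; rewrite ltNge; apply/negP => exy; apply: nb; exists (x, y); split => //.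
have {bad}[u uP] := choice bad.
have I1 : compact (`[-1, 1]%classic : set R) by exact: segment_compact.
have cK := compact_setX I1 I1.
have [|[x y] [[/= x1 y1] cl]] := cK (u n @[n --> \oo]) _.
  by exists 0%N => // n _ /=; have [? ? _ _] := uP n; split; rewrite /= in_itv.
move: x1 y1; rewrite !in_itv /= => x1 y1.
have close (P : set (R * R)) : nbhs (x, y) P -> forall n, exists2 k, (n <= k)%N & P (u k).
  move=> nP n; have tail : (u n @[n --> \oo]) (u @` [set k | (n <= k)%N]).
    by exists n => // k nk; exists k.
  by have [_ [[k nk <-] Pk]] := cl _ _ tail nP; exists k.
have cf i : {for (x, y), continuous (fun p : R * R => iter i f p.1 * iter i f p.2)}.
  apply: continuousM.
    by apply: (@continuous_comp _ _ _ fst (iter i f)); [exact: cvg_fst|exact: pmap_iter_continuous].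
  by apply: (@continuous_comp _ _ _ snd (iter i f)); [exact: cvg_snd|exact: pmap_iter_continuous].
have xy : (x : R) = y.
  apply: (no_homterval H) => // i; rewrite leNgt; apply/negP => neg.
  have [p Ep] : exists p : R, iter i f x * iter i f y = p by exists (iter i f x * iter i f y).
  rewrite Ep in neg.
  have [n np] : exists n : nat, n.+1%:R^-1 < - p / 2.
    have p0 : 0 < - p / 2 by rewrite divr_gt0// oppr_gt0.
    by have [n _ /(_ n (leqnn n))] := near_infty_natSinv_lt (PosNum p0); exists n.
  have nb : nbhs (x, y) [set q : R * R | iter i f q.1 * iter i f q.2 < p / 2].
    by apply: (cvgr_lt _ (cf i)) => /=; rewrite Ep; lra.
  have [k nk /= Pk] := close _ nb (maxn n i.+1).
  have [_ _ /(_ i) h _] := uP k.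
  have {}h := h (leq_trans (leq_maxr n _) nk).
  have : k.+1%:R^-1 <= n.+1%:R^-1 :> R.
    by rewrite lef_pV2 ?posrE// ler_nat ltnS (leq_trans (leq_maxl _ _) nk).
  have h' : - k.+1%:R^-1 < p / 2 :> R := lt_trans h Pk.
  move=> /le_lt_trans/(_ np); rewrite mulNr ltrNr => /lt_trans/(_ h').
  by rewrite ltxx.
have cd : {for (x, y), continuous (fun p : R * R => `|p.1 - p.2|)}.
  by apply: continuous_comp; [apply: continuousB; [exact: cvg_fst|exact: cvg_snd]|exact: norm_continuous].
have nb : nbhs (x, y) [set q : R * R | `|q.1 - q.2| < e].
  by apply: (cvgr_lt _ cd) => /=; rewrite xy subrr normr0.
have [k _ /= Pk] := close _ nb 0%N; have [_ _ _] := uP k.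
by rewrite leNgt Pk.
Qed.

Lemma crit_range t : -1 <= crit t <= 1.
Proof. by apply: (pmap_iter_range H); lra. Qed.

Lemma crit_iter i t : iter i f (crit t) = crit (i + t).
Proof. by rewrite /crit -iterD. Qed.

Lemma sign_mul_gt0 (bb : bool) x y : 0 < (-1) ^+ bb * x -> 0 < (-1) ^+ bb * y -> 0 < x * y.
Proof.
move=> h1 h2; have := mulr_gt0 h1 h2.
by rewrite mulrACA -expr2 sqrr_sign mul1r.
Qed.

(** If [|crit t|] had a level [j <= k], the signs of [crit (S_j + t)] and [crit (S_j)] would be
    opposite; but [3^n] does not divide [S_j], so [kneadneg_mod] makes them equal. *)
Lemma crit_small k n t : (S k < 3 ^ n)%N -> (0 < t)%N -> (3 ^ n.+1 %| t)%N ->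
  `|crit t| <= Zk k.+1.
Proof.
move=> Sn t0 nt; rewrite leNgt; apply/negP => Zc.
have c0 : 0 < `|crit t| := lt_trans (Z_gt0 a0 a1 admK k.+1) Zc.
have c1 : `|crit t| <= 1 by rewrite ler_norml crit_range.
have [j /andP[jl ju]] := lev_exists H c0 c1.
have jk : (j <= k)%N.
  by rewrite -ltnS ltnNge; apply/negP => kj; have := Z_noninc a0 a1 admK kj; lra.
have Sj : (0 < S j < 3 ^ n)%N by rewrite cuttime_gt0 (leq_ltn_trans _ Sn)// cuttime_mono.
have nS : ~~ (3 ^ n %| S j)%N.
  by apply/negP => /dvdn_leq; case/andP: Sj => -> jn /(_ isT); rewrite leqNgt jn.
have mS : S j = (S j + t)%N %[mod 3 ^ n.+1].
  by rewrite -modnDmr (eqP nt) addn0.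
have := @crit_sign _ _ _ _ _ _ _ H (S j + t)%N (ltn_addr _ (cuttime_gt0 j)).
rewrite -(kneadneg_mod nS mS) -crit_iter (pmap_cut H) tau_exp mulrA -expr2 sqrr_sign mul1r.
by apply/negP; rewrite -leNgt ltW// (gk_neg H) ?(exp_gtY H) ?(exp_leY H).
Qed.

Lemma small_level (d : R) : 0 < d -> exists2 k, Zk k * Zk k < d & forall i, (k <= i)%N -> Zk i * Zk i < d.
Proof.
move=> d0; have d1 : 0 < Num.min d 1 by rewrite lt_min d0 ltr01.
have [k kd] := Z_small H d1; exists k; rewrite lt_min in kd; case/andP: kd => kd k1.
  have Z0 := Z_gt0 a0 a1 admK k.
  by apply: le_lt_trans kd; rewrite -[leRHS]mulr1 ler_pM2l// ltW.
move=> i ki; have Z0 := Z_gt0 a0 a1 admK i; have Zki := Z_noninc a0 a1 admK ki.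
by apply: (@le_lt_trans _ _ (Zk i * 1)); [rewrite ler_pM2l//; lra|lra].
Qed.

Lemma mul_gt_opp (x y z d : R) : `|x| <= z -> `|y| <= z -> z * z < d -> - d < x * y.
Proof.
move=> xz yz zd; have h : `|x * y| <= z * z by rewrite normrM ler_pM.
by move: h; rewrite ler_norml => /andP[h _]; lra.
Qed.

(** The signs along the two orbits agree except when [3^(S_k + 1)] divides the time; then both
    points are within [Z_(k+1)] of 0 by [crit_small], which [homt_uniform] tolerates. *)
Lemma crit_close (e : R) : 0 < e -> exists n, forall t t', (0 < t)%N -> (0 < t')%N ->
  t = t' %[mod 3 ^ n] -> `|crit t - crit t'| < e.
Proof.
move=> e0; have [N [d [d0 close]]] := homt_uniform e0.
have [k _ kd] := small_level d0.
exists (S k).+2 => t t' t0 t'0 tt.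
apply: close => [||i _]; [exact: crit_range|exact: crit_range|].
rewrite !crit_iter; have tt' : (i + t)%N = (i + t')%N %[mod 3 ^ (S k).+2].
  by rewrite -modnDmr tt modnDmr.
have it : (0 < i + t)%N by rewrite addn_gt0 t0 orbT.
have it' : (0 < i + t')%N by rewrite addn_gt0 t'0 orbT.
have [dv|ndv] := boolP (3 ^ (S k).+1 %| i + t)%N.
  have dv' : (3 ^ (S k).+1 %| i + t')%N.
    have dd : (3 ^ (S k).+1 %| 3 ^ (S k).+2)%N by rewrite dvdn_exp2l.
    by move: dv; rewrite /dvdn -(modn_dvdm _ dd) tt' (modn_dvdm _ dd).
  have Sk3 : (S k < 3 ^ S k)%N by rewrite ltn_expl.
  exact: (mul_gt_opp (crit_small Sk3 it dv) (crit_small Sk3 it' dv') (kd k.+1 (leqnSn k))).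
apply: (@lt_trans _ _ 0); first by rewrite oppr_lt0.
have := @crit_sign _ _ _ _ _ _ _ H _ it'; rewrite -(kneadneg_mod ndv tt').
by apply: sign_mul_gt0; exact: (crit_sign H).
Qed.

Lemma return_small k k1 x : (k1 + 9 <= k)%N -> `|x| <= Zk k -> `|iter (S k) f x| < Zk k1.
Proof.
move=> kk xZ; rewrite (pmap_cut H) normrM norm_tau mul1r.
have xY : 0 <= x ^+ l <= Yk k by rewrite (exp_ge0 H) (exp_leY H).
have := gk_bounds a0 a1 admK xY => /andP[g1 g2].
have L1 : Lk k < Zk k1.
  apply: (lt_le_trans (L_ltZ a0 a1 admK k)); apply: (Z_noninc a0 a1 admK).
  by have := kneadQ_ge k.+1; move: kk; clear; lia.
have M1 : Mk k < Zk k1.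
  case: k kk {xZ xY g1 g2 L1} => [|k] kk; first by rewrite addnS in kk.
  apply: (lt_le_trans (L_ltZ a0 a1 admK (Q k.+1))); apply: (Z_noninc a0 a1 admK).
  by have := kneadQ_ge k.+1; have := kneadQ_ge (Q k.+1).+1; move: kk; clear; lia.
by rewrite ltr_norml; apply/andP; split; lra.
Qed.

(** Signs agree before time [S_k] by [pmap_sign]. At [S_k] both orbits are close to 0, and
    afterwards both follow the pattern of level [k2], whose length [S_k2 > N] covers all the times
    that [homt_uniform] inspects. *)
Lemma near_crit (e : R) : 0 < e -> exists k0, forall k x j, (k0 <= k)%N -> `|x| < Zk k -> (j <= S k)%N ->
  `|iter j f x - crit j| < e.
Proof.
move=> e0; have [N [d [d0 close]]] := homt_uniform e0.
have [k1 _ k1d] := small_level d0; pose k2 := maxn k1 N.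
exists (k2 + 9)%N => k x j kk xZ jS.
have Zk1 i : Zk i <= 1 by rewrite -(Zk0 m a) (Z_noninc a0 a1 admK).
have x1 : -1 <= x <= 1 by rewrite -ler_norml (le_trans (ltW xZ)).
have z0 : `|0 : R| < Zk k by rewrite normr0 (Z_gt0 a0 a1 admK).
apply: close => [||i iN]; [exact: (pmap_iter_range H)|exact: crit_range|].
rewrite crit_iter -iterD; have [s0|s0] := posnP (i + j); first by rewrite s0 /crit /= mulr0 oppr_lt0.
have [sS|] := ltnP (i + j) (S k).
  apply: (@lt_trans _ _ 0); first by rewrite oppr_lt0.
  have sr : (0 < i + j < S k)%N by rewrite s0.
  exact: (sign_mul_gt0 (pmap_sign H xZ sr) (pmap_sign H z0 sr)).
have r1 := return_small kk (ltW xZ); have r2 := return_small kk (ltW z0).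
rewrite leq_eqVlt => /predU1P[<-|Ss].
  exact: (mul_gt_opp (ltW r1) (ltW r2) (k1d _ (leq_maxl _ _))).
apply: (@lt_trans _ _ 0); first by rewrite oppr_lt0.
have -> : (i + j = (i + j - S k) + S k)%N by rewrite subnK// ltnW.
rewrite -crit_iter iterD.
have sr : (0 < i + j - S k < S k2)%N.
  have := cuttime_gtk k2; have := leq_maxr k1 N; rewrite -/k2.
  by move: iN jS Ss; move: (S k) (S k2); clear; lia.
exact: (sign_mul_gt0 (pmap_sign H r1 sr) (pmap_sign H r2 sr)).
Qed.

End Closeness.

Section Orbits.
Context {R : realType} (m : nat) (a A b : R) (K J : nat).
Hypothesis H : tame m a A b K J.
Implicit Types (x y : R).

Local Notation l := (2 ^ m)%N.
Local Notation lr := ((2 ^ m)%:R : R).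
Local Notation Q := kneadQ.
Local Notation S := cuttime.
Local Notation gk := (gk m a).
Local Notation th := (th m a).
Local Notation Lk := (Lk m a).
Local Notation Mk := (Mk m a).
Local Notation Zk := (Zk m a).
Local Notation Yk := (Yk m a).

Let a0 := tame_a0 H.
Let a1 := tame_a1 H.
Let admK := tame_adm H.
Arguments admK : clear implicits.

Local Notation f := (pmap m a).
Local Notation crit := (crit m a).

(** [Y n] is the orbit under jumps and [T n] the time elapsed. Never being [low] forces the level of
    [Y n] above [kappa n], hence to infinity, and [near_crit] controls the orbit between jumps. An
    orbit that hits 0 continues as the critical one. *)
Lemma survive_near K0 (kappa : nat -> nat) x k0 : (0 < K0)%N ->
  (forall n, (K0 <= kappa n)%N) -> (forall B, exists N, forall n, (N <= n)%N -> (B <= kappa n)%N) ->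
  lev m a k0 x -> (forall n, ~ low m a K0 n (kappa n) x) ->
  forall e : R, 0 < e -> exists T, forall t, (T <= t)%N -> exists s, `|iter t f x - crit s| < e.
Proof.
move=> K00 kK kB xk0 nlow e e0.
have [[T fT]|nz] := pselect (exists T, iter T f x = 0).
  exists T => t Tt; exists (t - T)%N.
  by rewrite -{1}(subnK Tt) iterD fT subrr normr0.
pose lv y := xget 0%N [set k | lev m a k y].
have lvP y : 0 < y -> y <= 1 -> lev m a (lv y) y.
  by move=> y0 y1; have [k ky] := lev_exists H y0 y1; rewrite /lv; case: xgetP => [j _ //|/(_ k)/(_ ky)].
pose Y n := iter n (fun y => jump m a (lv y) y) x.
pose T := fix T n := if n is n'.+1 then (S (lv (Y n')).-1 + T n')%N else 0%N.
have Zk1 i : Zk i <= 1 by rewrite -(Zk0 m a) (Z_noninc a0 a1 admK).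
have P n : [/\ 0 < Y n, Y n <= 1, `|iter (T n) f x| = Y n &
    forall i B, low m a K0 i B (Y n) -> low m a K0 (n + i) B x] /\ (kappa n < lv (Y n))%N.
  elim: n => [|n [[Y0 Y1 fY tail] klv]].
    have x0 : 0 < x by case/andP: xk0 => xl _; apply: lt_trans xl; exact: (Z_gt0 a0 a1 admK).
    have x1 : x <= 1 by case/andP: xk0 => _ xl; apply: le_trans xl (Zk1 _).
    split; first by split => //; rewrite /= gtr0_norm.
    rewrite ltnNge; apply/negP => lk; apply: (nlow 0%N) => /=; exists (lv x) => //; exact: lvP.
  have lY := lvP _ Y0 Y1; move: (klv) (lY); rewrite [Y n.+1]/= [T n.+1]/= -/(Y n).
  case E : (lv (Y n)) => [//|k] _ lYk; have /andP[j0 jZ] := jump_lev H lYk.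
  have jE : `|iter (S k + T n) f x| = jump m a k.+1 (Y n).
    rewrite iterD -(pmap_abs_iter H) ?cuttime_gt0// fY (pmap_cut H) normrM norm_tau mul1r.
    by rewrite ger0_norm.
  have jn0 : 0 < jump m a k.+1 (Y n).
    rewrite lt_neqAle j0 andbT eq_sym -jE normr_eq0; apply/eqP => z; apply: nz; by eexists; exact: z.
  have tail' i B : low m a K0 i B (jump m a k.+1 (Y n)) -> low m a K0 (n.+1 + i) B x.
    move=> lo; rewrite addSnnS; apply: tail => /=; exists k.+1; split => //.
    by rewrite -E; apply: leq_trans (kK n) (ltnW klv).
  split; first by split => //; apply: le_trans (ltW jZ) (Zk1 _).
  rewrite ltnNge; apply/negP => lk; apply: (nlow n.+1).
  have := tail' 0%N (kappa n.+1); rewrite addn0; apply => /=; exists (lv (jump m a k.+1 (Y n))) => //.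
  by apply: lvP => //; apply: le_trans (ltW jZ) (Zk1 _).
have [k1 near] := near_crit H e0; have [N NB] := kB k1.+1.
exists (T N) => t Tt.
have Tn n : (n <= T n)%N.
  elim: n => //= n IH; rewrite -add1n leq_add//; exact: cuttime_gt0.
have exT : exists n, (T n <= t)%N by exists N.
have [n nt nmax] := ex_maxnP exT (fun n (nt : (T n <= t)%N) => leq_trans (Tn n) nt).
have Nn : (N <= n)%N by exact: nmax.
have tn : (t < T n.+1)%N by rewrite ltnNge; apply/negP => /nmax; rewrite ltnn.
have [[Y0 Y1 fY _] klv] := P n; have lY := lvP _ Y0 Y1.
have k1n := NB n Nn; move: klv lY tn; rewrite [T n.+1]/=.
case: (lv (Y n)) => [//|k]; rewrite ltnS => klv /andP[_ lY] /= tn.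
exists (t - T n)%N; rewrite -{1}(subnK nt) iterD; apply: (near k).
- by apply: leq_trans klv; apply: leq_trans k1n.
- by rewrite fY (le_lt_trans lY)// (Z_ltS a0 a1 admK).
- by rewrite leq_subLR addnC ltnW.
Qed.

(* If [s] divides [S_j], then [f^(S_j) 0] is in the restrictive interval, hence so is a
   preimage of [0] of order [S_(Q(j+1))]. *)
Lemma not_renorm p q s : -1 <= p -> p < 0 -> 0 < q -> q <= 1 ->
  (forall x, p <= x <= q -> p <= iter s f x <= q) ->
  (forall x j, p <= x <= q -> iter j f x = 0 -> (s %| j)%N) -> s = 1%N.
Proof.
move=> p1 p0 q0 q1 inv Hs.
have c0 : p <= 0 <= q by lra.
have fz k : iter (S k) f (Zk k.+1) = 0.
  by rewrite (pmap_cut H) (Zk_exp H) (gk_YkS a0 a1 (lok a0 a1 admK k) (ltW (M_gt0 a0 a1 admK k))) mulr0.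
have fzN k : iter (S k) f (- Zk k.+1) = 0.
  have Z0 := Z_gt0 a0 a1 admK k.+1.
  by rewrite -(pmap_abs_iter H) ?cuttime_gt0// normrN gtr0_norm// fz.
have inv' j x : p <= x <= q -> (s %| j)%N -> p <= iter j f x <= q.
  move=> xI /dvdnP[k ->] {j}; elim: k x xI => [//|k IH] x xI.
  by rewrite mulSn iterD; apply: inv; exact: IH.
have desc j : (s %| S j)%N -> (s %| S (Q j.+1))%N.
  move=> sj; have cj := inv' _ _ c0 sj; have Z0 := Z_gt0 a0 a1 admK (Q j.+1).+1.
  have LZ := L_gtZ a0 a1 admK j.
  move: cj; rewrite (pmap_cut H) expr0n gtn_eqF ?expn_gt0//= -/(Lk j) tau_exp.
  case: kneadneg; rewrite ?expr0 ?expr1 ?mul1r ?mulN1r => cj.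
    by apply: (Hs (- Zk (Q j.+1).+1)); [lra|exact: fzN].
  by apply: (Hs (Zk (Q j.+1).+1)); [lra|exact: fz].
have [k kq] := Z_small H q0.
have sk : (s %| S k)%N.
  apply: (Hs (Zk k.+1)); last exact: fz.
  have := Z_gt0 a0 a1 admK k.+1; have := Z_ltS a0 a1 admK k; lra.
have all j : (s %| S j)%N -> (s %| S 0)%N.
  elim/ltn_ind: j => -[//|j] IH /desc; apply: IH; rewrite ltnS.
  exact: kneadQSS_le.
by have := all k sk; rewrite /cuttime dvdn1 => /eqP.
Qed.

End Orbits.

(** * Periodic points *)

Lemma cross_opp {R : realType} (x y z w : R) : cross (- x) (- y) (- z) (- w) = cross x y z w.
Proof.
have := @cross_affine R (-1) 0 x y z w; rewrite oppr_eq0 oner_eq0 => /(_ isT) <-.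
by rewrite !mulN1r !addr0.
Qed.

Section Repelling.
Context {R : realType} (m : nat) (a A b : R) (K J : nat).
Hypothesis H : tame m a A b K J.
Implicit Types (x y : R).

Local Notation l := (2 ^ m)%N.
Local Notation lr := ((2 ^ m)%:R : R).
Local Notation Q := kneadQ.
Local Notation S := cuttime.
Local Notation gk := (gk m a).
Local Notation th := (th m a).
Local Notation Lk := (Lk m a).
Local Notation Mk := (Mk m a).
Local Notation Zk := (Zk m a).
Local Notation Yk := (Yk m a).

Let a0 := tame_a0 H.
Let a1 := tame_a1 H.
Let admK := tame_adm H.
Arguments admK : clear implicits.

Local Notation f := (pmap m a).
Local Notation crit := (crit m a).

Lemma cross_exp n x y z w : 0 <= x -> x < y -> y < z -> z < w ->
  cross x y z w <= cross (x ^+ (2 ^ n)) (y ^+ (2 ^ n)) (z ^+ (2 ^ n)) (w ^+ (2 ^ n)).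
Proof.
move=> x0 xy yz zw; elim: n => [|n IH]; first by rewrite expn0 !expr1.
have e n' u v : 0 <= u -> u < v -> u ^+ (2 ^ n') < v ^+ (2 ^ n').
  by move=> u0 uv; rewrite ltrXn2r ?nnegrE ?expn_eq0//; lra.
apply: (le_trans IH); rewrite expnSr !exprM; apply/ltW/cross_sqr; rewrite ?exprn_ge0 ?e//; lra.
Qed.

Lemma cross_pmap x y z w : 0 <= x \/ w <= 0 -> x < y -> y < z -> z < w ->
  cross x y z w <= cross (f x) (f y) (f z) (f w).
Proof.
have fE u : f u = - (1 + a) * u ^+ l + a by rewrite /pmap; ring.
have n0 : - (1 + a) != 0 by rewrite oppr_eq0 gt_eqF//; have := a0; lra.
rewrite !fE cross_affine// => -[s0|s0] xy yz zw; first exact: (@cross_exp m x y z w s0 xy yz zw).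
have h := @cross_exp m (- w) (- z) (- y) (- x).
rewrite -(cross_opp x) -cross_rev -[leRHS]cross_rev -(even_exp H x) -(even_exp H y).
by rewrite -(even_exp H z) -(even_exp H w); apply: h; lra.
Qed.

Lemma pmap_smono u v : 0 <= u \/ v <= 0 -> smono f u v.
Proof.
have a0' := a0.
move=> [s0|s0]; [right|left] => x y ux xy yv; rewrite /pmap.
  rewrite ltrD2l ltrN2 ltr_pM2l ?ltrXn2r ?nnegrE ?expn_eq0//; lra.
rewrite ltrD2l ltrN2 ltr_pM2l; last lra.
by rewrite -(even_exp H y) -(even_exp H x) ltrXn2r ?nnegrE ?expn_eq0//; lra.
Qed.

Definition nocrit n u v := forall i, (i < n)%N ->
  (forall y, u <= y <= v -> 0 <= iter i f y) \/ (forall y, u <= y <= v -> iter i f y <= 0).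

Lemma nocrit_smono n u v : u <= v -> nocrit n u v -> smono (iter n f) u v.
Proof.
move=> uv; elim: n => [|n IH] nc; first by left.
have {IH} mo : smono (iter n f) u v by apply: IH => i ni; apply: nc; exact: ltnW.
have uI : u <= u <= v by rewrite lexx. have vI : u <= v <= v by rewrite lexx uv.
have [nc0|nc0] := nc n (ltnSn n).
  have mf : smono f 0 (Num.max (iter n f u) (iter n f v)) by apply: pmap_smono; left.
  apply: (smono_comp mo _ mf) => x xI; rewrite nc0//=; case/andP: xI => ux xv.
  rewrite le_max; have /predU1P[->|ux'] : (u == x) || (u < x) by rewrite -le_eqVlt.
    by rewrite lexx.
  have /predU1P[->|xv'] : (x == v) || (x < v) by rewrite -le_eqVlt.
    by rewrite lexx orbT.
  by case: mo => mo; [rewrite orbC (ltW (mo x v _ _ _))//; lra|rewrite (ltW (mo u x _ _ _))//; lra].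
have mf : smono f (Num.min (iter n f u) (iter n f v)) 0 by apply: pmap_smono; right.
apply: (smono_comp mo _ mf) => x xI; rewrite nc0// andbT; case/andP: xI => ux xv.
rewrite ge_min; have /predU1P[->|ux'] : (u == x) || (u < x) by rewrite -le_eqVlt.
    by rewrite lexx.
have /predU1P[->|xv'] : (x == v) || (x < v) by rewrite -le_eqVlt.
    by rewrite lexx orbT.
by case: mo => mo; [rewrite (ltW (mo u x _ _ _))//; lra|rewrite orbC (ltW (mo x v _ _ _))//; lra].
Qed.

Lemma nocrit_cross n u v : nocrit n u v -> forall x y z w, u <= x -> x < y -> y < z -> z < w -> w <= v ->
  cross x y z w <= cross (iter n f x) (iter n f y) (iter n f z) (iter n f w).
Proof.
elim: n => [|n IH] nc x y z w ux xy yz zw wv //=.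
have nc' : nocrit n u v by move=> i ni; apply: nc; exact: ltnW.
apply: (le_trans (IH nc' x y z w ux xy yz zw wv)).
have uv : u <= v by lra.
have mo := nocrit_smono uv nc'.
have sgn : (forall t, u <= t <= v -> 0 <= iter n f t) \/ (forall t, u <= t <= v -> iter n f t <= 0).
  by apply: nc.
have xI : u <= x <= v by lra. have wI : u <= w <= v by lra.
case: mo => mo.
  apply: cross_pmap; [|by apply: mo; lra..].
  by case: sgn => s; [left|right]; exact: s.
rewrite -cross_rev -[leRHS]cross_rev; apply: cross_pmap; [|by apply: mo; lra..].
by case: sgn => s; [left|right]; exact: s.
Qed.

Lemma iter_fix n p k : iter n f p = p -> iter (k * n) f p = p.
Proof. by move=> np; elim: k => // k IH; rewrite mulSn iterD IH. Qed.

(** Otherwise 0 would be periodic, but no [crit n] with [n > 0] vanishes. *)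
Lemma periodic_noncrit n p i : (0 < n)%N -> iter n f p = p -> iter i f p != 0.
Proof.
move=> n0 np; apply/eqP => ip; have := @crit_neq0 _ _ _ _ _ _ _ H n n0.
by rewrite /Orbit.crit -ip -iterD addnC iterD np ip eqxx.
Qed.

Lemma periodic_nocrit n p N : (0 < n)%N -> iter n f p = p ->
  exists2 r : R, 0 < r & nocrit N (p - r) (p + r).
Proof.
move=> n0 np; elim: N => [|N [r r0 IH]]; first by exists 1.
have fp := periodic_noncrit N n0 np.
have cf : iter N f y @[y --> p] --> iter N f p by exact: (pmap_iter_continuous (m := m) (a := a)).
have [s s0 sP] : exists2 s : R, 0 < s & (forall y, `|p - y| < s -> 0 <= iter N f y) \/
    (forall y, `|p - y| < s -> iter N f y <= 0).
  have [fp0|fp0|] := ltgtP (iter N f p) 0; last by move=> fp0; rewrite fp0 eqxx in fp.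
    have /nbhs_ballP[s s0 sb] : \forall y \near p, iter N f y < 0 by exact: (cvgr_lt _ cf _ fp0).
    exists s => //.
    by right => y py; apply/ltW; exact: (sb y).
  have /nbhs_ballP[s s0 sb] : \forall y \near p, 0 < iter N f y by exact: (cvgr_gt _ cf _ fp0).
  exists s => //.
  by left => y py; apply/ltW; exact: (sb y).
exists (Num.min r (s / 2)); first by rewrite lt_min r0 divr_gt0.
have mr : Num.min r (s / 2) <= r by rewrite ge_min lexx.
have ms : Num.min r (s / 2) <= s / 2 by rewrite ge_min lexx orbT.
set t := Num.min r (s / 2) in mr ms *.
have sub y : p - t <= y <= p + t -> p - r <= y <= p + r /\ `|p - y| < s.
  move=> yt; split; first lra.
  by rewrite ltr_norml; apply/andP; split; lra.
move=> i; rewrite ltnS leq_eqVlt => /predU1P[->|iN].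
  by case: sP => sP; [left|right] => y /sub[_ /sP].
by have [nc|nc] := IH i iN; [left|right] => y /sub[/nc].
Qed.

(* A one-sided neighbourhood of [p] mapped into itself would contain points
   with the same itinerary as [p]. *)
Lemma periodic_expand n p r : (0 < n)%N -> iter n f p = p -> 0 < r ->
  -1 <= p - r -> p + r <= 1 -> nocrit n (p - r) (p + r) ->
  (forall x y, p - r <= x -> x < y -> y <= p + r -> iter n f x < iter n f y) ->
  iter n f (p - r) < p - r /\ p + r < iter n f (p + r).
Proof.
move=> n0 np r0 r1 r2 nc inc.
have same x : x != p -> -1 <= x <= 1 -> (forall k, p - r <= iter (k * n) f x <= p + r) -> False.
  move=> xp x1 xk; move/eqP: xp; apply; apply: (no_homterval H) => // [|i]; first lra.
  rewrite (divn_eq i n) addnC !iterD (iter_fix _ np).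
  have pI : p - r <= p <= p + r by lra.
  have [h|h] := nc _ (ltn_pmod i n0); first by rewrite mulr_ge0 ?h.
  by rewrite mulr_le0 ?h.
have winc x y : p - r <= x -> x <= y -> y <= p + r -> iter n f x <= iter n f y.
  by move=> x1; rewrite le_eqVlt => /predU1P[->//|xy] y1; apply/ltW/inc.
split; rewrite ltNge; apply/negP => le.
  apply: (same (p - r)); [by rewrite lt_eqF//; lra|lra|].
  move=> k; suff : p - r <= iter (k * n) f (p - r) <= p by lra.
  elim: k => [|k /andP[h1 h2]]; first by rewrite mul0n /=; lra.
  have u1 : p - r <= p - r by []. have u2 : p <= p + r by lra.
  rewrite mulSn iterD; apply/andP; split; first by apply: (le_trans le); apply: winc => //; lra.
  by rewrite -[leRHS]np; apply: winc.
apply: (same (p + r)); [by rewrite gt_eqF//; lra|lra|].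
move=> k; suff : p <= iter (k * n) f (p + r) <= p + r by lra.
elim: k => [|k /andP[h1 h2]]; first by rewrite mul0n /=; lra.
have u1 : p + r <= p + r by []. have u2 : p - r <= p by lra.
rewrite mulSn iterD; apply/andP; split; first by rewrite -[leLHS]np; apply: winc.
by apply: (le_trans _ le); apply: winc => //; lra.
Qed.

(* Let [b = p] and [c -> p] in the cross-ratio of [(p - r, p, c, p + r)]: expansion of
   cross-ratios forces [D >= c (g (p + r) - p)], which exceeds [1] since
   [1 / (p - x) + 1 / (y - p)] decreases when [(x, y)] grows. *)
Lemma cvg_diff_ge (g : R -> R) (p r D : R) : 0 < r -> g p = p ->
  (g y - g p) / (y - p) @[y --> p^'] --> D ->
  {for p, continuous g} ->
  g (p - r) < p - r -> p + r < g (p + r) ->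
  (forall y, p < y -> y < p + r -> p < g y < g (p + r)) ->
  (forall y, p < y -> y < p + r ->
     cross (p - r) p y (p + r) <= cross (g (p - r)) (g p) (g y) (g (p + r))) ->
  1 < D.
Proof.
move=> r0 gp gD cg gu gv inc cr.
set u := p - r in gu cr *; set v := p + r in gv inc cr *.
pose c := (v - u) * (p - g u) / ((p - u) * (v - p) * (g v - g u)).
have up : u < p by rewrite /u; lra. have pv : p < v by rewrite /v; lra.
have den : 0 < (p - u) * (v - p) * (g v - g u) by rewrite !mulr_gt0//; lra.
have c0 : 0 < c by rewrite divr_gt0// mulr_gt0//; lra.
have c1 : 1 < c * (g v - p).
  rewrite /c mulrAC ltr_pdivlMr// mul1r.
  have e1 : 0 < u - g u by lra. have e2 : 0 < g v - v by lra.
  have e3 : 0 < p - u by lra. have e4 : 0 < v - p by lra.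
  have -> : g v - g u = (g v - v) + (v - p) + (p - u) + (u - g u) by ring.
  have -> : v - u = (v - p) + (p - u) by ring.
  have -> : p - g u = (p - u) + (u - g u) by ring.
  have -> : g v - p = (g v - v) + (v - p) by ring.
  move: (u - g u) (g v - v) (p - u) (v - p) e1 e2 e3 e4 => w1 w2 w3 w4 e1 e2 e3 e4.
  rewrite -subr_gt0.
  have -> : (w4 + w3) * (w3 + w1) * (w2 + w4) - w3 * w4 * (w2 + w4 + w3 + w1) =
     w4 * w1 * w4 + w3 * w3 * w2 + w3 * w1 * w2 + w4 * w1 * w2 by ring.
  by rewrite !addr_gt0 ?mulr_gt0.
rewrite ltNge; apply/negP => D1.
pose mid := (1 + c * (g v - p)) / 2.
have m1 : 1 < mid by rewrite /mid; lra. have m2 : mid < c * (g v - p) by rewrite /mid; lra.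
have n1 : \forall y \near p^', (g y - g p) / (y - p) < mid.
  by apply: (cvgr_lt _ gD); apply: le_lt_trans m1.
have cg' : c * (g v - g y) @[y --> p] --> c * (g v - g p).
  by apply: cvgM; [exact: cvg_cst|apply: cvgB; [exact: cvg_cst|exact: cg]].
have n2 : \forall y \near p, mid < c * (g v - g y).
  by apply: (cvgr_gt _ cg'); rewrite gp.
have /nbhs_ballP[s s0 sb] : nbhs p [set y | y != p -> (g y - g p) / (y - p) < mid] by exact: n1.
have /nbhs_ballP[t t0 tb] := n2.
pose h := Num.min r (Num.min s t) / 2.
have mr : Num.min r (Num.min s t) <= r by rewrite ge_min lexx.
have ms : Num.min r (Num.min s t) <= s by rewrite !ge_min lexx orbT.
have mt : Num.min r (Num.min s t) <= t by rewrite !ge_min lexx !orbT.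
have h0 : 0 < h by rewrite divr_gt0// !lt_min r0 s0 t0.
have hm : h < Num.min r (Num.min s t) by rewrite /h; move: h0; rewrite /h; lra.
pose y := p + h.
have py : p < y by rewrite /y; lra. have yv : y < v by rewrite /y /v; lra.
have yp : p - y = - h by rewrite /y; ring.
have {sb} q1 : (g y - g p) / (y - p) < mid.
  apply: sb; last by rewrite gt_eqF.
  by rewrite /ball /= yp normrN gtr0_norm//; lra.
have {tb} q2 : mid < c * (g v - g y).
  by apply: tb; rewrite /ball /= yp normrN gtr0_norm//; lra.
have /andP[gy gyv] := inc y py yv; have := cr y py yv; rewrite gp in q1 *.
rewrite /cross ler_pdivrMr; last by rewrite mulr_gt0//; lra.
rewrite mulrAC ler_pdivlMr; last by rewrite mulr_gt0//; lra.
move=> X; move: q1; rewrite ltr_pdivrMr; last lra.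
move=> q1; have q3 : mid * (y - p) < c * (g v - g y) * (y - p) by rewrite ltr_pM2r//; lra.
have := lt_trans q1 q3; rewrite ltNge => /negP; apply.
have -> : c * (g v - g y) * (y - p) =
    (v - u) * (y - p) * ((p - g u) * (g v - g y)) / ((p - u) * (v - p) * (g v - g u)).
  by rewrite /c; ring.
rewrite ler_pdivrMr//; apply: (le_trans X).
have -> : (g y - p) * ((p - u) * (v - p) * (g v - g u)) =
  (g v - g u) * (g y - p) * ((p - u) * (v - p)) by ring.
by rewrite ler_pM2l ?mulr_gt0//; [rewrite ler_pM2l; lra|lra|lra].
Qed.

Lemma nocritW n u v u' v' : u <= u' -> v' <= v -> nocrit n u v -> nocrit n u' v'.
Proof.
move=> uu vv nc i ni; have sub y : u' <= y <= v' -> u <= y <= v by lra.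
by have [h|h] := nc i ni; [left|right] => y /sub/h.
Qed.

(** The iterate [2 n] is increasing near [p] whatever the orientation of [f^n], and its derivative
    is [D^2]. *)
Lemma periodic_repelling p n (D : R) : -1 < p < 1 -> (0 < n)%N -> iter n f p = p ->
  (iter n f y - iter n f p) / (y - p) @[y --> p^'] --> D -> 1 < `|D|.
Proof.
move=> p1 n0 np gD; pose g := iter n f.
have cg : {for p, continuous g} by exact: pmap_iter_continuous.
have [r0 r00 nc0] := periodic_nocrit (n + n) n0 np.
have mo : smono g (p - r0) (p + r0).
  apply: nocrit_smono; first lra.
  by move=> i ni; apply: nc0; rewrite ltn_addr.
have pgp : p - r0 < g p < p + r0 by rewrite /g np; lra.
have [s s0 sP] : exists2 s : R, 0 < s & forall y, `|p - y| < s -> p - r0 <= g y <= p + r0.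
  have /nbhs_ballP[s s0 sb] : \forall y \near p, p - r0 < g y by apply: (cvgr_gt _ cg); lra.
  have /nbhs_ballP[t t0 tb] : \forall y \near p, g y < p + r0 by apply: (cvgr_lt _ cg); lra.
  exists (Num.min s t); first by rewrite lt_min s0 t0.
  move=> y; rewrite lt_min => /andP[ys yt]; apply/andP; split; first exact/ltW/sb.
  exact/ltW/tb.
pose r := Num.min (Num.min r0 (s / 2)) (Num.min (1 + p) (1 - p)).
have r_gt0 : 0 < r by rewrite /r !lt_min r00 divr_gt0//=; lra.
have rr0 : r <= r0 by rewrite /r !ge_min lexx.
have rs : r <= s / 2 by rewrite /r !ge_min lexx !orbT.
have rp1 : r <= 1 + p by rewrite /r !ge_min lexx !orbT.
have rp2 : r <= 1 - p by rewrite /r !ge_min lexx !orbT.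
have gI y : p - r <= y <= p + r -> p - r0 <= g y <= p + r0.
  by move=> yI; apply: sP; rewrite ltr_norml; apply/andP; split; lra.
have GE y : iter (n + n) f y = g (g y) by rewrite iterD.
have inc x y : p - r <= x -> x < y -> y <= p + r -> iter (n + n) f x < iter (n + n) f y.
  move=> px xy yq; rewrite !GE.
  have /andP[x1 x2] : p - r0 <= g x <= p + r0 by apply: gI; lra.
  have /andP[y1 y2] : p - r0 <= g y <= p + r0 by apply: gI; lra.
  case: mo => mo; [apply: (mo (g x) (g y)) => //|apply: (mo (g y) (g x)) => //]; apply: mo; lra.
have nc : nocrit (n + n) (p - r) (p + r) by apply: nocritW nc0; lra.
have nn0 : (0 < n + n)%N by rewrite addn_gt0 n0.
have Gp : iter (n + n) f p = p by rewrite GE /g !np.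
have [|| gu gv] := periodic_expand nn0 Gp r_gt0 _ _ nc inc; [lra|lra|].
have gn y : p - r < y -> y < p + r -> y != p -> g y != p.
  move=> y1 y2 yp; apply/eqP => gyp; move: yp; rewrite neq_lt => /orP[yp|yp].
    by have := inc y p; rewrite !GE gyp /g !np ltxx => h; have : false by apply: h; lra.
  by have := inc p y; rewrite !GE gyp /g !np ltxx => h; have : false by apply: h; lra.
have near_r : \forall y \near p^', p - r < y < p + r.
  apply/nbhs_ballP; exists r => //= y; rewrite /ball /= ltr_distlC => yr _; lra.
(* Near [p] the value [p] is taken at [p] only, so the difference quotient of [g] may be composed
   with [g]. *)
have gcv : g y @[y --> p^'] --> p^'.
  move=> B /nbhs_ballP[t t0 tb].
  have /nbhs_ballP[t' t'0 tb'] : \forall y \near p, `|p - g y| < t.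
    have cd : `|p - g y| @[y --> p] --> `|p - g p|.
      by apply: cvg_norm; apply: cvgB; [exact: cvg_cst|exact: cg].
    by apply: (cvgr_lt _ cd); rewrite /g np subrr normr0.
  apply/nbhs_ballP; exists (Num.min r t'); first by rewrite /= lt_min r_gt0.
  move=> z; rewrite /ball /= lt_min => /andP[yr yt] yp; apply: tb; first exact: tb'.
  by move: yr; rewrite ltr_distlC => /andP[y1 y2]; apply: gn => //; lra.
have DD : (iter (n + n) f y - iter (n + n) f p) / (y - p) @[y --> p^'] --> D * D.
  have q1 : (g (g y) - g p) / (g y - p) @[y --> p^'] --> D.
    exact: (@cvg_comp _ _ _ g (fun z => (g z - g p) / (z - p)) _ _ _ gcv gD).
  apply: cvg_trans (cvgM q1 gD); apply: near_eq_cvg.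
  have neq : \forall y \near p^', y != p by exact: withinT.
  near=> y.
  have yp : y != p by near: y.
  have /andP[yr1 yr2] : p - r < y < p + r by near: y.
  have gyp := gn y yr1 yr2 yp.
  have gpE : g p = p by [].
  have -> : iter (n + n) f y = g (g y) by [].
  rewrite Gp; transitivity ((g (g y) - p) / (g y - p) * ((g y - p) / (y - p))); last first.
    by field; rewrite !subr_eq0 yp gyp.
  by rewrite /= -/g gpE.
have lt1 : 1 < D * D.
  apply: (cvg_diff_ge r_gt0 Gp DD _ gu gv).
  - exact: pmap_iter_continuous.
  - move=> y py yv; have h1 : p < iter (n + n) f y by rewrite -{1}Gp; apply: inc; lra.
    by rewrite h1/=; apply: inc; lra.
  - by move=> y py yv; apply: (nocrit_cross nc); lra.
rewrite ltNge; apply/negP => D1.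
have : `|D| * `|D| <= 1 * 1 by apply: ler_pM.
by rewrite -normrM mulr1 => /(le_trans (ler_norm _)); rewrite leNgt lt1.
Unshelve. all: by end_near.
Qed.

End Repelling.

(** * The odometer *)

Definition three (i : nat) : nat := 3.
Local Notation odo := (@adding_machine three).

Implicit Types al be ga : Delta three.

Section OdometerDigits.
Local Open Scope nat_scope.

(** The residue modulo [3^n] of the 3-adic integer with digits [al]. *)
Definition odoval al n : nat := \sum_(i < n) (al i : 'I_3) * 3 ^ i.

Lemma odovalS al n : odoval al n.+1 = (odoval al n + (al n : 'I_3) * 3 ^ n)%N.
Proof. by rewrite /odoval big_ord_recr. Qed.

Lemma odoval_lt al n : (odoval al n < 3 ^ n)%N.
Proof.
elim: n => [|n IH]; first by rewrite /odoval big_ord0.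
rewrite odovalS expnS; have := ltn_ord (al n : 'I_3); move: IH.
by move: (nat_of_ord _) (3 ^ n)%N (odoval al n) => u v w; clear; nia.
Qed.

Lemma odoval_mod al n k : odoval al (n + k) = odoval al n %[mod 3 ^ n].
Proof.
elim: k => [|k IH]; first by rewrite addn0.
rewrite addnS odovalS; have /dvdnP[u ->] : (3 ^ n %| 3 ^ (n + k))%N by rewrite dvdn_exp2l ?leq_addr.
by rewrite mulnA addnC modnMDl.
Qed.

Lemma odo_carry al n : if [forall j : 'I_n, (al j : 'I_3).+1 == 3%N]
  then odoval al n + 1 = 3 ^ n /\ odoval (odo al) n = 0%N
  else odoval (odo al) n = (odoval al n + 1)%N.
Proof.
elim: n => [|n IH].
  case: ifP; first by rewrite /odoval !big_ord0 expn0.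
  by move/negbT/negP; case; apply/forallP => -[].
have all3 : [forall j : 'I_n.+1, (al j : 'I_3).+1 == 3%N] =
    [forall j : 'I_n, (al j : 'I_3).+1 == 3%N] && ((al n : 'I_3).+1 == 3%N).
  apply/forallP/andP => [h|[/forallP h hn] j].
    split; last exact: (h ord_max).
    by apply/forallP => j; exact: (h (widen_ord (leqnSn n) j)).
  have [jn|jn] := ltnP j n; first exact: (h (Ordinal jn)).
  by have -> : nat_of_ord j = n by apply/eqP; rewrite eqn_leq -ltnS ltn_ord jn.
rewrite all3 !odovalS expnS {2 4}/adding_machine.
move: IH; case: ifP => [_ [IH1 IH2]|_ IH] /=.
  rewrite IH2; have := ltn_ord (al n : 'I_3); case: eqP => [[->] _|n2 n3].
    by split; [move: IH1; lia|rewrite modnn].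
  rewrite modn_small; last by move: n2 n3; rewrite /three; lia.
  by rewrite add0n mulSn -{1}IH1 addnAC.
by rewrite IH addnAC.
Qed.

Lemma odoval_odo al n : odoval (odo al) n = odoval al n + 1 %[mod 3 ^ n].
Proof. by have := odo_carry al n; case: ifP => [_ [-> ->]|_ ->] //; rewrite modnn mod0n. Qed.

Lemma odoval_iter al j n : odoval (iter j odo al) n = odoval al n + j %[mod 3 ^ n].
Proof.
elim: j => [|j IH]; first by rewrite addn0.
by rewrite iterS odoval_odo -modnDml IH modnDml -addnA addn1.
Qed.

Lemma odoval_inj al be : (forall n, odoval al n = odoval be n) -> al = be.
Proof.
move=> e; apply: functional_extensionality_dep => i; apply/val_inj => /=.
have := e i.+1; rewrite !odovalS e => /addnI/eqP; rewrite eqn_pmul2r ?expn_gt0//.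
by move/eqP.
Qed.

Lemma odoval_eq_digits al be n : (forall i, (i < n)%N -> al i = be i) -> odoval al n = odoval be n.
Proof. by move=> e; apply: eq_bigr => i _; rewrite e. Qed.

End OdometerDigits.

(** * The coding of an orbit with Toeplitz sign sequence by 3-adic integers *)

Section Odometer.
Context {R : realType} (F : R -> R) (c : R).
Local Notation C t := (iter t F c).
Hypothesis F_cont : continuous F.
Hypothesis orbit_close : forall e : R, 0 < e -> exists n, forall t t', (0 < t)%N -> (0 < t')%N ->
  t = t' %[mod 3 ^ n] -> `|C t - C t'| < e.
Hypothesis orbit_sign : forall t, (0 < t)%N -> 0 < (-1) ^+ kneadneg t * (C t - c).
Hypothesis value_uniq : forall y, F y = F c -> y = c.

(** A time in the residue class of [al] modulo [3^n]. Adding [3^n] makes it positive, as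
    [orbit_close] requires, and lets it tend to infinity, as membership in the omega-limit set
    requires. *)
Definition odotime al n : nat := (odoval al n + 3 ^ n)%N.

Lemma odotime_mod al n k : odotime al (n + k) = odoval al n %[mod 3 ^ n].
Proof. by rewrite /odotime expnD addnC mulnC modnMDl odoval_mod. Qed.

Lemma odotime_mod_le al n k : (n <= k)%N -> odotime al k = odoval al n %[mod 3 ^ n].
Proof. by move=> nk; rewrite -(subnKC nk) odotime_mod. Qed.

Lemma odotime_gt0 al n : (0 < odotime al n)%N.
Proof. by rewrite addn_gt0 expn_gt0 orbT. Qed.

Lemma odotime_ge al n : (n <= odotime al n)%N.
Proof. by apply: leq_trans (leq_addl _ _); exact/ltnW/ltn_expl. Qed.

Definition odolim al : R := lim (C (odotime al n) @[n --> \oo]).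
Local Notation h := odolim.

Lemma odolim_cvg al : C (odotime al n) @[n --> \oo] --> h al.
Proof.
apply/cauchy_cvgP; apply: cauchy_exP => e e0; have [n close] := orbit_close e0.
exists (C (odotime al n)); exists n => // k /= nk; apply: close; try exact: odotime_gt0.
by rewrite (odotime_mod_le al nk) (odotime_mod_le al (leqnn n)).
Qed.

Lemma odolim_close (e : R) : 0 < e -> exists n, forall al t, (0 < t)%N ->
  t = odoval al n %[mod 3 ^ n] -> `|C t - h al| <= e.
Proof.
move=> e0; have [n close] := orbit_close e0; exists n => al t t0 tn.
rewrite leNgt; apply/negP => te.
have d0 : 0 < `|C t - h al| - e by rewrite subr_gt0.
have /cvgrPdist_lt/(_ _ d0)[N _ NP] := @odolim_cvg al.
have h1 : `|h al - C (odotime al (maxn n N))| < `|C t - h al| - e := NP (maxn n N) (leq_maxr n N).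
have h2 : `|C t - C (odotime al (maxn n N))| < e.
  by apply: close => //; [exact: odotime_gt0|rewrite tn odotime_mod_le// leq_maxl].
have := ler_distD (C (odotime al (maxn n N))) (C t) (h al).
by rewrite [`|C (odotime _ _) - h al|]distrC; lra.
Qed.

Lemma odolim_odo al : h (odo al) = F (h al).
Proof.
have h1 : C (odotime al n).+1 @[n --> \oo] --> F (h al).
  by apply: (cvg_comp _ F (@odolim_cvg al)); exact: F_cont.
suff h2 : C (odotime al n).+1 @[n --> \oo] --> h (odo al) by exact: (cvg_unique _ h2 h1).
apply/cvgrPdist_le => e e0; have [n close] := odolim_close e0.
exists n => // k nk; rewrite distrC; apply: (close _ (odotime al k).+1 isT).
by rewrite odoval_odo -addn1 -modnDml odotime_mod_le// modnDml.
Qed.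

Lemma odolim_iter j al : iter j F (h al) = h (iter j odo al).
Proof. by elim: j => //= j ->; rewrite odolim_odo. Qed.

Definition odozero : Delta three := fun i => (ord0 : 'I_3).

Lemma odoval_zero n : odoval odozero n = 0%N.
Proof. by rewrite /odoval big1. Qed.

(** [orbit_close] covers positive times only; time 0 is recovered from time 1 by [value_uniq]. *)
Lemma orbit_odolim t : C t = h (iter t odo odozero).
Proof.
have P s : (0 < s)%N -> C s = h (iter s odo odozero).
  move=> s0; apply/eqP; rewrite -subr_eq0 -normr_le0; apply/ler_addgt0Pl => e e0.
  have [n close] := odolim_close e0; rewrite addr0; apply: close => //.
  by rewrite odoval_iter odoval_zero.
case: t => [|t]; last exact: P.
by apply/esym/value_uniq; rewrite /= -odolim_odo -(P 1%N).
Qed.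

Lemma odo_cyl al n : nbhs al [set be | forall i, (i < n)%N -> be i = al i].
Proof.
elim: n => [|n IH]; first by apply: filterS filterT => be _ i.
have pn : nbhs al [set be | be n = al n].
  exact: (@proj_continuous nat (fun i => discrete_topology 'I_(three i)) n al _ (discrete_set1 (al n))).
apply: (filterS _ (filterI IH pn)) => be [h1 h2] i; rewrite ltnS leq_eqVlt => /predU1P[->|]; [exact: h2|exact: h1].
Qed.

Lemma odolim_dist (e : R) : 0 < e -> exists n, forall al be, odoval al n = odoval be n %[mod 3 ^ n] ->
  `|h al - h be| < e.
Proof.
move=> e0; have e3 : 0 < e / 3 by rewrite divr_gt0.
have [n close] := odolim_close e3; exists n => al be ab.
have h1 := close al _ (odotime_gt0 al n) (odotime_mod_le al (leqnn n)).
have h2 := close be _ (odotime_gt0 al n) (etrans (odotime_mod_le al (leqnn n)) ab).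
have := ler_distD (C (odotime al n)) (h al) (h be).
by rewrite (distrC (h al) (C (odotime al n))); lra.
Qed.

Lemma odolim_continuous : continuous h.
Proof.
move=> al B /nbhs_ballP[e e0 eB]; have [n close] := odolim_dist e0.
have := odo_cyl al n; apply: filterS => be bi; apply: eB; apply: close.
by rewrite (odoval_eq_digits bi).
Qed.

(** A limit away from [c] shares its side with all orbit points close to it, in particular with a
    whole residue class of times. *)
Lemma odolim_sign al j : iter j F (h al) != c -> exists n, forall t, (0 < t)%N ->
  t = odoval al n + j %[mod 3 ^ n] -> kneadneg t = (iter j F (h al) < c).
Proof.
move=> jc; have d0 : 0 < `|iter j F (h al) - c| / 2.
  by rewrite divr_gt0// normr_gt0 subr_eq0.
have [n close] := odolim_close d0; exists n => t t0 tj.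
have := close (iter j odo al) t t0; rewrite odoval_iter -odolim_iter => /(_ tj) ct {tj close}.
have := orbit_sign t0; move: ct d0; set p := iter j F (h al); set q := C t.
have [pc|pc] := ltP p c.
  have -> : `|p - c| = c - p by rewrite ltr0_norm ?opprB ?subr_lt0.
  rewrite ler_norml => /andP[_ h1] _; case: kneadneg => //.
  by rewrite mul1r => h2; exfalso; lra.
have -> : `|p - c| = p - c by rewrite ger0_norm ?subr_ge0.
rewrite ler_norml => /andP[h1 _] h0; case: kneadneg => //.
by rewrite mulN1r => h2; exfalso; lra.
Qed.

(* The signs along the orbit of [h al] determine those times [t] near [al] at which the
   sign sequence restarts, i.e. the residues of [al] ([kneadneg_recog]). *)
Lemma odolim_inj : injective h.
Proof.
move=> al be hab; apply: odoval_inj => N.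
(* After a visit to [c] the orbit is that of [c], which does not return. *)
have [j0 j0P] : exists j0, forall j, (j0 <= j)%N -> iter j F (h al) != c.
  have [[j jc]|nj] := pselect (exists j, iter j F (h al) = c); last first.
    by exists 0%N => j _; apply/eqP => jc; apply: nj; exists j.
  exists j.+1 => i ji; rewrite -(subnK ji) addnS -addSn iterD jc.
  have := orbit_sign (ltn0Sn (i - j.+1)); apply: contraTneq => ->.
  by rewrite subrr mulr0 ltxx.
(* Room for a multiple of [3^(N+2)] after [j0], followed by the window of length [3^(N+1)] that
   [kneadneg_recog] inspects. *)
pose W := (j0 + 3 ^ N.+2 + 3 ^ N.+1)%N.
have [n nP] : exists n, forall j, (j0 <= j < W)%N -> forall t, (0 < t)%N ->
    t = odoval al n + j %[mod 3 ^ n] \/ t = odoval be n + j %[mod 3 ^ n] ->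
    kneadneg t = (iter j F (h al) < c).
  elim: W => [|w [n nP]]; first by exists 0%N => j; rewrite ltn0 andbF.
  have [jw|wj] := leqP j0 w; last first.
    exists 0%N => j /andP[j1 j2]; have := leq_ltn_trans j1 j2.
    by rewrite ltnS leqNgt wj.
  have wc := j0P w jw; have [n1 sP1] := odolim_sign wc.
  rewrite hab in wc; have [n2 sP2] := odolim_sign wc.
  pose n' := maxn n (maxn n1 n2).
  have redu i ga u t : (i <= n')%N -> t = odoval ga n' + u %[mod 3 ^ n'] -> t = odoval ga i + u %[mod 3 ^ i].
    move=> ii e; have dd : (3 ^ i %| 3 ^ n')%N by rewrite dvdn_exp2l.
    rewrite -(modn_dvdm t dd) e (modn_dvdm _ dd) -modnDml -(subnKC ii) odoval_mod.
    by rewrite modnDml.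
  have i0 : (n <= n')%N by rewrite leq_maxl.
  have i1 : (n1 <= n')%N by rewrite /n' leq_max leq_maxl orbT.
  have i2 : (n2 <= n')%N by rewrite /n' leq_max leq_maxr orbT.
  exists n' => j; rewrite ltnS => /andP[j1]; rewrite leq_eqVlt => /predU1P[->|j2] t t0 tn; last first.
    by apply: (nP j _ t t0); [rewrite j1|case: tn => e; [left|right]; exact: redu e].
  by case: tn => e; [apply: sP1 => //|rewrite hab; apply: sP2 => //]; exact: redu e.
pose M := maxn n N.+2.
have nM : (n <= M)%N by rewrite leq_maxl. have NM : (N.+2 <= M)%N by rewrite leq_maxr.
pose u := odotime al M; pose u' := odotime be M.
have win j : (j0 <= j < W)%N -> kneadneg (u + j) = kneadneg (u' + j).
  move=> jW; have g1 : (0 < u + j)%N by rewrite addn_gt0 odotime_gt0.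
  have g2 : (0 < u' + j)%N by rewrite addn_gt0 odotime_gt0.
  have e1 : (u + j)%N = (odoval al n + j)%N %[mod 3 ^ n].
    by rewrite -modnDml (odotime_mod_le al nM) modnDml.
  have e2 : (u' + j)%N = (odoval be n + j)%N %[mod 3 ^ n].
    by rewrite -modnDml (odotime_mod_le be nM) modnDml.
  by rewrite (nP j jW _ g1 (or_introl e1)) (nP j jW _ g2 (or_intror e2)).
(* At [u + s] the first sequence copies its beginning throughout the window. The second one has the
   same signs, so [kneadneg_recog] shows that [3^N] divides [u' + s]. *)
have [s [s1 s2 s3]] : exists s, [/\ (j0 <= s)%N, (s < j0 + 3 ^ N.+2)%N & (3 ^ N.+2 %| u + s)%N].
  have p0 : (0 < 3 ^ N.+2)%N by rewrite expn_gt0.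
  pose r := ((u + j0) %% 3 ^ N.+2)%N; have rl : (r < 3 ^ N.+2)%N by rewrite ltn_pmod.
  have [r0|r0] := posnP r.
    by exists j0; split => //; [rewrite -{1}[j0]addn0 ltn_add2l|rewrite /dvdn -/r r0].
  exists (j0 + (3 ^ N.+2 - r))%N; split; first exact: leq_addr.
    by rewrite ltn_add2l ltn_subrL r0.
  by rewrite addnA /dvdn -modnDml -/r subnKC ?modnn// ltnW.
have u'N : (3 ^ N %| u' + s)%N.
  apply: kneadneg_recog; first by rewrite addn_gt0 odotime_gt0.
  move=> j /andP[j0' jN]; rewrite -addnA -win; last first.
    rewrite (leq_trans s1 (leq_addr _ _)) /W /=; move: jN; rewrite -expnSr => jN.
    by apply: leq_trans (_ : (s + j < s + 3 ^ N.+1)%N) _; rewrite ?ltn_add2l// leq_add2r ltnW.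
  apply/esym; apply: (@kneadneg_mod N.+1).
    by apply/negP => /dvdn_leq => /(_ j0'); rewrite leqNgt expnSr jN.
  by rewrite addnA -modnDml (eqP s3).
have uN : (3 ^ N %| u + s)%N by apply: dvdn_trans s3; rewrite dvdn_exp2l// ltnW.
have NM' : (N <= M)%N by apply: leq_trans NM; rewrite leqW.
have : (u + s = u' + s %[mod 3 ^ N])%N by rewrite (eqP uN) (eqP u'N).
move/eqP; rewrite eqn_modDr => /eqP; rewrite (odotime_mod_le al NM') (odotime_mod_le be NM').
by rewrite !modn_small// odoval_lt.
Qed.

End Odometer.

(** * The omega-limit set as a minimal Cantor set *)

Section OdometerSet.
Context {R : realType} (F : R -> R) (c : R).
Local Notation C t := (iter t F c).
Hypothesis F_cont : continuous F.
Hypothesis orbit_close : forall e : R, 0 < e -> exists n, forall t t', (0 < t)%N -> (0 < t')%N ->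
  t = t' %[mod 3 ^ n] -> `|C t - C t'| < e.
Hypothesis orbit_sign : forall t, (0 < t)%N -> 0 < (-1) ^+ kneadneg t * (C t - c).
Hypothesis value_uniq : forall y, F y = F c -> y = c.

Local Notation h := (odolim F c).
Local Notation X := (omega F c).

Let hcvg := odolim_cvg orbit_close.
Let hclose := odolim_close orbit_close.
Let hdist := odolim_dist orbit_close.
Let hcont := odolim_continuous orbit_close.
Let hiter := odolim_iter F_cont orbit_close.
Let horbit := orbit_odolim F_cont orbit_close value_uniq.
Let hinj := odolim_inj F_cont orbit_close orbit_sign.

Lemma Delta_compact : compact [set: Delta three].
Proof.
have := @tychonoff nat (fun i => discrete_topology 'I_(three i)) (fun=> setT).
have -> : [set f : forall i, discrete_topology 'I_(three i) | forall i, setT (f i)] = setT.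
  by apply/seteqP; split.
apply=> i; apply: finite_compact; exact: finite_finset.
Qed.

Lemma range_closed : closed (range h).
Proof.
apply: compact_closed; first exact: Rhausdorff.
by apply: continuous_compact Delta_compact; exact: continuous_subspaceT.
Qed.

(** The orbit lies in the closed set [range h]; conversely each [h al] is a limit along the times
    [odotime al n], which tend to infinity. *)
Lemma omega_range : X = range h.
Proof.
apply/seteqP; split => [q qX|_ [al _ <-]].
  apply: range_closed => B nB; have tail : (iter n F c @[n --> \oo]) (range h).
    by exists 0%N => // n _ /=; rewrite horbit; exists (iter n odo odozero).
  exact: qX tail nB.
move=> B D [N _ NB] nD; have [M _ MD] := hcvg (al := al) nD.
exists (iter (odotime al (maxn N M)) F c); split.
  by apply: NB => /=; apply: leq_trans (odotime_ge al _); rewrite leq_maxl.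
by apply: MD => /=; rewrite leq_maxr.
Qed.

Lemma omega_compact : compact X.
Proof.
by rewrite omega_range; apply: continuous_compact Delta_compact; exact: continuous_subspaceT.
Qed.

Lemma orbit_omega t : X (iter t F c).
Proof. by rewrite omega_range horbit; exists (iter t odo odozero). Qed.

Lemma omega_near x :
  (forall e : R, 0 < e -> exists T, forall t, (T <= t)%N -> exists s, `|iter t F x - iter s F c| < e) ->
  omega F x `<=` X.
Proof.
move=> nx q qx; rewrite omega_range; apply: contrapT => nq.
have /nbhs_ballP[r /= r0 rb] : nbhs q (~` range h).
  by apply: open_nbhs_nbhs; split => //; apply: closed_openC; exact: range_closed.
have r2 : 0 < r / 2 by rewrite divr_gt0.
have [T TP] := nx _ r2.
have tail : (iter n F x @[n --> \oo]) [set y | exists s, `|y - iter s F c| < r / 2].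
  by exists T => // n /= /TP.
have [y [[s ys] qy]] := qx _ _ tail (nbhsx_ballx q _ r2).
apply: (rb (iter s F c)); last by rewrite horbit; exists (iter s odo odozero).
have := ler_distD y q (iter s F c); move: qy; rewrite /ball /= => qy.
by move=> /le_lt_trans; apply; lra.
Qed.

Lemma omega_image : F @` X `<=` X.
Proof.
by rewrite omega_range => _ [_ [al _ <-] <-]; rewrite -(odolim_odo F_cont orbit_close); exists (odo al).
Qed.

Lemma omega_minimal Y : closed Y -> Y !=set0 -> F @` Y `<=` Y -> Y `<=` X -> Y = X.
Proof.
move=> cY [y0 Yy0] FY YX; apply/seteqP; split => //.
have := YX _ Yy0; rewrite omega_range => -[al _ yE]; rewrite -yE in Yy0 => _ [be _ <-].
have Yj j : Y (h (iter j odo al)).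
  elim: j => [//|j IH]; rewrite iterS (odolim_odo F_cont orbit_close); apply: FY.
  by exists (h (iter j odo al)).
apply: cY => B /nbhs_ballP[e e0 eB]; have [n close] := hdist e0.
(* The number of steps that carries the first [n] digits of [al] to those of [be]. *)
exists (h (iter (odoval be n + (3 ^ n - odoval al n)) odo al)); split => //; apply: eB; apply: close.
rewrite odoval_iter addnCA subnKC; last exact/ltnW/odoval_lt.
by rewrite modnDr.
Qed.

Definition odocode (x : R) : Delta three := xget odozero [set al | h al = x].

Lemma odocodeK : cancel h odocode.
Proof.
by move=> al; rewrite /odocode; case: xgetP => [be _ /hinj//|/(_ al)]; case.
Qed.

Lemma odocode_continuous : {within X, continuous odocode}.
Proof.
apply/subspace_continuousP => x; rewrite omega_range => -[al _ <-].
move=> W nW0; have nW : nbhs al W by rewrite -[al]odocodeK.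
pose D := h @` (~` W°).
have cD : closed D.
  apply: compact_closed; first exact: Rhausdorff.
  apply: continuous_compact; first exact: continuous_subspaceT.
  apply: (subclosed_compact _ Delta_compact) => //.
  by apply: open_closedC; exact: open_interior.
have nD : nbhs (h al) (~` D).
  apply: open_nbhs_nbhs; split; first exact: closed_openC.
  by move=> [be nbe /hinj bal]; apply: nbe; rewrite bal.
have := nD; apply: filterS => y yD [be _ beE].
have kb : odocode y = be by rewrite -beE odocodeK.
change (W (odocode y)); rewrite kb; apply: contrapT => nW'; apply: yD; exists be => //.
by move=> /interior_subset.
Qed.

Lemma orbit_inj s t : iter s F c = iter t F c -> s = t.
Proof.
rewrite !horbit => /hinj e; have M n : s = t %[mod 3 ^ n].
  have := odoval_iter odozero s n; rewrite e odoval_iter odoval_zero !add0n => ->.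
  by [].
have := M (s + t)%N; have st : (s + t < 3 ^ (s + t))%N by exact: ltn_expl.
by rewrite !modn_small// (leq_ltn_trans _ st)// (leq_addr, leq_addl).
Qed.

Lemma omega_cantor : cantor_set X.
Proof.
split.
- by exists (iter 0 F c); exact: orbit_omega.
- exact: omega_compact.
- split; first by rewrite omega_range; exact: range_closed.
  apply/seteqP; split => [x lx|x].
    rewrite omega_range; apply: range_closed => B nB; have [y [_ Xy By]] := lx B nB.
    by exists y; split => //; rewrite -omega_range.
  rewrite {1}omega_range => -[al _ <-] U nU; have [M _ MD] := hcvg (al := al) nU.
  have inU n : (M <= n)%N -> U (iter (odotime al n) F c) by exact: MD.
  (* Orbit points at different times are distinct, so at most one of two successive approximations
     can be the limit itself. *)
  have [e|ne] := eqVneq (iter (odotime al M) F c) (h al); last first.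
    by exists (iter (odotime al M) F c); split => //; [exact: orbit_omega|exact: inU].
  exists (iter (odotime al M.+1) F c); split; [|exact: orbit_omega|exact: inU].
  apply/eqP; rewrite -e => /orbit_inj; rewrite /odotime odovalS expnS.
  have := expn_gt0 3 M; rewrite /= => p0 q; have : (3 ^ M + 3 ^ M <= 0)%N.
    move: q p0; move: (3 ^ M)%N (odoval al M) (nat_of_ord _) => u v w; clear; nia.
  by rewrite leqn0 addn_eq0 -leqn0 leqNgt p0.
- have tD : totally_disconnected [set: Delta three].
    apply: zero_dimension_totally_disconnected; apply: zero_dimension_prod => i.
    exact: discrete_zero_dimension.
  move=> x Xx; apply/seteqP; split => [y [B [Bx BX cB] By]|_ ->]; last first.
    exists [set x] => //; split => //; [by move=> _ ->|exact: connected1].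
  have cB' : connected (odocode @` B).
    apply: connected_continuous_connected => //.
    exact: continuous_subspaceW odocode_continuous.
  have kx : (odocode @` B) (odocode x) by exists x.
  have sub := connected_component_max kx (@subsetT _ _) cB'.
  have : connected_component [set: Delta three] (odocode x) (odocode y) by apply: sub; exists y.
  rewrite tD// => /= kxy; have := BX _ By; have := Xx; rewrite omega_range => -[al _ alE] [be _ beE].
  by move: kxy; rewrite -alE -beE !odocodeK => ->.
Qed.

Lemma omega_conjugate : conjugate_on F X (@adding_machine three).
Proof.
exists h, odocode; split.
- split.
  + by move=> al _; rewrite omega_range; exists al.
  + by move=> al be _ _; exact: hinj.
  + by move=> x; rewrite omega_range => -[al _ <-]; exists al.
- exact: odocodeK.
- exact: hcont.
- exact: odocode_continuous.
- exact: odolim_odo.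
Qed.

(** The odometer preserves congruence modulo [3^n], so points with equal first digits stay within
    the bound of [odolim_dist] forever. *)
Lemma omega_equicontinuous : equicontinuous_on F X.
Proof.
move=> x E; rewrite -entourage_from_ballE => -[e /= e0 eE]; have [n close] := hdist e0.
have Xx : X (set_val x) := set_valP x; have := Xx; rewrite {1}omega_range => -[al _ alE].
have kx : odocode (set_val x) = al by rewrite -alE odocodeK.
have cyl : nbhs (odocode (set_val x)) [set be : Delta three | forall i, (i < n)%N -> be i = al i].
  by rewrite kx; exact: odo_cyl.
have := odocode_continuous; move=> /subspace_continuousP/(_ _ Xx)/(_ _ cyl) nb.
have nx : \forall y \near x, forall i, (i < n)%N -> odocode (set_val y) i = al i.
  have := @initial_continuous _ _ (@set_val _ X) x _ nb.
  rewrite nbhs_simpl /= => nx; near=> y.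
  have /= := near nx y.
  move=> h1 i i_n; exact: (h1 _ (set_valP y) i i_n).
near=> y => i _; apply: eE.
have yP : forall i, (i < n)%N -> odocode (set_val y) i = al i by near: y.
have : X (set_val y) := set_valP y; rewrite {1}omega_range => -[be _ beE].
have ky : odocode (set_val y) = be by rewrite -beE odocodeK.
rewrite ky in yP.
rewrite /= -alE -beE !hiter /ball /=; apply: close.
by rewrite !odoval_iter -[in LHS]modnDml -[in RHS]modnDml (odoval_eq_digits yP).
Unshelve. all: by end_near.
Qed.

End OdometerSet.

(** * Derivatives relative to a set *)

Section PolyDerive.
Context {R : realType}.
Implicit Types (A : set R) (p : {poly R}) (g : R -> R).

Lemma horner_continuous p : continuous (horner p).
Proof. exact: continuous_horner. Qed.

Lemma poly_diff_quot p x : (p.[y] - p.[x]) / (y - x) @[y --> x^'] --> p^`().[x].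
Proof.
have /factor_theorem[q qE] : root (p - p.[x]%:P) x by rewrite /root !hornerE subrr.
have -> : p^`().[x] = q.[x].
  have := congr1 (fun r : {poly R} => r^`().[x]) qE.
  by rewrite /= derivB derivC subr0 derivM derivXsubC !hornerE subrr mulr0 add0r.
have qc : q.[y] @[y --> x^'] --> q.[x].
  by apply: cvg_trans (horner_continuous (x := x)); apply: cvg_app; exact: cvg_within.
apply: cvg_trans qc; apply: near_eq_cvg.
have neq : \forall y \near x^', y != x by exact: withinT.
near=> y; have yx : y != x by near: y.
have := congr1 (fun r : {poly R} => r.[y]) qE; rewrite /= !hornerE => ->.
by rewrite mulfK// subr_eq0.
Unshelve. all: by end_near.
Qed.

(** Without isolated points the punctured filter within [A] is proper, and relative derivatives are
    unique. *)
Definition thick A := forall x r, A x -> 0 < r -> exists y, [/\ A y, y != x & `|x - y| < r].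

Lemma thick_proper A x : thick A -> A x -> ProperFilter (within A x^').
Proof.
move=> tA Ax; apply: Build_ProperFilter_ex => B /nbhs_ballP[r r0 rB].
have [y [Ay yx xy]] := tA x r Ax r0; exists y; exact: rB.
Qed.

Lemma derive_in_poly A g p x : thick A -> A x -> (forall y, A y -> g y = p.[y]) ->
  derivable_in A g x /\ derive_in A g x = p^`().[x].
Proof.
move=> tA Ax gp; have PF := thick_proper tA Ax.
have cv : diff_quot g x @ within A x^' --> p^`().[x].
  have pq : (p.[y] - p.[x]) / (y - x) @[y --> within A x^'] --> p^`().[x].
    by apply: cvg_trans (@poly_diff_quot p x); apply: cvg_app; exact: cvg_within.
  apply: cvg_trans pq; apply: near_eq_cvg.
  have inA : \forall y \near within A x^', A y by exact: withinT.
  near=> y; have Ay : A y by near: y.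
  by rewrite /diff_quot !gp.
split; first by apply/cvg_ex; exists p^`().[x].
exact: cvg_lim cv.
Unshelve. all: by end_near.
Qed.

Lemma derive_in_iter A g p k : thick A -> (forall y, A y -> g y = p.[y]) ->
  forall y, A y -> iter k (derive_in A) g y = p^`(k).[y].
Proof.
move=> tA gp; elim: k => [|k IH] y Ay; first by rewrite derivn0 /= gp.
by rewrite iterS derivnS; have [_ ->] := derive_in_poly tA Ay IH.
Qed.

Lemma Cn_on_poly A n g p : thick A -> (forall y, A y -> g y = p.[y]) -> Cn_on A n g.
Proof.
move=> tA gp; split => [k x _ Ax|].
  by have [] := derive_in_poly tA Ax (derive_in_iter k tA gp).
apply: (@subspace_eq_continuous _ _ _ (horner p^`(n))).
  by move=> y /set_mem Ay; exact/esym/(derive_in_iter n tA gp Ay).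
by apply: continuous_subspaceT; exact: horner_continuous.
Qed.

Lemma thick_setT : thick [set: R].
Proof.
move=> x r _ r0; exists (x + r / 2); split => //.
  by rewrite -subr_eq0 addrC addKr gt_eqF ?divr_gt0.
by rewrite opprD addrA subrr add0r normrN gtr0_norm ?divr_gt0//; lra.
Qed.

Lemma thick_I01 : thick (I01 R).
Proof.
move=> x r; rewrite /I01 /= in_itv/= => /andP[x0 x1] r0.
pose e := Num.min r 1 / 2; have m1 : Num.min r 1 <= 1 by rewrite ge_min lexx orbT.
have mr : Num.min r 1 <= r by rewrite ge_min lexx.
have m0 : 0 < Num.min r 1 by rewrite lt_min r0 ltr01.
have e0 : 0 < e by rewrite divr_gt0.
have [x2|x2] := leP x (1 / 2).
  exists (x + e); split; [rewrite in_itv/=; rewrite /e in e0 *; lra| |].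
    by rewrite -subr_eq0 addrC addKr gt_eqF.
  by rewrite opprD addrA subrr add0r normrN gtr0_norm// /e; lra.
exists (x - e); split; [rewrite in_itv/=; rewrite /e in e0 *; lra| |].
  by rewrite -subr_eq0 addrC addKr oppr_eq0 gt_eqF.
by rewrite opprB addrC subrK gtr0_norm// /e; lra.
Qed.

Lemma thick_punctured c : thick (I01 R `\ c).
Proof.
move=> x r [Ix xc] r0; have d0 : 0 < `|x - c| by rewrite normr_gt0 subr_eq0; exact/eqP.
have m0 : 0 < Num.min r `|x - c| by rewrite lt_min r0.
have [y [Iy yx]] := thick_I01 Ix m0; rewrite lt_min => /andP[yr yc].
exists y; split => //; split => // yE.
by move: yc; rewrite yE ltxx.
Qed.

End PolyDerive.

(** * The map on the unit interval *)

Section Model.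
Context {R : realType} (m : nat) (a A b : R) (K J : nat).
Hypothesis H : tame m a A b K J.
Implicit Types (x y : R).

Local Notation l := (2 ^ m)%N.
Local Notation lr := ((2 ^ m)%:R : R).
Local Notation Q := kneadQ.
Local Notation S := cuttime.
Local Notation gk := (gk m a).
Local Notation th := (th m a).
Local Notation Lk := (Lk m a).
Local Notation Mk := (Mk m a).
Local Notation Zk := (Zk m a).
Local Notation Yk := (Yk m a).

Let a0 := tame_a0 H.
Let a1 := tame_a1 H.
Let admK := tame_adm H.
Arguments admK : clear implicits.

Local Notation f := (pmap m a).
Local Notation crit := (crit m a).

Definition phi01 x : R := (1 + x) / 2.
Definition model y : R := phi01 (f (2 * y - 1)).
Local Notation F := model.
Definition turn : R := 1 / 2.

Let lam : R := (1 + a) / 2.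
Let a_ge := tame_a H.

Lemma phi01K y : phi01 (2 * y - 1) = y. Proof. by rewrite /phi01; field. Qed.
Lemma phi01E x : 2 * phi01 x - 1 = x. Proof. by rewrite /phi01; field. Qed.

Lemma model_iter n y : iter n F y = phi01 (iter n f (2 * y - 1)).
Proof. by elim: n => [|n IH]; [rewrite /= phi01K|rewrite !iterS IH /model phi01E]. Qed.

Lemma orbitE t : iter t F turn = phi01 (crit t).
Proof. by rewrite model_iter /Orbit.crit; congr (phi01 (iter _ _ _)); rewrite /turn; field. Qed.

Lemma I01E y : I01 R y <-> -1 <= 2 * y - 1 <= 1.
Proof. by rewrite /I01 /= in_itv /=; split => /andP[]; lra. Qed.

Lemma model_I01 n y : I01 R y -> I01 R (iter n F y).
Proof. by move=> /I01E y1; apply/I01E; rewrite model_iter phi01E (pmap_iter_range H). Qed.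

(** A polynomial form lets [derive_in_poly] supply the derivatives relative to each of the
    prescribed sets. *)
Definition model_poly : {poly R} := lam%:P - lam *: (2%:P * 'X - 1) ^+ l.

Lemma model_polyE y : F y = model_poly.[y].
Proof. by rewrite /model_poly !hornerE /model /phi01 /pmap /lam; field. Qed.

Lemma model_continuous : continuous F.
Proof.
have -> : F = horner model_poly by apply/funext => y; rewrite model_polyE.
exact: horner_continuous.
Qed.

Fixpoint iter_poly n : {poly R} := if n is n'.+1 then model_poly \Po iter_poly n' else 'X.

Lemma iter_polyE n y : iter n F y = (iter_poly n).[y].
Proof. by elim: n => [|n IH] /=; [rewrite hornerX|rewrite IH model_polyE horner_comp]. Qed.

Lemma model_deriv y : model_poly^`().[y] = - (lam * l%:R * 2 * (2 * y - 1) ^+ l.-1).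
Proof.
rewrite /model_poly derivB derivC derivZ deriv_exp derivB derivC derivM derivC derivX.
by rewrite !hornerE hornerMn !hornerE -mulr_natr; ring.
Qed.

Lemma model_incr x y : 0 <= x -> x < y -> y <= turn -> F x < F y.
Proof.
move=> x0 xy y1; rewrite /model /phi01 ltr_pM2r ?invr_gt0// ltrD2l /pmap ltrD2l ltrN2 ltr_pM2l; last by have := a0; lra.
rewrite -(even_exp H (2 * y - 1)) -(even_exp H (2 * x - 1)) ltrXn2r ?nnegrE ?expn_eq0//; move: y1; rewrite /turn; lra.
Qed.

Lemma model_decr x y : turn <= x -> x < y -> y <= 1 -> F y < F x.
Proof.
move=> x0 xy y1; rewrite /model /phi01 ltr_pM2r ?invr_gt0// ltrD2l /pmap ltrD2l ltrN2 ltr_pM2l; last by have := a0; lra.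
rewrite ltrXn2r ?nnegrE ?expn_eq0//; move: x0; rewrite /turn; lra.
Qed.

Lemma model_unimodal : unimodal F turn.
Proof.
have c1 : 0 < turn < 1 by rewrite /turn; lra.
have t1 : turn < 1 by lra.
split.
- by move=> _ [y Iy <-]; exact: (model_I01 1 Iy).
- exact: continuous_subspaceT model_continuous.
- split.
    split => // x y; rewrite !in_itv /= => /andP[x0 x1] /andP[y0 y1] xy.
      exact: model_incr.
    exact: model_decr.
  move=> c' [/andP[c'0 c'1] inc dec]; apply/eqP; rewrite eq_le; apply/andP; split.
    rewrite leNgt; apply/negP => cc; have : F c' < F turn by apply: model_incr => //; exact: ltW.
    rewrite ltNge => /negP; apply; apply/ltW/dec => //; rewrite in_itv/=; lra.
  rewrite leNgt; apply/negP => cc; have : F c' < F turn by apply: model_decr => //; exact: ltW.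
  by rewrite ltNge => /negP; apply; apply/ltW/inc => //; rewrite in_itv/=; lra.
Qed.

Lemma affine_diffeo (r s : R) : r != 0 ->
  local_diffeo 3 0 s (fun x => r * x + s) (fun y => (y - s) / r).
Proof.
move=> r0; exists setT, setT; split.
- by split; exact: openT.
- by split => //; rewrite mulr0 add0r.
- split => //; first by move=> x y _ _ /addIr/(mulfI r0).
  by move=> y _; exists ((y - s) / r) => //; rewrite mulrC divfK// subrK.
- by move=> x _; rewrite addrK mulrC mulKf.
- split.
    apply: (@Cn_on_poly _ _ _ _ (r *: 'X + s%:P)); first exact: thick_setT.
    by move=> y _; rewrite !hornerE.
  apply: (@Cn_on_poly _ _ _ _ (r^-1 *: ('X - s%:P))); first exact: thick_setT.
  by move=> y _; rewrite !hornerE mulrC.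
Qed.

Lemma model_class_A : class_A F turn.
Proof.
have lam0 : 0 < lam by rewrite /lam; have := a0; lra.
split; first exact: model_unimodal.
- apply: (@Cn_on_poly _ _ _ _ model_poly); first exact: thick_punctured.
  by move=> y _; exact: model_polyE.
- move=> x Ix; have [_ ->] := derive_in_poly (@thick_punctured R turn) Ix (fun y _ => model_polyE y).
  rewrite model_deriv oppr_eq0 mulf_neq0//.
    apply: mulf_neq0; last by rewrite pnatr_eq0.
    by apply: mulf_neq0; [rewrite gt_eqF|rewrite pnatr_eq0 expn_eq0].
  apply: expf_neq0; rewrite subr_eq0; apply/eqP => x2; case: Ix => _; apply; rewrite /turn /=; lra.
(* Affine charts suffice: [F (x / 2 + turn) - F turn = - lam x^l] for all [x]. *)
- exists (fun x => 1 / 2 * x + turn), (fun y => (y - turn) / (1 / 2)),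
    (fun x => - lam * x + F turn), (fun y => (y - F turn) / - lam), l%:R; split.
  + by apply: affine_diffeo; rewrite gt_eqF.
  + by apply: affine_diffeo; rewrite oppr_eq0 gt_eqF.
  + by rewrite -[X in X < _]/(1%:R) ltr_nat -[1%N](expn0 2) ltn_exp2l// (tame_l H).
  + near=> x; rewrite powR_mulrn// -normrX; congr `|_|.
    rewrite /model /phi01 /turn /pmap.
    have -> : 2 * (1 / 2 * x + 1 / 2) - 1 = x by field.
    have -> : 2 * (1 / 2) - 1 = 0 :> R by field.
    rewrite expr0n gtn_eqF ?expn_gt0//= mulr0 /lam; field.
    by rewrite gt_eqF//; have := a0; lra.
Unshelve. all: by end_near.
Qed.

(** In the coordinate of [f], -1 is a fixed point with derivative [(1 + a) l > 2], and 1 is sent to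
    it and is not periodic. Interior periodic points are those of [periodic_repelling]. *)
Lemma model_repelling p n : I01 R p -> has_period F p n -> hyperbolic_repelling F p n.
Proof.
move=> Ip [n0 np mini]; have [dI dE] := derive_in_poly (@thick_I01 R) Ip (fun y _ => iter_polyE n y).
split => //; rewrite dE; have /I01E x1 := Ip.
have fp : iter n f (2 * p - 1) = 2 * p - 1 by rewrite -[RHS]phi01E phi01K -{2}np model_iter phi01E.
have fm1 x : x ^+ l = 1 -> f x = -1 by move=> xl; rewrite /pmap xl; ring.
have m1l : (-1) ^+ l = 1 :> R by rewrite (even_exp H) expr1n.
have [p0|p0] := eqVneq (2 * p - 1) (-1).
  have n1 : n = 1%N.
    apply/eqP; rewrite eqn_leq n0 andbT leqNgt; apply/negP => n1.
    have := mini 1%N; rewrite n1 /= /model p0 fm1// => /(_ isT)/eqP; apply.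
    by rewrite -p0 phi01K.
  have l2 : 2 <= l%:R :> R by rewrite ler_nat -[X in (X <= _)%N](expn1 2) leq_exp2l// (tame_l H).
  have a0' := a0; have al : 1 * 2 < (1 + a) * l%:R.
    by apply: (@lt_le_trans _ _ ((1 + a) * 2)); [rewrite ltr_pM2r//; lra|rewrite ler_pM2l//; lra].
  have lamE : lam * l%:R * 2 = (1 + a) * l%:R by rewrite /lam; field.
  rewrite n1 /= comp_polyXr model_deriv p0 normrN normrM normrX normrN1 expr1n mulr1 lamE.
  by rewrite gtr0_norm; lra.
have [p1|p1] := eqVneq (2 * p - 1) 1.
  have it k : iter k.+1 f 1 = -1.
    by elim: k => [|k IH]; [rewrite /= fm1// expr1n|rewrite iterS IH fm1].
  by move: fp; rewrite p1; case: n n0 {np mini dI dE} => // k _; rewrite it => /eqP; rewrite eq_sym -subr_eq0 opprK gt_eqF.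
pose r : {poly R} := 2 *: (iter_poly n \Po (2^-1 *: ('X + 1))) - 1.
have rE x : iter n f x = r.[x].
  rewrite /r !hornerE horner_comp !hornerE -iter_polyE model_iter phi01E; congr (iter _ _ _).
  by field.
have -> : (iter_poly n)^`().[p] = r^`().[2 * p - 1].
  rewrite /r derivB derivC derivZ deriv_comp derivZ derivD derivX derivC !hornerE horner_comp !hornerE subrK.
  have -> : 2^-1 * (2 * p) = p by field.
  set d := _^`().[p]; suff : d = 2 * d * 2^-1 * 1 - 0 by [].
  by field.
apply: (periodic_repelling H _ n0 fp); first by move: x1; rewrite !le_eqVlt eq_sym (negbTE p0) (negbTE p1).
apply: cvg_trans (@poly_diff_quot _ r (2 * p - 1)); apply: near_eq_cvg.
by near=> y; rewrite !rE.
Unshelve. all: by end_near.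
Qed.

Lemma phi01_dist x y : `|phi01 x - phi01 y| = `|x - y| / 2.
Proof.
have -> : phi01 x - phi01 y = (x - y) / 2 by rewrite /phi01; field.
by rewrite normrM [`|2^-1|]gtr0_norm// invr_gt0.
Qed.

Lemma model_close (e : R) : 0 < e -> exists n, forall t t', (0 < t)%N -> (0 < t')%N ->
  t = t' %[mod 3 ^ n] -> `|iter t F turn - iter t' F turn| < e.
Proof.
move=> e0; have [n close] := crit_close H e0; exists n => t t' t0 t'0 tt.
rewrite !orbitE phi01_dist; have := close t t' t0 t'0 tt.
have := normr_ge0 (crit t - crit t'); lra.
Qed.

Lemma model_sign t : (0 < t)%N -> 0 < (-1) ^+ kneadneg t * (iter t F turn - turn).
Proof.
move=> t0; rewrite orbitE (_ : phi01 (crit t) - turn = crit t / 2); last by rewrite /phi01 /turn; field.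
by rewrite mulrA divr_gt0// (crit_sign H).
Qed.

Lemma model_uniq y : F y = F turn -> y = turn.
Proof.
rewrite /model /phi01 => /(mulIf _); rewrite invr_eq0 pnatr_eq0 => /(_ isT)/addrI.
have -> : 2 * turn - 1 = 0 by rewrite /turn; field.
rewrite /pmap => /addrI/oppr_inj; rewrite expr0n gtn_eqF ?expn_gt0//= mulr0 => /eqP.
rewrite mulf_eq0 gt_eqF ?expf_eq0 ?expn_gt0/=; last by have := a0; lra.
by rewrite subr_eq0 => /eqP y1; rewrite /turn; lra.
Qed.

Let near := omega_near model_continuous model_close model_uniq.

Lemma model_attracting : attracting F (omega F turn).
Proof.
split.
- move=> q qX; have cI : closed (I01 R) by exact: itv_closed.
  apply: cI => B nB; have tail : (iter n F turn @[n --> \oo]) (I01 R).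
    by exists 0%N => // n _ /=; apply: model_I01; apply/I01E; rewrite /turn; lra.
  exact: qX tail nB.
- exact: (omega_compact model_continuous model_close model_uniq).
- exact: (omega_image model_continuous model_close model_uniq).
- have [K0 [k0 [kap [K00 kB kK pos]]]] := survive H.
  apply: (lt_le_trans pos); apply: leb_le => _ [x [xk nlow] <-].
  have Zk1 i : Zk i <= 1 by rewrite -(Zk0 m a) (Z_noninc a0 a1 admK).
  have xr : -1 <= x <= 1.
    have /andP[x1 x2] := xk; have := Zk1 k0; have := Z_gt0 a0 a1 admK k0.+1; lra.
  split; first by apply/I01E; rewrite phi01E.
  apply: near => e e0; have [T TP] := survive_near H K00 kK kB xk nlow e0.
  exists T => t /TP[s sP]; exists s; rewrite -/(phi01 x) model_iter phi01E orbitE phi01_dist.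
  have := normr_ge0 (iter t f x - crit s); lra.
Qed.

Lemma omega_nonempty x : I01 R x -> omega F x !=set0.
Proof.
move=> Ix; have cI : compact (I01 R) by exact: segment_compact.
have [|q [_ qx]] := cI (iter n F x @[n --> \oo]) _; last by exists q.
by exists 0%N => // n _ /=; exact: model_I01.
Qed.

(** A smaller attractor would have a nonempty basin, hence contain an omega-limit point and be all
    of the set by minimality of the odometer. *)
Lemma model_metric_attractor : metric_attractor F (omega F turn).
Proof.
split; first exact: model_attracting.
move=> Y [YX XY] [_ cY FY posY]; apply: XY.
have [x [Ix xY]] : basin F Y !=set0.
  by apply/set0P/eqP => b0; move: posY; rewrite b0 leb0 ltxx.
have [q qx] := omega_nonempty Ix.
rewrite (omega_minimal model_continuous model_close model_uniq _ _ FY YX)//.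
  by apply: compact_closed => //; exact: Rhausdorff.
by exists q; exact: xY.
Qed.

(** Suppose that [F^i (I)], [0 < i < s], contains the turning point. By connectedness it contains
    the points between [turn] and [F^i turn], which differ, and so it overlaps the interior of [I].
    Hence points of [I] reach [turn] only at multiples of [s], as [not_renorm] assumes. *)
Lemma model_not_renorm : ~ infinitely_renormalizable F turn.
Proof.
move=> /(_ 2%N)[s [u [v [_ [[uvI cin] s2 disj inv _]]]]].
have [r r0 rb] : exists2 r : R, 0 < r & forall y, `|turn - y| < r -> u <= y <= v.
  have /nbhs_ballP[r /= r0 rb] : nbhs turn `[u, v]%classic by [].
  by exists r => // y ry; have := rb y ry; rewrite /= in_itv.
have uv : u <= turn <= v by apply: rb; rewrite subrr normr0.
have uc : u < turn by have := rb (turn - r / 2); rewrite opprB addrC subrK gtr0_norm ?divr_gt0//; lra.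
have cv : turn < v.
  have := rb (turn + r / 2); rewrite opprD addrA subrr add0r normrN gtr0_norm ?divr_gt0//; lra.
have /I01E u1 : I01 R u by apply: uvI; rewrite /= in_itv/= lexx; lra.
have /I01E v1 : I01 R v by apply: uvI; rewrite /= in_itv/= lexx; lra.
have tI : `[u, v]%classic turn by rewrite /= in_itv.
have invP j w : `[u, v]%classic w -> `[u, v]%classic (iter (j * s) F w).
  move=> wI; elim: j => [//|j IH]; rewrite mulSn iterD; apply: inv.
  by exists (iter (j * s) F w).
have not0 i w : (0 < i < s)%N -> `[u, v]%classic w -> iter i F w <> turn.
  move=> /andP[i0 is_] wI wt.
  have ci : iter i F turn != turn.
    by have := model_sign i0; apply: contraTneq => ->; rewrite subrr mulr0 ltxx.
  have ic : {within `[Num.min w turn, Num.max w turn], continuous (iter i F)}.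
    apply: continuous_subspaceT => y; elim: (i) => [|k IH]; first exact: cvg_id.
    exact: (@continuous_comp _ _ _ (iter k F) F y IH (@model_continuous _)).
  have sub : `[Num.min w turn, Num.max w turn]%classic `<=` `[u, v]%classic.
    move: wI tI; rewrite /= !in_itv /= => wI tI y; rewrite /= !in_itv /=.
    by rewrite ge_min le_max => /andP[/orP[h1|h1] /orP[h2|h2]]; lra.
  pose z := iter i F turn.
  have conn y : Num.min turn z < y < Num.max turn z -> (iter i F @` `[u, v]%classic) y.
    move=> /andP[y1 y2]; have mM : Num.min w turn <= Num.max w turn by rewrite ge_min !le_max lexx.
    have yb : Num.min (iter i F (Num.min w turn)) (iter i F (Num.max w turn)) <= y <=
        Num.max (iter i F (Num.min w turn)) (iter i F (Num.max w turn)).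
      have [wt'|wt'] := leP w turn.
        rewrite wt -/z.
        by rewrite (ltW y1) (ltW y2).
      rewrite wt -/z minC maxC.
      by rewrite (ltW y1) (ltW y2).
    by have [x xI <-] := IVT mM ic yb; exists x => //; apply: sub.
  have : exists y, (iter 0 F @` `[u, v]%classic)° y /\ (iter i F @` `[u, v]%classic)° y.
    pose p := Num.max (Num.min turn z) u; pose q := Num.min (Num.max turn z) v.
    have pq : p < q.
      rewrite /p /q gt_max !lt_min; have [zt|zt|ze] := ltgtP z turn; last by move: ci; rewrite -/z ze eqxx.
        by rewrite zt (lt_trans zt cv) uc (lt_trans uc cv).
      by rewrite cv (lt_trans uc zt) (lt_trans uc cv) zt.
    have mid y : p < y < q -> Num.min turn z < y < Num.max turn z /\ u <= y <= v.
      by rewrite /p /q gt_max lt_min => /andP[/andP[-> h1] /andP[-> h2]]; rewrite !ltW.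
    exists ((p + q) / 2).
    have op : nbhs ((p + q) / 2) `]p, q[%classic.
      by apply: open_nbhs_nbhs; split; [exact: itv_open|rewrite /= in_itv/=; lra].
    split; apply: filterS op => y; rewrite /= in_itv /= => /mid[h1 h2]; last exact: conn.
    by exists y => //; rewrite /= in_itv.
  have d := disj 0%N i; rewrite i0 is_ in d; move=> [y [y0 yi]].
  by have : ((iter 0 F @` `[u, v]%classic)° `&` (iter i F @` `[u, v]%classic)°) y by []; rewrite d.
have : s = 1%N.
  apply: (not_renorm H (p := 2 * u - 1) (q := 2 * v - 1)); try (by move: uc cv; rewrite /turn; lra).
    move=> x xI; have xI' : `[u, v]%classic (phi01 x) by rewrite /= in_itv/= /phi01; lra.
    have := invP 1%N _ xI'; rewrite mul1n model_iter phi01E /= in_itv/= /phi01; lra.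
  move=> x j xI jx; rewrite /dvdn; have [//|j0] := posnP (j %% s).
  have xI' : `[u, v]%classic (phi01 x) by rewrite /= in_itv/= /phi01; lra.
  have sl : (j %% s < s)%N by rewrite ltn_pmod// (leq_trans _ s2).
  have := not0 (j %% s)%N _ _ (invP (j %/ s)%N _ xI'); rewrite j0 sl => /(_ isT); case.
  by rewrite -iterD addnC -divn_eq model_iter phi01E jx /phi01 /turn addr0.
by move=> s1; rewrite s1 in s2.
Qed.

End Model.

Theorem theorem6p1 (R : realType) :
  exists (f : R -> R) (c : R),
    [/\ class_A_star f c,
        wild_attractor f c (omega f c),
        exists alpha : nat -> nat,
          (forall i, (2 <= alpha i)%N) /\
          conjugate_on f (omega f c) (@adding_machine alpha) &
        equicontinuous_on f (omega f c)].
Proof.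
have [m [a [A [b [K [J H]]]]]] := @tame_exists R.
have Fc := @model_continuous R m a; have close := model_close H; have uniq := model_uniq H.
have sgn := model_sign H.
exists (model m a), (@turn R); split.
- split; first exact: (model_class_A H).
  exact: (model_repelling H).
- split; [exact: (model_class_A H)|exact: (model_not_renorm H)|].
  split; first exact: (model_metric_attractor H).
  exact: (omega_cantor Fc close sgn uniq).
- by exists three; split => //; exact: (omega_conjugate Fc close sgn uniq).
- exact: (omega_equicontinuous Fc close sgn uniq).
Qed.
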